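(* Let $T,\gamma>0$ be fixed, let $\varepsilon_N>0$ be such that $\varepsilon_N\to0$ as $N\to\infty$, and let $\vartheta$, $F$, the data and the solutions $x^{(N)}$ ($N\ge1$) of the microscopic traffic model with $\zeta=\vartheta$ and parameter $\varepsilon=\varepsilon_N$ be as in the context, with interpolants $\rho^N,e_1^N$ as defined there. Then, up to a (nonrelabelled) subsequence, the following convergences hold as $N\to\infty$: (a) $x_0^{(N)}\to\underline x$ and $x_N^{(N)}\to\overline x$ uniformly in $[0,T]$; (b) $\rho^N(0)\overset{*}{\rightharpoonup}\rho^0$ weakly$^*$ in $L^\infty(\mathbb{R})$; (c) $\rho^N\overset{*}{\rightharpoonup}\rho$ and $e_1^N\overset{*}{\rightharpoonup}e_1$ weakly$^*$ in $L^\infty((0,T)\times\mathbb{R})$; (d) $\frac{e_1^N}{\vartheta(\rho^N)}\,dt\,dx\overset{*}{\rightharpoonup}\frac1\gamma\rho F\,dt\,dx$ weakly$^*$ in $\mathcal{M}([0,T]\times\mathbb{R})$, for some limit objects $\underline x,\overline x,\rho^0,\rho,e_1$. Moreover, $\|\rho^0\|_{L^\infty(\mathbb{R})}\le\bar\rho$ and $\rho^0$ is nonnegative and has compact support; also, $\rho$ and $e_1$ are nonnegative, $\|\rho\|_{L^\infty((0,T)\times\mathbb{R})}\le\bar\rho$, and their supports are contained in $$\bigcup_{t\in[0,T]}\{t\}\times[\underline x(t),\overline x(t)].$$ Finally, the pair $(\rho,e_1)$ solves the transport equation with initial datum $\rho^0$ in the sense that for all $\varphi\in C^1([0,T]\times\mathbb{R})$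 with $\varphi(T)\equiv0$ one has $$\int_0^T\!\!\int_{\mathbb{R}}(\rho\,\partial_t\varphi+e_1\,\partial_x\varphi)\,dx\,dt=-\int_{\mathbb{R}}\rho^0\varphi(0)\,dx.$$
   Context: Notation: $a\vee b=\max\{a,b\}$; $\mathrm{int}$ is the interior; $\mathbf 1_A$ is the indicator function of $A$; $C^{0,1}$ denotes Lipschitz functions; $\mathcal{M}([0,T]\times\mathbb{R})$ is the set of Radon measures on $[0,T]\times\mathbb{R}$. Assumptions on the nonlinearities (independent of $N$). $\vartheta\in C^0([0,\infty))$ is nonnegative, there is $\bar\rho>0$ with $\vartheta(r)=0$ if and only if $r\ge\bar\rho$, and $\vartheta$ is Lipschitz continuous near $\bar\rho$. $F\in C^0([0,T]\times\mathbb{R})$ is positive, and $x\mapsto F(t,x)$ is Lipschitz continuous in $\mathbb{R}$ uniformly with respect to $t\in[0,T]$. The alertness function $\zeta$ of the model is taken equal to $\vartheta$. Data for each $N\ge1$. Initial positions $x_0^{0(N)}<\dots<x_N^{0(N)}$ with $\rho_i^{0(N)}:=\frac{1}{N(x_{i+1}^{0(N)}-x_i^{0(N)})}\le\bar\rho$ for $i=0,\dots,N-1$; $\Sigma^{0(N)}:=\{i\in\{0,\dots,N-1\}:\rho_i^{0(N)}=\bar\rho\}$; initial velocities $v_i^{0(N)}\ge0$ for $i\in\{0,\dots,N-1\}\setminus\Sigma^{0(N)}$ (written $i\notin\Sigma^{0(N)}$); a given leader trajectory $x_N^{(N)}\in C^1([0,T])$, nondecreasing, with $x_N^{(N)}(0)=x_N^{0(N)}$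 and $\dot x_N^{(N)}(t)>0$ for all $t\in(0,T]$. There are constants $s,S,C_0>0$ independent of $N$ such that $$s\le x_0^{0(N)}\le x_N^{(N)}(T)\le S,\qquad\sup_{i\notin\Sigma^{0(N)}}v_i^{0(N)}\le C_0,\qquad\sup_{t\in[0,T]}\dot x_N^{(N)}(t)\le C_0.$$ Microscopic solutions. For each $N$, $x^{(N)}=(x_0^{(N)},\dots,x_{N-1}^{(N)})\in C^{0,1}([0,T];\mathbb{R}^N)$ is a solution of the microscopic traffic model with $\zeta=\vartheta$ and $\varepsilon=\varepsilon_N$; that is, with $\rho_i^{(N)}(t):=\frac{1}{N(x_{i+1}^{(N)}(t)-x_i^{(N)}(t))}$, for every $i=0,\dots,N-1$ (superscripts $(N)$ omitted): (1) $x_i(0)=x_i^0$; (2) $x_i$ is nondecreasing in $[0,T]$; (3) $x_i(t)<x_{i+1}(t)$ and $\rho_i(t)\le\bar\rho$ for all $t\in[0,T]$; (4) $x_i$ is $C^2$ in the relatively open set $\{t\in[0,T]:\rho_i(t)<\bar\rho\}$, where $\varepsilon_N\vartheta(\rho_i(t))\ddot x_i(t)+\gamma\dot x_i(t)=\vartheta(\rho_i(t))F(t,x_i(t))$; (5) $x_i$ is $C^1$ in $\mathrm{int}\{t\in[0,T]:\rho_i(t)=\bar\rho\}$, where $\gamma\dot x_i(t)=\vartheta(\rho_i(t))F(t,x_i(t))$; (6) $\dot x_i(0)=v_i^0$ if $i\notin\Sigma^0$. In addition, $x^{(N)}$ satisfies, for a.e. $t\in(0,T)$ and $i=0,\dots,N-1$,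 $$\dot x_i^{(N)}(t)\le\widetilde v_i^{0(N)}\vee\Big(\tfrac{\bar\vartheta}{\gamma}\max_{[0,T]\times[x_0^{0(N)},x_N^{(N)}(T)]}F\Big),$$ where $\widetilde v_i^{0(N)}=v_i^{0(N)}$ if $i\notin\Sigma^{0(N)}$, $\widetilde v_i^{0(N)}=0$ if $i\in\Sigma^{0(N)}$, and $\bar\vartheta=\max_{[0,\bar\rho]}\vartheta$. (Such solutions exist; under these assumptions they belong to $C^1([0,T];\mathbb{R}^N)\cap C^2((0,T];\mathbb{R}^N)$ and satisfy $\rho_i^{(N)}(t)<\bar\rho$ for $t\in(0,T]$, so the quantities below are well defined.) Interpolants. For $(t,x)\in[0,T]\times\mathbb{R}$ (superscripts $(N)$ omitted on the right): $$\rho^N(t,x):=\sum_{i=0}^{N-1}\rho_i(t)\mathbf 1_{[x_i(t),x_{i+1}(t))}(x),\qquad e_1^N(t,x):=\sum_{i=0}^{N-1}\rho_i(t)\dot x_i(t)\mathbf 1_{[x_i(t),x_{i+1}(t))}(x).$$ *)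

(* Defs.v *)
From HB Require Import structures.
From mathcomp Require Import all_boot all_order all_algebra.
From mathcomp Require Import all_classical all_reals all_analysis.

Set Implicit Arguments.
Unset Strict Implicit.
Unset Printing Implicit Defensive.

Import Order.TTheory GRing.Theory Num.Theory.
Import numFieldNormedType.Exports.

Local Open Scope classical_set_scope.
Local Open Scope ring_scope.

(** A function on [0, T] is represented by a total function R -> R whose values
    outside [0, T] are irrelevant.  Hence derivatives are taken relatively to a
    set A (in practice `[0, T]): at an interior point of A this is the ordinary
    derivative, at the endpoints of an interval the one-sided one. *)

Definition diff_quot_in (R : realType) (A : set R) (f : R -> R) (t : R) :
    set_system R :=
  (fun s => (f s - f t) / (s - t)) @ within A t^'.

Definition derivable_in (R : realType) (A : set R) (f : R -> R) (t : R) : Prop :=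
  cvg (diff_quot_in A f t).

Definition deriv_in (R : realType) (A : set R) (f : R -> R) (t : R) : R :=
  lim (diff_quot_in A f t).

(** f is C^1 (resp. C^2) in B, where B is a relatively open subset of A. *)

Definition C1_in (R : realType) (A B : set R) (f : R -> R) : Prop :=
  (forall t : R, B t -> derivable_in A f t) /\
  {within B, continuous (deriv_in A f)}.

Definition C2_in (R : realType) (A B : set R) (f : R -> R) : Prop :=
  C1_in A B f /\ C1_in A B (deriv_in A f).

Definition strip (R : realType) (T : R) : set (R * R) := `[0, T] `*` [set: R].

Definition open_strip (R : realType) (T : R) : set (R * R) :=
  `]0, T[ `*` [set: R].

Record nonlinearities (R : realType) (T rhobar : R) (theta : R -> R)
    (F : R * R -> R) : Prop := Nonlinearities {
  theta_continuous : {within `[0, +oo[, continuous theta} ;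
  theta_ge0 : forall r : R, 0 <= r -> 0 <= theta r ;
  rhobar_gt0 : 0 < rhobar ;
  theta_eq0 : forall r : R, 0 <= r -> (theta r = 0 <-> rhobar <= r) ;
  theta_lipschitz :
    exists2 d : R, 0 < d & [lipschitz theta r | r in ball rhobar d] ;
  F_continuous : {within strip T, continuous F} ;
  F_gt0 : forall z, strip T z -> 0 < F z ;
  F_lipschitz : exists L : R, forall t : R, t \in `[0, T] ->
    L.-lipschitz (fun y => F (t, y)) }.

(** For a fixed N, the positions x_0, ..., x_N are given by x : nat -> R -> R;
    x N is the leader and x i is irrelevant for N < i. *)

Definition density (R : realType) (N : nat) (x : nat -> R -> R) (i : nat)
    (t : R) : R :=
  (N%:R * (x i.+1 t - x i t))^-1.

Definition density0 (R : realType) (N : nat) (x0 : nat -> R) (i : nat) : R :=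
  (N%:R * (x0 i.+1 - x0 i))^-1.

Definition jammed0 (R : realType) (N : nat) (rhobar : R) (x0 : nat -> R) :
    set nat :=
  [set i | (i < N)%N /\ density0 N x0 i = rhobar].

Record admissible_data (R : realType) (T rhobar s S C0 : R) (N : nat)
    (x0 v0 : nat -> R) (xN : R -> R) : Prop := AdmissibleData {
  x0_increasing : forall i, (i < N)%N -> x0 i < x0 i.+1 ;
  density0_le : forall i, (i < N)%N -> density0 N x0 i <= rhobar ;
  v0_ge0 : forall i, (i < N)%N -> ~ jammed0 N rhobar x0 i -> 0 <= v0 i ;
  leader_C1 : C1_in `[0, T] `[0, T] xN ;
  leader_nondecreasing : {in `[0, T] &, nondecreasing_fun xN} ;
  leader_init : xN 0 = x0 N ;
  leader_speed_gt0 : forall t : R, t \in `]0, T] -> 0 < deriv_in `[0, T] xN t ;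
  positions_bounds : [/\ s <= x0 0%N, x0 0%N <= xN T & xN T <= S] ;
  v0_le : forall i, (i < N)%N -> ~ jammed0 N rhobar x0 i -> v0 i <= C0 ;
  leader_speed_le : forall t : R, t \in `[0, T] -> deriv_in `[0, T] xN t <= C0 }.

Record micro_solution (R : realType) (T gamma eps rhobar : R) (theta : R -> R)
    (F : R * R -> R) (N : nat) (x0 v0 : nat -> R) (x : nat -> R -> R) : Prop :=
    MicroSolution {
  sol_lipschitz : forall i, (i < N)%N -> [lipschitz x i t | t in `[0, T]] ;
  sol_init : forall i, (i < N)%N -> x i 0 = x0 i ;
  sol_nondecreasing : forall i, (i < N)%N ->
    {in `[0, T] &, nondecreasing_fun (x i)} ;
  sol_ordered : forall (i : nat) (t : R), (i < N)%N -> t \in `[0, T] ->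
    x i t < x i.+1 t /\ density N x i t <= rhobar ;
  sol_free : forall i, (i < N)%N ->
    let B := [set t : R | t \in `[0, T] /\ density N x i t < rhobar] in
    C2_in `[0, T] B (x i) /\
    forall t : R, B t ->
      eps * theta (density N x i t) * deriv_in `[0, T] (deriv_in `[0, T] (x i)) t
        + gamma * deriv_in `[0, T] (x i) t
      = theta (density N x i t) * F (t, x i t) ;
  sol_jammed : forall i, (i < N)%N ->
    let B := [set t : R | t \in `[0, T] /\ density N x i t = rhobar]° in
    C1_in `[0, T] B (x i) /\
    forall t : R, B t ->
      gamma * deriv_in `[0, T] (x i) t
      = theta (density N x i t) * F (t, x i t) ;
  sol_init_speed : forall i, (i < N)%N -> ~ jammed0 N rhobar x0 i ->
    deriv_in `[0, T] (x i) 0 = v0 i }.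

(** The suprema below are maxima of continuous functions on nonempty compact
    sets. *)
Definition speed_bound (R : realType) (T gamma rhobar : R) (theta : R -> R)
    (F : R * R -> R) (N : nat) (x0 v0 : nat -> R) (xN : R -> R) (i : nat) : R :=
  Num.max
    (if density0 N x0 i == rhobar then 0 else v0 i)
    (sup (theta @` `[0, rhobar]) / gamma
       * sup (F @` (`[0, T] `*` `[x0 0%N, xN T]))).

Definition speed_bounded (R : realType) (T gamma rhobar : R) (theta : R -> R)
    (F : R * R -> R) (N : nat) (x0 v0 : nat -> R) (x : nat -> R -> R) : Prop :=
  {ae @lebesgue_measure R, forall t : R, t \in `]0, T[ ->
    forall i, (i < N)%N ->
      deriv_in `[0, T] (x i) t
      <= speed_bound T gamma rhobar theta F N x0 v0 (x N) i}.

Definition rho_interp (R : realType) (N : nat) (x : nat -> R -> R)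
    (z : R * R) : R :=
  \sum_(i < N) density N x i z.1 * \1_(`[x i z.1, x i.+1 z.1[%classic) z.2.

Definition e1_interp (R : realType) (T : R) (N : nat) (x : nat -> R -> R)
    (z : R * R) : R :=
  \sum_(i < N) density N x i z.1 * deriv_in `[0, T] (x i) z.1
    * \1_(`[x i z.1, x i.+1 z.1[%classic) z.2.

Notation leb1 R := (@lebesgue_measure R).
Notation leb2 R := (@lebesgue_measure R \x @lebesgue_measure R)%E.

(** L^oo(D) is identified with the functions of L^oo vanishing outside D. *)
Definition Linfty_on d (X : measurableType d) (R : realType)
    (mu : {measure set X -> \bar R}) (D : set X) (f : X -> R) : Prop :=
  (f \_ D : X -> R) \in Lfun mu +oo%E.

Definition weakstar_Linfty d (X : measurableType d) (R : realType)
    (mu : {measure set X -> \bar R}) (D : set X)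
    (u : nat -> X -> R) (f : X -> R) : Prop :=
  [/\ forall n, Linfty_on mu D (u n),
      Linfty_on mu D f &
      forall g : X -> R, mu.-integrable D (EFin \o g) ->
        (\int[mu]_(z in D) (u n z * g z)%:E @[n --> \oo]
          --> \int[mu]_(z in D) (f z * g z)%:E)%E].

Definition test_Cc (R : realType) (T : R) (psi : R * R -> R) : Prop :=
  {within strip T, continuous psi} /\
  compact (closure (strip T `&` [set z | psi z != 0])).

(** A locally integrable f on [0, T] x R stands for the Radon measure f dt dx;
    Radon measures on [0, T] x R act on C_c([0, T] x R). *)
Definition radon_density (R : realType) (T : R) (f : R * R -> R) : Prop :=
  forall K : set (R * R), compact K -> K `<=` strip T ->
    (leb2 R).-integrable K (EFin \o f).

Definition weakstar_measures (R : realType) (T : R)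
    (u : nat -> R * R -> R) (f : R * R -> R) : Prop :=
  [/\ forall n, radon_density T (u n),
      radon_density T f &
      forall psi, test_Cc T psi ->
        (\int[leb2 R]_(z in strip T) (psi z * u n z)%:E @[n --> \oo]
          --> \int[leb2 R]_(z in strip T) (psi z * f z)%:E)%E].

(** Support of (the a.e. class of) f, ae being the filter of sets of full
    measure: complement of the union of the open sets on which f = 0 a.e. *)
Definition ess_supp (X : topologicalType) (R : realType) (ae : set_system X)
    (f : X -> R) : set X :=
  [set z | forall U, open U -> U z -> ~ ae [set y | U y -> f y = 0]].

Definition partial_t (R : realType) (T : R) (phi : R * R -> R) (z : R * R) : R :=
  deriv_in `[0, T] (fun s => phi (s, z.2)) z.1.

Definition partial_x (R : realType) (phi : R * R -> R) (z : R * R) : R :=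
  derive1 (fun y => phi (z.1, y)) z.2.

Definition C1_strip (R : realType) (T : R) (phi : R * R -> R) : Prop :=
  [/\ {within strip T, continuous phi},
      forall z, strip T z ->
        derivable_in `[0, T] (fun s => phi (s, z.2)) z.1 /\
        derivable (fun y => phi (z.1, y)) z.2 1,
      {within strip T, continuous (partial_t T phi)} &
      {within strip T, continuous (partial_x phi)}].

Definition transport_solution (R : realType) (T : R) (rho0 : R -> R)
    (rho e1 : R * R -> R) : Prop :=
  forall phi : R * R -> R, C1_strip T phi -> (forall y, phi (T, y) = 0) ->
    (\int[leb1 R]_(t in `]0%R, T[) \int[leb1 R]_y
       (rho (t, y) * partial_t T phi (t, y)
        + e1 (t, y) * partial_x phi (t, y))%:E
     = - \int[leb1 R]_y (rho0 y * phi (0%R, y))%:E)%E.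

(* Main.v *)
(** The singular damping keeps every follower out of the jam for [t > 0], so its
    equation may be divided by [theta (rho_i)] and integrated: with
    [q_i = x_i' / theta (rho_i)],
      [\int_a^b (gamma q_i - F (t, x_i)) dt = eps_N (x_i' a - x_i' b)],
    which is [O(eps_N)] because the velocities are uniformly bounded.  Every cell
    carries the mass [1/N] and most cells are short, so pairing [rho^N], [e_1^N]
    and [e_1^N / theta (rho^N)] with a continuous [G] amounts, up to [o(1)], to
    averaging over [i] the integrals of [G (t, x_i)], [x_i' G (t, x_i)] and
    [q_i G (t, x_i)].  The transport equation is then the chain rule for
    [phi (t, x_i t)], and the limit of the flux follows by replacing [gamma q_i]
    by [F (t, x_i)], first for [G] frozen on a space-time grid.  Weak-star limits
    come from a diagonal extraction over rational quadrants and the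
    Radon-Nikodym theorem. *)

Require Import Defs.
From HB Require Import structures.
From mathcomp Require Import finmap all_boot all_order all_algebra.
From mathcomp Require Import all_classical all_reals all_analysis.
From mathcomp Require Import measurable_realfun ess_sup_inf lra ring.

Set Implicit Arguments.
Unset Strict Implicit.
Unset Printing Implicit Defensive.

Import Order.TTheory GRing.Theory Num.Theory.
Import numFieldNormedType.Exports.

Local Open Scope classical_set_scope.
Local Open Scope ring_scope.

(** What shapes the proof is that [q_i] has no bound uniform in [N]: [theta] degenerates near a jam,
    and cells may even start jammed. What survives is one-sided: [w_i = gamma q_i - F (t, x_i)] is
    at least minus the maximum of [F], because velocities are nonnegative, and its primitive
    [- eps_N x_i'] is bounded. Together these give integrability up to the endpoints of []0, T[] and
    an [L^1] bound uniform in [N], so the averaging estimates are stated for weights bounded in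
    [L^1] only. The errors have to be linear in the cell lengths, since single cells may be long and
    only their mean length is small; continuous functions therefore enter through
    [|G z - G z'| <= eta + K |z - z'|]. The escape from the jam is a logarithmic estimate on the
    gap, which uses that [theta] decays linearly at [rhobar]; to exclude a jam lasting an interval
    it also needs a predecessor in strict motion, so regularity is proved vehicle by vehicle from
    the leader backwards. In the limit of the flux the number of grid slots is fixed by the
    precision before [N] grows, so that its product with [eps_N] still tends to 0. *)

(** * Derivatives and continuity relative to a set *)

Lemma deriv_in_is_derive (R : realType) (A : set R) (f : R -> R) (t : R) :
  nbhs t A -> derivable_in A f t -> is_derive t 1 f (deriv_in A f t).
Proof.
move=> At dft; apply/is_derive1_caratheodory.
exists (fun s => if s == t then deriv_in A f t else (f s - f t) / (s - t)).
split; last by rewrite eqxx.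
  move=> s; case: eqP => [->|/eqP]; first by rewrite !subrr mulr0.
  by rewrite -subr_eq0 => /divfK->.
apply/continuous_withinNx; rewrite eqxx.
have cvgA : (fun s => (f s - f t) / (s - t)) @ within A t^' --> deriv_in A f t.
  exact: dft.
apply: cvg_trans; last exact: cvgA.
have -> : within A t^' = t^'.
  rewrite predeqE => P; split => wP.
    have {}wP : \forall s \near t, s != t -> A s -> P s := wP.
    have : \forall s \near t, s != t -> P s; last by [].
    by near=> s => st; apply: (near wP s) => //; near: s.
  have {}wP : \forall s \near t, s != t -> P s := wP.
  have : \forall s \near t, s != t -> A s -> P s; last by [].
  by apply: filterS wP => s h st _; exact: h.
apply: near_eq_cvg; rewrite near_withinE; near=> s => st.
by rewrite ifF //; apply/negbTE.
Unshelve. all: by end_near. Qed.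

Lemma within_continuous_at (R : realType) (V : topologicalType) (B : set V)
  (f : V -> R) (t : V) :
  nbhs t B -> {within B, continuous f} -> {for t, continuous f}.
Proof.
move=> Bt /subspace_continuousP /(_ t (nbhs_singleton Bt)).
by rewrite (within_interior Bt).
Qed.

Lemma C1_in_at (R : realType) (A B : set R) (f : R -> R) (t : R) :
  nbhs t A -> nbhs t B -> C1_in A B f ->
  is_derive t 1 f (deriv_in A f t) /\ {for t, continuous (deriv_in A f)}.
Proof.
move=> At Bt [dB cB]; split; last exact: within_continuous_at cB.
by apply: deriv_in_is_derive => //; apply: dB; exact: nbhs_singleton.
Qed.

Lemma lipschitzW (R : realType) (A : set R) (f : R -> R) :
  [lipschitz f x | x in A] -> exists2 K, 0 < K &
  forall a b, A a -> A b -> `|f a - f b| <= K * `|a - b|.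
Proof.
move=> [M [Mr hM]]; exists (Num.max (M + 1) 1); first by rewrite lt_max ltr01 orbT.
move=> a b Aa Ab.
apply: (hM (Num.max (M + 1) 1) _ (a, b)) => //.
by rewrite lt_max ltrDl ltr01.
Qed.

Lemma lipschitz_within_continuous (R : realType) (A : set R) (f : R -> R) (K : R) :
  (forall a b, A a -> A b -> `|f a - f b| <= K * `|a - b|) ->
  {within A, continuous f}.
Proof.
move=> hK; apply/subspace_continuousP => t At.
apply/cvgrPdist_le => e e0; rewrite near_withinE.
have K0 : 0 < `|K| + 1 by rewrite ltr_wpDl.
near=> u => Au; apply: le_trans (hK _ _ At Au) _.
apply: (@le_trans _ _ ((`|K| + 1) * `|t - u|)).
  by rewrite ler_wpM2r// (le_trans (ler_norm K))// lerDl.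
rewrite mulrC -ler_pdivlMr//; near: u.
by apply: cvgr_dist_le; [exact: cvg_id|rewrite divr_gt0].
Unshelve. all: by end_near. Qed.

Lemma is_derive_derivable (R : realType) (f : R -> R) (t d : R) :
  is_derive t 1 f d -> derivable f t 1.
Proof. by case. Qed.

Lemma is_derive_continuous (R : realType) (f : R -> R) (t d : R) :
  is_derive t 1 f d -> {for t, continuous f}.
Proof. by case=> df _; apply/differentiable_continuous/derivable1_diffP. Qed.

Lemma is_derive_derive1 (R : realType) (f : R -> R) (t d : R) :
  is_derive t 1 f d -> derive1 f t = d.
Proof. by case=> _ <-; rewrite derive1E. Qed.

Lemma is_derive_unique (R : realType) (f : R -> R) (t d d' : R) :
  is_derive t 1 f d -> is_derive t 1 f d' -> d = d'.
Proof. by move=> /is_derive_derive1 <- /is_derive_derive1 <-. Qed.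

(** * Avoidance of the jam by a follower behind a moving predecessor *)

Lemma MVT_le0 (R : realType) (f df : R -> R) (a b : R) : a <= b ->
  (forall t, t \in `[a, b] -> is_derive t 1 f (df t)) ->
  (forall t, t \in `[a, b] -> df t <= 0) -> f b <= f a.
Proof.
move=> ab fdf df0.
have fdf' t : t \in `]a, b[ -> is_derive t 1 f (df t).
  by move=> tab; apply: fdf; move: tab; rewrite !in_itv/= => /andP[/ltW-> /ltW->].
have cf : {within `[a, b], continuous f}.
  apply: derivable_within_continuous => t tab.
  exact: is_derive_derivable (fdf _ tab).
have [c cab fE] := MVT_segment ab fdf' cf.
by rewrite -subr_le0 fE mulr_le0_ge0 ?subr_ge0// df0.
Qed.

(** The function [eps v - (gamma / K) ln h - Fm t] is nonincreasing: the equation divided by [th]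
    gives [eps v' = f - gamma v / th], and [th <= K h] makes the damping dominate the term
    [(gamma / K) v / h] coming from the logarithm. As [eps v >= 0], this bounds [ln h] from below on
    the second half of the interval. *)
Lemma gap_bounded_below (R : realType) (a b eps gamma K Fm : R)
    (h v w dv th f : R -> R) :
  a < b -> 0 < eps -> 0 < gamma -> 0 < K -> 0 <= Fm ->
  (forall t, t \in `]a, b[ ->
    [/\ 0 < h t, is_derive t 1 h (w t - v t), is_derive t 1 v (dv t),
        0 <= w t & 0 <= v t]) ->
  (forall t, t \in `]a, b[ ->
    [/\ 0 < th t, th t <= K * h t, f t <= Fm &
        eps * th t * dv t + gamma * v t = th t * f t]) ->
  exists2 c, 0 < c & forall t, (a + b) / 2 <= t < b -> c <= h t.
Proof.
move=> ab e0 g0 K0 Fm0 H1 H2.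
pose G := eps *: v - (gamma / K) *: (@ln R \o h) - Fm *: (id : R -> R).
pose dG t := eps *: dv t - (gamma / K) *: ((h t)^-1 * (w t - v t)) - Fm *: (1 : R).
have dGP t : t \in `]a, b[ -> is_derive t 1 G (dG t).
  move=> tab; have [h0 dh dvt _ _] := H1 _ tab.
  have dln : is_derive t 1 (@ln R \o h) ((h t)^-1 * (w t - v t)).
    exact: (is_derive1_comp (is_derive1_ln h0) dh).
  exact: (is_deriveB (is_deriveB (is_deriveZ _ dvt) (is_deriveZ _ dln))
    (is_deriveZ _ (is_derive_id _ _))).
have dG0 t : t \in `]a, b[ -> dG t <= 0.
  move=> tab; have [h0 _ _ w0 v0] := H1 _ tab.
  have [th0 thK fF eqt] := H2 _ tab.
  (* All three terms are nonpositive, the last one because [th <= K h]. *)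
  have -> : dG t = (f t - Fm) - gamma / K * (w t / h t)
      - (gamma * v t) * ((th t)^-1 - (K * h t)^-1).
    have k0 : K != 0 by rewrite gt_eqF.
    have hn0 : h t != 0 by rewrite gt_eqF.
    have t0 : th t != 0 by rewrite gt_eqF.
    have E : eps * dv t = f t - gamma * v t / th t.
      have -> : f t = (th t * f t) / th t by field.
      by rewrite -eqt; field.
    rewrite /dG /GRing.scale/= E; field.
    by rewrite hn0 t0 k0.
  have p1 : 0 <= gamma / K * (w t / h t).
    by rewrite !mulr_ge0// ?invr_ge0 ltW.
  have p2 : 0 <= gamma * v t * ((th t)^-1 - (K * h t)^-1).
    rewrite !mulr_ge0// ?(ltW g0)// subr_ge0 lef_pV2//.
    by rewrite posrE mulr_gt0.
  by move: fF p1 p2; lra.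
have gK : 0 < gamma / K by rewrite divr_gt0.
pose m := (a + b) / 2.
have am : a < m by rewrite midf_lt.
(* The constant is read off from [G t <= G m], with [eps v t >= 0] and [t <= |b|]. *)
exists (expR (- (G m + Fm * (`|b|)) / (gamma / K))); first exact: expR_gt0.
move=> t /andP[mt tb].
have tab : t \in `]a, b[ by rewrite in_itv/= tb andbT (lt_le_trans am).
have [h0 _ _ _ v0] := H1 _ tab.
rewrite -[leRHS]lnK// ler_expR ler_pdivrMr//.
have sub u : u \in `[m, t] -> u \in `]a, b[.
  rewrite !in_itv/= => /andP[mu ut].
  by rewrite (lt_le_trans am)//= (le_lt_trans ut).
have : G t <= G m.
  exact: (MVT_le0 mt (fun u ui => dGP u (sub u ui)) (fun u ui => dG0 u (sub u ui))).
have -> : G t = eps * v t - gamma / K * ln (h t) - Fm * t by [].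
have : 0 <= eps * v t by rewrite mulr_ge0// ltW.
have : Fm * t <= Fm * `|b|.
  by rewrite ler_wpM2l// (le_trans (ltW tb))// ler_norm.
rewrite [ln _ * _]mulrC; lra.
Qed.

(** The infimum of the zero set is itself a zero by continuity; for the gap, it is the end of the
    free phase that starts at [a]. *)
Lemma first_zero (R : realType) (h : R -> R) (a c : R) : a < c ->
  (forall t, a <= t <= c -> {for t, continuous h}) ->
  0 < h a -> h c = 0 ->
  exists b, [/\ a < b <= c, h b = 0 & forall t, a <= t < b -> h t != 0].
Proof.
move=> ac ch ha hc.
pose A := [set t | a <= t <= c /\ h t = 0].
have Ac : A c by split=> //; rewrite lexx ltW.
have Alb : lbound A a by move=> t [/andP[]].
have Ainf : has_inf A by split; [exists c | exists a].
have aA : a <= inf A by apply: lb_le_inf => //; exists c.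
have Aci : inf A <= c by apply: ge_inf => //; exists a.
have h0 : h (inf A) = 0.
  apply/eqP; apply: contrapT => /negP hb0.
  have /cvgrPdist_lt/(_ `|h (inf A)|) := ch (inf A) (introT andP (conj aA Aci)).
  rewrite normr_gt0 => /(_ hb0) /nbhs_ballP[e /= e0 he].
  have [u Au uA] := inf_adherent e0 Ainf.
  have [_ hu] := Au.
  have iu : inf A <= u by apply: ge_inf => //; exists a.
  have /he : ball (inf A) e u.
    by rewrite /ball/= distrC ger0_norm ?subr_ge0// ltrBlDl.
  by rewrite /= hu subr0 ltxx.
exists (inf A); split => //.
  rewrite Aci andbT lt_neqAle aA andbT; apply/negP => /eqP aE.
  by move: ha; rewrite aE h0 ltxx.
move=> t /andP[at_ tA]; apply/negP => /eqP ht.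
suff : inf A <= t by rewrite leNgt tA.
by apply: ge_inf; [exists a | split => //; rewrite at_ (le_trans (ltW tA))].
Qed.

(* A jam cannot fill an interval, since the predecessor moves; and at the end
   of a free phase the singular damping would make [ln] of the gap bounded
   below. *)
Lemma follower_free (R : realType) (T eps gamma K delta Fm d0 : R)
    (x y v w dv th f : R -> R) :
  0 < eps -> 0 < gamma -> 0 < K -> 0 <= Fm -> 0 < delta ->
  (forall t, t \in `]0, T[ ->
    [/\ {for t, continuous x}, x t + d0 <= y t, is_derive t 1 y (w t),
        0 < w t & f t <= Fm]) ->
  (forall t, t \in `]0, T[ -> x t + d0 < y t ->
    [/\ is_derive t 1 x (v t), is_derive t 1 v (dv t), 0 <= v t, 0 < th t &
        eps * th t * dv t + gamma * v t = th t * f t]) ->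
  (forall t, t \in `]0, T[ -> x t + d0 < y t < x t + d0 + delta ->
    th t <= K * (y t - x t - d0)) ->
  (forall t, t \in `]0, T[ -> (\forall u \near t, y u = x u + d0) ->
    is_derive t 1 x 0) ->
  forall t, t \in `]0, T[ -> x t + d0 < y t.
Proof.
move=> e0 g0 K0 Fm0 dl0 H1 H2 H3 H4 c cT.
have [_ hc _ _ _] := H1 c cT.
rewrite lt_neqAle hc andbT; apply/negP => /eqP jc.
have [c0 cT'] : 0 < c /\ c < T by move: cT; rewrite in_itv/= => /andP.
pose h := y - x - cst d0.
have hE t : h t = y t - x t - d0 by [].
have inT t : 0 < t -> t <= c -> t \in `]0, T[.
  by move=> t0 tc; rewrite in_itv/= t0 (le_lt_trans tc).
have cy t : t \in `]0, T[ -> {for t, continuous y}.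
  move=> tT; have [_ _ dy _ _] := H1 t tT.
  by apply/differentiable_continuous/derivable1_diffP; exact: ex_derive.
have ch t : t \in `]0, T[ -> {for t, continuous h}.
  move=> tT; have [cx _ _ _ _] := H1 t tT.
  apply: (@continuousB _ _ _ (y - x) (cst d0)); last exact: cvg_cst.
  by apply: continuousB => //; exact: cy.
have [a /andP[a0 ac] ha] : exists2 a, 0 < a < c & 0 < h a.
  apply: contrapT => hneg.
  have hz t : 0 < t -> t < c -> y t = x t + d0.
    move=> t0 tc; have [_ ht _ _ _] := H1 t (inT t t0 (ltW tc)).
    apply/eqP; rewrite eq_le ht andbT leNgt; apply/negP => ht'.
    apply: hneg; exists t; first by rewrite t0.
    by rewrite hE; move: ht'; lra.
  have m0 : 0 < c / 2 by lra.
  have mc : c / 2 < c by lra.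
  have mT := inT _ m0 (ltW mc).
  have near_m : \forall u \near c / 2, y u = x u + d0.
    near=> u; apply: hz; near: u; [exact: lt_nbhsr|exact: lt_nbhsl].
  have dx := H4 _ mT near_m.
  have dxd : is_derive (c / 2) 1 (x + cst d0) (0 + 0) by apply: is_deriveD.
  have [_ _ dy wm _] := H1 _ mT.
  have dy' : is_derive (c / 2) 1 y (0 + 0).
    by apply: near_eq_is_derive dxd; apply: filterS near_m => u ->.
  by move: wm; rewrite -(@derive_val _ _ _ _ _ _ _ dy) (@derive_val _ _ _ _ _ _ _ dy') addr0 ltxx.
have cont t : a <= t <= c -> {for t, continuous h}.
  by move=> /andP[at_ tc]; apply: ch; apply: inT => //; exact: lt_le_trans at_.
have hc0 : h c = 0 by rewrite hE -jc; lra.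
have [b [/andP[ab bc] hb hneq]] := first_zero ac cont ha hc0.
have b0 : 0 < b by exact: lt_trans ab.
have bT := inT _ b0 bc.
have hpos t : a <= t < b -> 0 < h t.
  move=> /[dup] atb /andP[at_ tb]; rewrite lt_neqAle eq_sym hneq//=.
  have tT : t \in `]0, T[.
    by apply: inT; [exact: lt_le_trans at_|exact: (le_trans (ltW tb))].
  by have [_ + _ _ _] := H1 _ tT; rewrite hE; lra.
have small e : 0 < e -> exists2 r, 0 < r & forall t, b - r < t < b -> h t < e.
  move=> e1; have /cvgrPdist_lt/(_ e e1)/nbhs_ballP[r /= r0 hr] := ch _ bT.
  exists r => // t /andP[rt tb]; have := hr t; rewrite hb sub0r normrN.
  rewrite /ball/= ger0_norm ?subr_ge0 ?(ltW tb)// => /(_ _)/ltr_normlW; apply.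
  by move: rt; lra.
have [r r0 hr] := small _ dl0.
(* Close enough to [b] the gap is below [delta], where the linear bound [th <= K h] of [H3] is
   available. *)
pose a' := Num.max a (b - r).
have a'b : a' < b by rewrite /a' gt_max ab/= ltrBlDr ltrDl.
have H t : t \in `]a', b[ -> [/\ t \in `]0, T[, 0 < h t & h t < delta].
  rewrite in_itv/= gt_max => /andP[/andP[at_ rt] tb]; split.
  - by apply: inT; [exact: lt_trans at_|exact: (le_trans (ltW tb))].
  - by apply: hpos; rewrite tb (ltW at_).
  - by apply: hr; rewrite rt tb.
have [||q q0 hq] := @gap_bounded_below R a' b eps gamma K Fm h v w dv th f
    a'b e0 g0 K0 Fm0.
- move=> t /H[tT ht _]; have [_ _ dy wt _] := H1 _ tT.
  have [|dx dvt v0 _ _] := H2 _ tT; first by move: ht; rewrite hE; lra.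
  split=> //; last exact: ltW.
  have -> : w t - v t = w t - v t - 0 by rewrite subr0.
  exact: (is_deriveB (is_deriveB dy dx) (is_derive_cst _ _ _)).
- move=> t /H[tT ht htd]; have [_ _ _ _ ft] := H1 _ tT.
  have hlt : x t + d0 < y t by move: ht; rewrite hE; lra.
  have [_ _ _ th0 eqt] := H2 _ tT hlt.
  split=> //; apply: H3 => //; rewrite hlt/=.
  by move: htd; rewrite hE; lra.
have [r' r'0 hr'] := small _ q0.
(* Late enough for the lower bound [q], which holds on the second half of []a', b[], and close
   enough to [b] for [h t < q]. *)
pose t := Num.max ((a' + b) / 2) (b - r' / 2).
have tb : t < b by rewrite gt_max midf_lt//=; lra.
have := hq t; rewrite tb andbT le_max lexx => /(_ isT).
rewrite leNgt hr'// tb andbT lt_max; apply/orP; right; lra.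
Unshelve. all: by end_near. Qed.

(** * Bounds and moduli of continuity on space-time boxes *)

Lemma box_compact (R : realType) (T s S : R) :
  compact (`[0, T] `*` `[s, S] : set (R * R)).
Proof. by apply: compact_setX; exact: segment_compact. Qed.

Lemma continuous_box (R : realType) (T s S : R) (G : R * R -> R) :
  {within strip T, continuous G} ->
  {within (`[0, T] `*` `[s, S] : set (R * R)), continuous G}.
Proof. by apply: continuous_subspaceW => -[t y] [/= tT _]; split. Qed.

Lemma box_bounded (R : realType) (T s S : R) (G : R * R -> R) :
  {within strip T, continuous G} ->
  exists2 M : R, 0 < M & forall t y : R, t \in `[0, T] -> y \in `[s, S] ->
    `|G (t, y)| <= M.
Proof.
move=> /(@continuous_box _ _ s S) cG.
have /compact_bounded[M [_ hM]] := continuous_compact cG (@box_compact R T s S).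
exists (Num.max (M + 1) 1); first by rewrite lt_max ltr01 orbT.
move=> t y tT yS; apply: hM; first by rewrite lt_max ltrDl ltr01.
by exists (t, y).
Qed.

(** Uniform continuity on a compact box in a form that is linear in the distance: below the radius
    [e / 2] the slack [eta] suffices, beyond it the trivial bound [2 M] is at most [K] times the
    distance for [K = 2 M / (e / 2)]. Linearity is what allows the errors to be summed over cells of
    which only the total length is controlled. *)
Lemma almost_lipschitz (R : realType) (T s S : R) (G : R * R -> R) (eta : R) :
  {within strip T, continuous G} -> 0 < eta ->
  exists2 K : R, 0 < K & forall t y t' y' : R,
    t \in `[0, T] -> y \in `[s, S] -> t' \in `[0, T] -> y' \in `[s, S] ->
    `|G (t, y) - G (t', y')| <= eta + K * (`|t - t'| + `|y - y'|).
Proof.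
move=> cG eta0; have [M M0 hM] := box_bounded s S cG.
move/(@continuous_box _ _ s S)/subspace_continuousP : cG => cG.
set B := (X in within X) in cG.
pose P (e : R) (z : R * R) := B z -> forall z', B z' ->
  `|z.1 - z'.1| < e -> `|z.2 - z'.2| < e -> `|G z - G z'| <= eta.
have /compact_near_coveringP/(_ R (0^'+) P) := @box_compact R T s S.
have HP z : B z -> \forall z' \near z & e \near 0^'+, P e z'.
  move=> Bz; have /cvgrPdist_le/(_ (eta / 2)) := cG z Bz.
  rewrite divr_gt0// => /(_ isT); rewrite near_withinE => /nbhs_ballP[r/= r0 hr].
  have r20 : 0 < r / 2 by lra.
  exists (ball z (r / 2), [set e | e < r / 2]).
    by split => /=; [exact: nbhsx_ballx|exact: nbhs_right_lt].
  move=> [z' e]/= [zz' er] Bz' z'' Bz'' d1 d2.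
  have G1 : `|G z - G z'| <= eta / 2.
    by apply: hr => //; apply: le_ball zz'; lra.
  have G2 : `|G z - G z''| <= eta / 2.
    apply: hr => //; rewrite [X in ball _ X](_ : r = r / 2 + r / 2); last by lra.
    by apply: ball_triangle zz' _; split; rewrite /ball/=; exact: lt_trans er.
  rewrite (_ : G z' - G z'' = (G z - G z'') - (G z - G z')); last by lra.
  by apply: le_trans (ler_normB _ _) _; lra.
move=> /(_ _ HP) [e /= e0 he].
have e2 : 0 < e / 2 by lra.
have hP : B `<=` P (e / 2).
  apply: he => //=; rewrite /ball/= sub0r normrN gtr0_norm//; lra.
exists (2 * M / (e / 2)); first by rewrite divr_gt0// mulr_gt0.
move=> t y t' y' tT yS t'T y'S.
have [d1|d1] := ltP `|t - t'| (e / 2); last first.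
- apply: (@le_trans _ _ (2 * M)).
    by apply: le_trans (ler_normB _ _) _; rewrite mulr2n mulrDl !mul1r lerD// hM.
  rewrite ler_wpDl ?(ltW eta0)// mulrAC -mulrA ler_pMr ?mulr_gt0//.
  by rewrite ler_pdivlMr// mul1r ler_wpDr.
have [d2|d2] := ltP `|y - y'| (e / 2); last first.
- apply: (@le_trans _ _ (2 * M)).
    by apply: le_trans (ler_normB _ _) _; rewrite mulr2n mulrDl !mul1r lerD// hM.
  rewrite ler_wpDl ?(ltW eta0)// mulrAC -mulrA ler_pMr ?mulr_gt0//.
  by rewrite ler_pdivlMr// mul1r ler_wpDl.
apply: (@le_trans _ _ eta).
  have := hP (t, y); apply => //; by split.
by rewrite lerDl mulr_ge0// ?addr_ge0// divr_ge0// ?mulr_ge0// ltW.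
Qed.

Lemma is_derive_ge0 (R : realType) (f : R -> R) (t d : R) :
  is_derive t 1 f d -> (\forall u \near t, t < u -> f t <= f u) -> 0 <= d.
Proof.
move=> /is_derive1_caratheodory[g [fE cg <-]] fnd.
rewrite leNgt; apply/negP => g0.
have /cvgrPdist_lt/(_ (- g t)) := cg; rewrite oppr_gt0 => /(_ g0) near_g.
have /nbhs_ballP[e /= e0 he] : \forall u \near t,
    (t < u -> f t <= f u) /\ `|g t - g u| < - g t by exact: filterI.
have /he[/= +] : ball t e (t + e / 2).
  by rewrite /ball/= opprD addNKr normrN gtr0_norm; lra.
rewrite ltrDl => /(_ ltac:(lra)) ftu.
have := fE (t + e / 2) => ftE /ltr_normlP[gl _].
have gu0 : g (t + e / 2) < 0 by lra.
move: ftu; rewrite -subr_ge0 ftE addrAC subrr add0r.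
by rewrite pmulr_lge0 ?divr_gt0// leNgt gu0.
Qed.

Lemma densityN (R : realType) (N : nat) (x : nat -> R -> R) (i : nat) (t : R)
  (rhobar : R) : (0 < N)%N -> 0 < rhobar -> x i t < x i.+1 t ->
  (density N x i t <= rhobar) = (x i t + (N%:R * rhobar)^-1 <= x i.+1 t).
Proof.
move=> N0 r0 xi; have n0 : 0 < N%:R :> R by rewrite ltr0n.
have d0 : 0 < x i.+1 t - x i t by rewrite subr_gt0.
rewrite /density -lerBrDl -[leLHS]mulr1 -[(N%:R * rhobar)^-1]mulr1.
rewrite ler_pdivrMl ?mulr_gt0// ler_pdivrMl ?mulr_gt0//.
by rewrite mulrAC [N%:R * rhobar * _]mulrAC.
Qed.

(** * Regularity of the microscopic trajectories *)

Definition vel (R : realType) (T : R) (x : nat -> R -> R) (i : nat) : R -> R :=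
  deriv_in `[0, T] (x i).

Lemma nbhs_itvoo (R : realType) (a b t : R) : t \in `]a, b[ -> nbhs t `]a, b[%classic.
Proof. by move=> tab; apply: open_nbhs_nbhs; split => //; exact: interval_open. Qed.

Lemma nbhs_itvcc (R : realType) (a b t : R) : t \in `]a, b[ -> nbhs t `[a, b]%classic.
Proof.
move=> /nbhs_itvoo; apply: filterS => u /=.
by rewrite !in_itv/= => /andP[/ltW-> /ltW->].
Qed.

Lemma itv_oocc (R : realType) (a b t : R) : t \in `]a, b[ -> t \in `[a, b].
Proof. by rewrite !in_itv/= => /andP[/ltW-> /ltW->]. Qed.

(** [theta] vanishes at [rhobar] and is Lipschitz there. This linear decay is what the logarithmic
    estimate on the gap requires. *)
Lemma theta_linear (R : realType) (T rhobar : R) (theta : R -> R)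
    (F : R * R -> R) : nonlinearities T rhobar theta F ->
  exists K : R, exists2 d : R, 0 < K & 0 < d /\
    forall r, rhobar - d < r < rhobar -> theta r <= K * (rhobar - r).
Proof.
move=> [_ th0 r0 theq [d d0 /lipschitzW[K K0 hK]] _ _ _].
exists K, d => //; split => // r /andP[dr rr].
have thr : theta rhobar = 0 by apply/theq => //; exact: ltW.
have rb : ball rhobar d r.
  by rewrite /ball/= ger0_norm ?subr_ge0 ?(ltW rr)//; lra.
have := hK r rhobar rb (ballxx _ d0); rewrite thr subr0 [ `|r - _|]distrC.
rewrite [ `|rhobar - _|]ger0_norm ?subr_ge0 ?(ltW rr)//.
by move=> h; exact: (le_trans (ler_norm _) h).
Qed.

(** Induction on the distance [m] to the leader: strict positivity of the predecessor's velocity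
    keeps the follower free, and a free follower in turn has strictly positive velocity. The free
    regime then supplies the regularity and the equation at every interior time. *)
Lemma micro_regular (R : realType) (T gamma eps rhobar s S C0 Fm : R)
    (theta : R -> R) (F : R * R -> R) (N : nat) (x0 v0 : nat -> R)
    (x : nat -> R -> R) :
  0 < T -> 0 < gamma -> 0 < eps -> (0 < N)%N -> 0 <= Fm ->
  nonlinearities T rhobar theta F ->
  admissible_data T rhobar s S C0 N x0 v0 (x N) ->
  micro_solution T gamma eps rhobar theta F N x0 v0 x ->
  (forall i t, (i < N)%N -> t \in `[0, T] -> F (t, x i t) <= Fm) ->
  forall m i, (m + i = N)%N -> forall t, t \in `]0, T[ ->
  [/\ is_derive t 1 (x i) (vel T x i t), {for t, continuous (vel T x i)},
      0 < vel T x i t & (i < N)%N ->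
      [/\ density N x i t < rhobar,
          is_derive t 1 (vel T x i) (deriv_in `[0, T] (vel T x i) t) &
          eps * theta (density N x i t) * deriv_in `[0, T] (vel T x i) t
          + gamma * vel T x i t = theta (density N x i t) * F (t, x i t)]].
Proof.
move=> T0 g0 e0 N0 Fm0 nl data sol Fb.
elim=> [i|m IH i miN].
  rewrite add0n => -> t tT; have [dx cdx] :=
    C1_in_at (nbhs_itvcc tT) (nbhs_itvcc tT) (leader_C1 data).
  split; [exact: dx|exact: cdx| |by rewrite ltnn].
  apply: (leader_speed_gt0 data).
  by move: tT; rewrite !in_itv/= => /andP[-> /ltW->].
have iN : (i < N)%N by rewrite -miN addSn ltnS leq_addl.
have {}IH := IH i.+1; rewrite addnS -addSn miN in IH; have {}IH := IH erefl.
have r0 := rhobar_gt0 nl.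
have n0 : 0 < N%:R :> R by rewrite ltr0n.
have [C2B eqB] := sol_free sol iN.
pose B := [set t : R | t \in `[0, T] /\ density N x i t < rhobar].
rewrite -/B in C2B eqB.
have ord t : t \in `[0, T] -> x i t < x i.+1 t.
  by move=> tT; have [] := sol_ordered sol iN tT.
pose d0 := (N%:R * rhobar)^-1.
have d00 : 0 < d0 by rewrite invr_gt0 mulr_gt0.
have dens_gt0 t : t \in `[0, T] -> 0 < density N x i t.
  by move=> /ord xt; rewrite invr_gt0 mulr_gt0// subr_gt0.
have densB t : t \in `[0, T] -> density N x i t = rhobar -> x i.+1 t = x i t + d0.
  move=> /ord xt dr; have : (density N x i t)^-1 = rhobar^-1 by rewrite dr.
  rewrite /density invrK /d0 invfM => /(congr1 (fun z => N%:R^-1 * z)).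
  by rewrite mulKf ?gt_eqF//; lra.
have densE t : t \in `[0, T] -> x i.+1 t = x i t + d0 -> density N x i t = rhobar.
  move=> tT xE; rewrite /density xE addrAC subrr add0r /d0 invfM invrK mulKf//.
  by rewrite gt_eqF.
have dens_lt t : t \in `[0, T] -> x i t + d0 < x i.+1 t -> density N x i t < rhobar.
  move=> tT xt; rewrite lt_neqAle; have [_ ->] := sol_ordered sol iN tT.
  by rewrite andbT; apply/eqP => /(densB _ tT) E; move: xt; rewrite E ltxx.
have [K [dd K0 [dd0 thK]]] := theta_linear nl.
have cxi t : t \in `]0, T[ -> {for t, continuous (x i)}.
  move=> tT; have [M M0 hM] := lipschitzW (sol_lipschitz sol iN).
  exact: within_continuous_at (nbhs_itvcc tT) (lipschitz_within_continuous hM).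
have nbhsB t : t \in `]0, T[ -> x i t + d0 < x i.+1 t -> nbhs t B.
  move=> tT xt; have [dy _ _ _] := IH t tT.
  have cg : {for t, continuous (x i.+1 - x i)}.
    by apply: continuousB; [exact: is_derive_continuous dy|exact: cxi].
  have near_gt : \forall u \near t, d0 < (x i.+1 - x i) u.
    apply: (@cvgr_gt _ _ _ _ _ _ cg) => /=.
    by rewrite (_ : (x i.+1 - x i) t = x i.+1 t - x i t)//; lra.
  near=> u.
  have uT : u \in `[0, T] by near: u; exact: nbhs_itvcc.
  have hu : d0 < x i.+1 u - x i u by near: u; exact: near_gt.
  by split; [exact: uT|apply: dens_lt; [exact: uT|lra]].
have freeP t : t \in `]0, T[ -> x i t + d0 < x i.+1 t ->
    [/\ is_derive t 1 (x i) (vel T x i t), {for t, continuous (vel T x i)} &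
        is_derive t 1 (vel T x i) (deriv_in `[0, T] (vel T x i) t)].
  move=> tT xt; have [C1x C1v] := C2B.
  have [dx cv] := C1_in_at (nbhs_itvcc tT) (nbhsB _ tT xt) C1x.
  by have [dv _] := C1_in_at (nbhs_itvcc tT) (nbhsB _ tT xt) C1v.
have vge0 t : t \in `]0, T[ -> x i t + d0 < x i.+1 t -> 0 <= vel T x i t.
  move=> tT xt; have [dx _ _] := freeP t tT xt.
  apply: is_derive_ge0 dx _; near=> u => tu.
  apply: (sol_nondecreasing sol iN) (itv_oocc tT) _ (ltW tu).
  by near: u; exact: nbhs_itvcc.
have thgt0 t : t \in `[0, T] -> density N x i t < rhobar ->
    0 < theta (density N x i t).
  move=> tT dr; have dge := ltW (dens_gt0 t tT).
  rewrite lt_neqAle (theta_ge0 nl dge) andbT eq_sym; apply/eqP.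
  by move/(theta_eq0 nl dge); rewrite leNgt dr.
have jam t : t \in `]0, T[ -> (\forall u \near t, x i.+1 u = x i u + d0) ->
    is_derive t 1 (x i) 0.
  move=> tT jt; have [C1j eqj] := sol_jammed sol iN.
  set J := (_°) in C1j eqj.
  have Jt : nbhs t J.
    apply: nbhs_interior; near=> u.
    have uT : u \in `[0, T] by near: u; exact: nbhs_itvcc.
    have ju : x i.+1 u = x i u + d0 by near: u; exact: jt.
    by split; [exact: uT|exact: densE].
  have [dx _] := C1_in_at (nbhs_itvcc tT) Jt C1j.
  have := eqj t (nbhs_singleton Jt).
  have [_ ->] := interior_subset (nbhs_singleton Jt).
  have -> : theta rhobar = 0 by apply/(theta_eq0 nl) => //; exact: ltW.
  rewrite mul0r => /eqP; rewrite mulf_eq0 (gt_eqF g0)/= => /eqP vz.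
  by move: dx; rewrite vz.
have free : forall t, t \in `]0, T[ -> x i t + d0 < x i.+1 t.
  (* A gap [h] above the jammed spacing [d0] gives [rhobar - rho = N rhobar rho h <= N rhobar^2 h],
     which turns the linear decay in the density into one in [h]. *)
  pose K' := K * (N%:R * rhobar ^+ 2).
  apply: (@follower_free R T eps gamma K' (dd / (N%:R * rhobar ^+ 2)) Fm d0
    (x i) (x i.+1) (vel T x i) (vel T x i.+1)
    (deriv_in `[0, T] (vel T x i)) (theta \o density N x i)
    (fun t => F (t, x i t))) => //.
  - by rewrite mulr_gt0// mulr_gt0// exprn_gt0.
  - by rewrite divr_gt0// mulr_gt0// exprn_gt0.
  - move=> t tT; have [dy _ w0 _] := IH t tT; split => //.
    + exact: cxi.
    + have [xt dt] := sol_ordered sol iN (itv_oocc tT).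
      by rewrite -densityN.
    + exact: Fb (itv_oocc tT).
  - move=> t tT xt; have [dx _ dv] := freeP t tT xt; split => //.
    + exact: vge0.
    + by apply: thgt0; [exact: itv_oocc|apply: dens_lt => //; exact: itv_oocc].
    + by apply: eqB; split; [exact: itv_oocc|apply: dens_lt => //; exact: itv_oocc].
  - move=> t tT /andP[xt xt'].
    have dlt := dens_lt _ (itv_oocc tT) xt.
    have dgt := dens_gt0 _ (itv_oocc tT).
    set h := x i.+1 t - x i t - d0.
    have h0 : 0 < h by rewrite /h; lra.
    have hdd : h < dd / (N%:R * rhobar ^+ 2) by rewrite /h; lra.
    have E : rhobar - density N x i t = N%:R * rhobar * density N x i t * h.
      rewrite /h /density /d0; have := ord _ (itv_oocc tT); rewrite -subr_gt0 => p0.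
      by field; rewrite !gt_eqF.
    have le1 : rhobar - density N x i t <= N%:R * rhobar ^+ 2 * h.
      by rewrite E expr2 mulrA !ler_wpM2r ?(ltW h0)// !ler_wpM2l// ?mulr_ge0// ltW.
    apply: (@le_trans _ _ (K * (rhobar - density N x i t))).
      apply: thK; rewrite dlt andbT.
      move: hdd; rewrite ltr_pdivlMr ?mulr_gt0 ?exprn_gt0// => hdd.
      by move: le1; rewrite mulrC; lra.
    by rewrite /K' -mulrA ler_wpM2l// ltW.
(* A zero of the nonnegative velocity is a minimum, so its derivative vanishes there and the
   equation leaves [theta F = 0], although both factors are positive. *)
have vpos t : t \in `]0, T[ -> 0 < vel T x i t.
  move=> tT; have xt := free t tT; rewrite lt_neqAle vge0// andbT eq_sym.
  apply/eqP => vz; have [_ _ dv] := freeP t tT xt.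
  have dv0 : is_derive t 1 (vel T x i) 0.
    apply: (@derive1_at_min _ _ 0 T) => //; first exact: ltW.
      by move=> u uT; have [_ _] := freeP u uT (free u uT); exact: is_derive_derivable.
    by move=> u uT; rewrite vz; apply: vge0 => //; exact: free.
  have tB : B t by split; [exact: itv_oocc|apply: dens_lt => //; exact: itv_oocc].
  have := eqB t tB; rewrite -/(vel T x i) -/(vel T x i t) vz.
  rewrite (is_derive_unique dv dv0) !mulr0 addr0 => /eqP.
  rewrite eq_sym mulf_eq0 !gt_eqF//.
    by apply: (F_gt0 nl); split => //=; exact: itv_oocc.
  by apply: thgt0; [exact: itv_oocc|have [] := tB].
move=> t tT; have xt := free t tT; have [dx cv dv] := freeP t tT xt.
have tB : B t by split; [exact: itv_oocc|apply: dens_lt => //; exact: itv_oocc].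
split => //; first exact: vpos.
by move=> _; split => //; [have [] := tB|exact: eqB].
Unshelve. all: by end_near. Qed.

(** * Bounds uniform in the number of vehicles *)

(** What the averaging over cells relies on, with [L] later chosen independent of [N]. Keeping the
    differential equation out allows the same estimates to be applied to configurations frozen in
    time. *)
Record trajectories (R : realType) (T s S L rhobar : R) (N : nat)
    (x : nat -> R -> R) : Prop := Trajectories {
  traj_lipschitz : forall i, (i <= N)%N -> forall a b : R,
    a \in `[0, T] -> b \in `[0, T] -> `|x i a - x i b| <= L * `|a - b| ;
  traj_itv : forall i t, (i <= N)%N -> t \in `[0, T] -> x i t \in `[s, S] ;
  traj_lt : forall i t, (i < N)%N -> t \in `[0, T] -> x i t < x i.+1 t ;
  traj_density : forall i t, (i < N)%N -> t \in `[0, T] ->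
    density N x i t <= rhobar ;
  traj_derive : forall i t, (i < N)%N -> t \in `]0, T[ ->
    is_derive t 1 (x i) (vel T x i t) ;
  traj_vel_continuous : forall i t, (i < N)%N -> t \in `]0, T[ ->
    {for t, continuous (vel T x i)} ;
  traj_vel : forall i t, (i < N)%N -> t \in `]0, T[ -> 0 <= vel T x i t <= L }.

Lemma ae_exists_itv (R : realType) (P : R -> Prop) (a b : R) : a < b ->
  {ae leb1 R, forall t, P t} -> exists2 t, t \in `]a, b[ & P t.
Proof.
move=> ab [A [mA A0 PA]]; apply: contrapT => nP.
have : (lebesgue_measure (`]a, b[%classic : set R) <= lebesgue_measure A)%E.
  apply: le_measure; rewrite ?inE//.
  by move=> t tab; apply: PA => /= Pt; apply: nP; exists t.
by rewrite A0 lebesgue_measure_itv/= lte_fin ab -EFinB lee_fin leNgt subr_gt0 ab.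
Qed.

(** By continuity an excess over [L] would persist on an interval, which is not negligible. *)
Lemma ae_le_itv (R : realType) (f : R -> R) (T L : R) :
  (forall t, t \in `]0, T[ -> {for t, continuous f}) ->
  {ae leb1 R, forall t, t \in `]0, T[ -> f t <= L} ->
  forall t, t \in `]0, T[ -> f t <= L.
Proof.
move=> cf aef t tT; rewrite leNgt; apply/negP => Lf.
have near_f : \forall u \near t, L < f u by exact: (@cvgr_gt R R (nbhs t) _ f (f t) (cf t tT) L Lf).
have /nbhs_ballP[e /= e0 he] : \forall u \near t, L < f u /\ u \in `]0, T[.
  by near=> u; split; near: u; [exact: near_f|exact: nbhs_itvoo].
have [u ut fu] := @ae_exists_itv R _ (t - e) (t + e) ltac:(lra) aef.
have /he[Lu uT] : ball t e u by rewrite ball_itv.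
by move: Lu; rewrite ltNge fu.
Unshelve. all: by end_near. Qed.

Lemma lipschitz_derive_bound (R : realType) (T L : R) (f df : R -> R) :
  {within `[0, T], continuous f} ->
  (forall t, t \in `]0, T[ -> is_derive t 1 f (df t)) ->
  (forall t, t \in `]0, T[ -> `|df t| <= L) ->
  forall a b, a \in `[0, T] -> b \in `[0, T] -> `|f a - f b| <= L * `|a - b|.
Proof.
move=> cf fdf dfL a b; wlog ab : a b / a <= b => [hw aT bT|aT bT].
  have [ab|/ltW ba] := leP a b; first exact: hw.
  by rewrite distrC (distrC a); exact: hw.
have subo t : t \in `]a, b[ -> t \in `]0, T[.
  move: aT bT; rewrite !in_itv/= => /andP[a0 _] /andP[_ bT] /andP[at_ tb].
  by rewrite (le_lt_trans a0)//= (lt_le_trans tb).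
have fdf' t : t \in `]a, b[ -> is_derive t 1 f (df t) by move=> /subo/fdf.
have cf' : {within `[a, b], continuous f}.
  apply: continuous_subspaceW cf => t /=.
  move: aT bT; rewrite !in_itv/= => /andP[a0 _] /andP[_ bT] /andP[at_ tb].
  by rewrite (le_trans a0)//= (le_trans tb).
move: ab; rewrite le_eqVlt => /predU1P[<-|ab]; first by rewrite !subrr normr0 mulr0.
have [c /subo cT fE] := MVT ab fdf' cf'.
by rewrite distrC fE [ `|a - b|]distrC normrM ler_wpM2r// dfL.
Qed.

(** The bound depends on [N] only through data controlled by [C0], [s] and [S]: the interval from
    the initial position of the rearmost vehicle to the final one of the leader lies in [[s, S]],
    where [F <= Fm]. *)
Lemma speed_bound_le (R : realType) (T gamma rhobar s S C0 Fm : R)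
    (theta : R -> R) (F : R * R -> R) (N : nat) (x0 v0 : nat -> R) (xN : R -> R) :
  0 < T -> 0 < gamma -> 0 < C0 ->
  nonlinearities T rhobar theta F ->
  admissible_data T rhobar s S C0 N x0 v0 xN ->
  (forall t y, t \in `[0, T] -> y \in `[s, S] -> F (t, y) <= Fm) ->
  forall i, (i < N)%N -> speed_bound T gamma rhobar theta F N x0 v0 xN i
    <= Num.max C0 (sup (theta @` `[0, rhobar]) / gamma * Fm).
Proof.
move=> T0 g0 C00 nl data Fb i iN; rewrite /speed_bound ge_max; apply/andP; split.
  rewrite le_max; apply/orP; left; case: ifPn => [_|/eqP nj]; first exact: ltW.
  by apply: (v0_le data) => // -[].
rewrite le_max; apply/orP; right.
have sup0 : 0 <= sup (theta @` `[0, rhobar]).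
  (* A set without a supremum has [sup] equal to 0, so the sign is clear in that case. *)
  have [hs|/sup_out->//] := pselect (has_sup (theta @` `[0, rhobar])).
  apply: (@le_trans _ _ (theta 0)); first exact: (theta_ge0 nl).
  apply: ub_le_sup; first by case: hs.
  by exists 0 => //=; rewrite in_itv/= lexx ltW// (rhobar_gt0 nl).
rewrite ler_wpM2l ?divr_ge0 ?(ltW g0)//.
have [s0 sx Sx] := positions_bounds data.
apply: ge_sup.
  exists (F (0, x0 0%N)); exists (0, x0 0%N) => //; split => /=.
    by rewrite in_itv/= lexx ltW.
  by rewrite in_itv/= lexx.
move=> _ [[t y] [/= tT yS] <-]; apply: Fb => //.
move: yS; rewrite /= !in_itv/= => /andP[xy yx].
by rewrite (le_trans s0 xy) (le_trans yx Sx).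
Qed.

Lemma micro_itv (R : realType) (T gamma eps rhobar s S C0 : R)
    (theta : R -> R) (F : R * R -> R) (N : nat) (x0 v0 : nat -> R)
    (x : nat -> R -> R) : 0 < T -> (0 < N)%N ->
  admissible_data T rhobar s S C0 N x0 v0 (x N) ->
  micro_solution T gamma eps rhobar theta F N x0 v0 x ->
  forall i t, (i <= N)%N -> t \in `[0, T] -> x i t \in `[s, S].
Proof.
move=> T0 N0 data sol i t iN tT.
have [s0 sx Sx] := positions_bounds data.
have O0 : 0 \in `[0, T] by rewrite in_itv/= lexx ltW.
have TT : T \in `[0, T] by rewrite in_itv/= lexx ltW.
have t0 : 0 <= t <= T by move: tT; rewrite in_itv.
have mono i' j : (i' <= j)%N -> (j <= N)%N -> x i' t <= x j t.
  elim: j => [|j IH]; first by rewrite leqn0 => /eqP->.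
  rewrite leq_eqVlt => /predU1P[->//|ij jN]; apply: le_trans (IH ij (ltnW jN)) _.
  by have [/ltW] := sol_ordered sol jN tT.
case/andP: t0 => t0 t1.
rewrite in_itv/= (le_trans s0)/=.
  apply: le_trans (mono _ _ iN (leqnn _)) _.
  by apply: le_trans Sx; apply: (leader_nondecreasing data).
rewrite -(sol_init sol N0); apply: le_trans (mono 0%N i _ iN) => //.
by apply: (sol_nondecreasing sol).
Qed.

(** Applied to the leader, which is differentiable relatively to [[0, T]], to get its continuity up
    to the endpoints. *)
Lemma derivable_in_continuous (R : realType) (A : set R) (f : R -> R) (t : R) :
  derivable_in A f t -> f @ within A (nbhs t) --> f t.
Proof.
rewrite /derivable_in /diff_quot_in; set q := fun s => _ => dft.
have cq : q @ within A t^' --> lim (q @ within A t^') by [].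
set l := lim _ in cq.
have {}cq : \forall s \near t, s != t -> A s -> `|l - q s| <= 1.
  by have /cvgrPdist_le/(_ 1 ltr01) := cq.
apply/cvgrPdist_le => e e0; rewrite near_withinE.
have l0 : 0 < `|l| + 1 by rewrite ltr_wpDl.
near=> s => As; have [->|st] := eqVneq s t; first by rewrite subrr normr0 ltW.
have qs : `|l - q s| <= 1 by have := near cq s; apply.
have ql : `|q s| <= `|l| + 1.
  rewrite -[q s](subrK l) addrC.
  by apply: le_trans (ler_normD _ _) _; rewrite lerD2l distrC.
have -> : f t - f s = - (q s * (s - t)).
  by rewrite /q divfK ?opprB// subr_eq0.
rewrite normrN normrM; apply: (@le_trans _ _ ((`|l| + 1) * `|s - t|)).
  by rewrite ler_wpM2r.
rewrite mulrC -ler_pdivlMr// distrC; near: s.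
by apply: cvgr_dist_le; [exact: cvg_id|rewrite divr_gt0].
Unshelve. all: by end_near. Qed.

(** The Lipschitz constants in the definition of a solution may depend on [N]. The speed bound,
    extended from almost every time to every interior time by continuity of the velocity, replaces
    them by one constant. *)
Lemma micro_trajectories (R : realType) (T gamma eps rhobar s S C0 Fm : R)
    (theta : R -> R) (F : R * R -> R) (N : nat) (x0 v0 : nat -> R)
    (x : nat -> R -> R) :
  0 < T -> 0 < gamma -> 0 < eps -> (0 < N)%N -> 0 < C0 -> 0 <= Fm ->
  nonlinearities T rhobar theta F ->
  admissible_data T rhobar s S C0 N x0 v0 (x N) ->
  micro_solution T gamma eps rhobar theta F N x0 v0 x ->
  speed_bounded T gamma rhobar theta F N x0 v0 x ->
  (forall t y, t \in `[0, T] -> y \in `[s, S] -> F (t, y) <= Fm) ->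
  trajectories T s S (Num.max C0 (sup (theta @` `[0, rhobar]) / gamma * Fm))
    rhobar N x.
Proof.
move=> T0 g0 e0 N0 C00 Fm0 nl data sol spd Fb.
set L := Num.max _ _.
have itvx := micro_itv T0 N0 data sol.
have Fbi i t : (i < N)%N -> t \in `[0, T] -> F (t, x i t) <= Fm.
  by move=> iN tT; apply: Fb => //; apply: itvx => //; exact: ltnW.
have reg := micro_regular T0 g0 e0 N0 Fm0 nl data sol Fbi.
have regi i t : (i <= N)%N -> t \in `]0, T[ ->
    [/\ is_derive t 1 (x i) (vel T x i t), {for t, continuous (vel T x i)} &
        0 < vel T x i t].
  by move=> iN tT; have [] := reg (N - i)%N i (subnK iN) t tT.
have velL i t : (i <= N)%N -> t \in `]0, T[ -> vel T x i t <= L.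
  rewrite leq_eqVlt => /predU1P[->|iN] tT.
    rewrite le_max; apply/orP; left.
    by apply: (leader_speed_le data); exact: itv_oocc.
  move: t tT; apply: ae_le_itv.
    by move=> t tT; have [] := regi i t (ltnW iN) tT.
  have [A [mA A0 spdA]] := spd; exists A; split => // t /= nt.
  apply: spdA => /= ht; apply: nt => tT; apply: le_trans (ht tT i iN) _.
  exact: (speed_bound_le T0 g0 C00 nl data Fb).
split => //.
- move=> i iN; apply: (@lipschitz_derive_bound _ _ _ _ (vel T x i)).
  + move: iN; rewrite leq_eqVlt => /predU1P[->|iN].
      apply/subspace_continuousP => t tT; have [dl _] := leader_C1 data.
      exact: derivable_in_continuous (dl t tT).
    have [M M0 hM] := lipschitzW (sol_lipschitz sol iN).
    exact: lipschitz_within_continuous hM.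
  + by move=> t tT; have [] := regi i t iN tT.
  + move=> t tT; have [_ _ v0'] := regi i t iN tT.
    by rewrite ger0_norm ?velL// ltW.
- by move=> i t iN tT; have [] := sol_ordered sol iN tT.
- by move=> i t iN tT; have [] := sol_ordered sol iN tT.
- by move=> i t iN tT; have [] := regi i t (ltnW iN) tT.
- by move=> i t iN tT; have [] := regi i t (ltnW iN) tT.
- move=> i t iN tT; have [_ _ /ltW->] := regi i t (ltnW iN) tT.
  by rewrite velL// ltnW.
Qed.

(** * Integration over intervals *)

(** The denominator starts at 3 so that an inset is always below half of the length, and the
    interval shrunk at both ends is nondegenerate for every [n]. *)
Definition inset (R : realType) (a b : R) (n : nat) : R := (b - a) / n.+3%:R.

Lemma inset_gt0 (R : realType) (a b : R) n : a < b -> 0 < inset a b n.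
Proof. by move=> ab; rewrite divr_gt0 ?subr_gt0. Qed.

Lemma inset_lt (R : realType) (a b : R) n : a < b ->
  a + inset a b n < b - inset a b n.
Proof.
move=> ab; have n0 : 0 < n.+3%:R^-1 :> R by rewrite invr_gt0.
have n3 : n.+3%:R^-1 < 2%:R^-1 :> R by rewrite ltf_pV2 ?posrE// ltr_nat.
rewrite /inset; set q := _^-1 in n0 n3 *.
suff : (b - a) * q < (b - a) * 2^-1 by lra.
by rewrite ltr_pM2l// subr_gt0.
Qed.

Lemma inset_decr (R : realType) (a b : R) n m : a < b -> (n <= m)%N ->
  inset a b m <= inset a b n.
Proof.
move=> ab nm; rewrite /inset ler_pM2l ?subr_gt0// lef_pV2 ?posrE//.
by rewrite ler_nat !ltnS.
Qed.

Lemma cvg_inset (R : realType) (a b : R) : inset a b @ \oo --> (0 : R).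
Proof.
rewrite -[X in _ --> X](mulr0 (b - a)).
have h : (fun n => n.+3%:R^-1 : R) @ \oo --> (0 : R).
  have := @cvg_harmonic R; rewrite -(cvg_shiftn 2).
  by apply: cvg_trans; apply: near_eq_cvg; near=> n; rewrite /harmonic/= addn2.
exact: (@cvgM _ _ _ _ (fun=> b - a) _ _ _ (cvg_cst _) h).
Unshelve. all: by end_near. Qed.

Lemma bigcup_inset (R : realType) (a b : R) : a < b ->
  \bigcup_n `[a + inset a b n, b - inset a b n]%classic = `]a, b[%classic.
Proof.
move=> ab; apply/seteqP; split => [t [n _]|t]; rewrite /= !in_itv/=.
  have := inset_gt0 n ab => i0 /andP[h1 h2].
  by apply/andP; split; lra.
move=> /andP[at_ tb].
have e0 : 0 < Num.min (t - a) (b - t) by rewrite lt_min !subr_gt0 at_ tb.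
have /cvgrPdist_lt/(_ _ e0)[n _ hn] := @cvg_inset R a b.
exists n => //=; have := hn n (leqnn n); rewrite /= sub0r normrN.
rewrite gtr0_norm ?inset_gt0// lt_min in_itv/= => /andP[h1 h2].
by apply/andP; split; lra.
Qed.

(** Nothing is assumed at the endpoints, where [u] may blow up: for a nonnegative [u], monotone
    convergence over the shrunk intervals gives the identity in the extended reals. *)
Lemma ge0_FTC_oo (R : realType) (a b : R) (u U : R -> R) : a < b ->
  (forall t, t \in `]a, b[ -> is_derive t 1 U (u t)) ->
  (forall t, t \in `]a, b[ -> {for t, continuous u}) ->
  (forall t, t \in `]a, b[ -> 0 <= u t) ->
  ((U (b - inset a b n) - U (a + inset a b n))%:E @[n --> \oo] -->
    \int[leb1 R]_(t in `]a, b[) (u t)%:E)%E.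
Proof.
move=> ab dU cu u0.
pose I n := `[a + inset a b n, b - inset a b n]%classic.
have subI n : I n `<=` `]a, b[%classic.
  by move=> t; rewrite -bigcup_inset// => It; exists n.
have mu' : measurable_fun `]a, b[%classic (EFin \o u).
  apply/measurable_EFinP; apply: open_continuous_measurable_fun.
    exact: interval_open.
  by move=> t; rewrite inE => /cu.
have ndI : {homo I : n m / (n <= m)%N >-> (n <= m)%O}.
  move=> n m nm; apply/subsetPset => t; rewrite /I/= !in_itv/= => /andP[h1 h2].
  by have := inset_decr ab nm => h; apply/andP; split; lra.
have h : (\int[leb1 R]_(t in I n) (u t)%:E @[n --> \oo] -->
    \int[leb1 R]_(t in \bigcup_n I n) (u t)%:E)%E.
  apply: ge0_nondecreasing_set_cvg_integral => //.
  - by move=> n; exact: measurable_itv.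
  - by move=> n; apply: measurable_funS mu' => //; exact: subI.
  - by move=> n t /subI tI; rewrite lee_fin u0.
rewrite /I bigcup_inset// in h.
have -> : (fun n => (U (b - inset a b n) - U (a + inset a b n))%:E) =
    (fun n => (\int[leb1 R]_(t in I n) (u t)%:E)%E).
  apply/funext => n; rewrite (@continuous_FTC2 _ u U) ?EFinB//.
  - exact: inset_lt.
  - have cI : {in I n, continuous u}.
      by move=> t; rewrite inE => /subI; exact: cu.
    exact: continuous_in_subspaceT.
  - have aI : a + inset a b n \in `]a, b[.
      by apply: (subI n); rewrite /I/= in_itv/= lexx ?andbT/= ltW// inset_lt.
    have bI : b - inset a b n \in `]a, b[.
      by apply: (subI n); rewrite /I/= in_itv/= lexx ?andbT/= ltW// inset_lt.
    split.
    + move=> t tI; apply: (@is_derive_derivable _ _ _ (u t)); apply: dU.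
      by apply: (subI n); exact: itv_oocc.
    + apply: cvg_at_right_filter; exact: is_derive_continuous (dU _ aI).
    + apply: cvg_at_left_filter; exact: is_derive_continuous (dU _ bI).
  - move=> t; rewrite inE => tI; apply: is_derive_derive1; apply: dU.
    by apply: (subI n); exact: itv_oocc.
exact: h.
Qed.

Lemma integrable_bounded (d : measure_display) (X : measurableType d)
    (R : realType) (mu : {measure set X -> \bar R}) (D : set X) (f : X -> R)
    (M : R) : measurable D -> (mu D < +oo)%E -> measurable_fun D f ->
  (forall z, D z -> `|f z| <= M) -> mu.-integrable D (EFin \o f).
Proof.
move=> mD Doo mf fM; apply: measurable_bounded_integrable => //.
exists M; split; first exact: num_real.
by move=> M' MM' z Dz; apply: le_trans (ltW MM'); exact: fM.
Qed.

Lemma itv_finite (R : realType) (a b : R) :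
  (leb1 R `]a, b[%classic < +oo)%E.
Proof. by rewrite lebesgue_measure_itv/=; case: ifP => _; rewrite ?ltry// -EFinB ltry. Qed.

Lemma integrable_cst_itv (R : realType) (a b M : R) :
  (leb1 R).-integrable `]a, b[%classic (EFin \o cst M).
Proof. by apply: (@integrable_bounded _ _ _ _ _ _ `|M|) => //; exact: itv_finite. Qed.

Lemma Rintegral_cst_itv (R : realType) (a b M : R) : a <= b ->
  \int[leb1 R]_(t in `]a, b[) M = M * (b - a).
Proof.
move=> ab; rewrite Rintegral_cst//= lebesgue_measure_itv/= lte_fin.
by case: ltgtP ab => //= ->; rewrite subrr.
Qed.

(** Adding the constant [M] makes the integrand nonnegative; the bound [B] on the increments of [W]
    then makes the limit finite. Integrability thus follows from a one-sided bound on [w]. *)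
Lemma FTC_oo (R : realType) (a b M B : R) (w W : R -> R) : a < b ->
  (forall t, t \in `]a, b[ -> is_derive t 1 W (w t)) ->
  (forall t, t \in `]a, b[ -> {for t, continuous w}) ->
  (forall t, t \in `]a, b[ -> - M <= w t) ->
  (forall s t : R, s \in `]a, b[ -> t \in `]a, b[ -> W t - W s <= B) ->
  (leb1 R).-integrable `]a, b[%classic (EFin \o w) /\
  W (b - inset a b n) - W (a + inset a b n) @[n --> \oo] -->
    \int[leb1 R]_(t in `]a, b[) w t.
Proof.
move=> ab dW cw wM WB.
pose u t := w t + M; pose U := W + M *: (id : R -> R).
have dU t : t \in `]a, b[ -> is_derive t 1 U (u t).
  move=> tab; have -> : u t = w t + M *: (1 : R) by rewrite /u /GRing.scale/= mulr1.
  exact: (is_deriveD (dW t tab) (is_deriveZ _ (is_derive_id _ _))).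
have cu t : t \in `]a, b[ -> {for t, continuous u}.
  by move=> tab; apply: cvgD; [exact: cw|exact: cvg_cst].
have u0 t : t \in `]a, b[ -> 0 <= u t.
  by move=> tab; rewrite /u -[leLHS](addNr M) lerD2r wM.
have hU := ge0_FTC_oo ab dU cu u0.
have memI n : (a + inset a b n \in `]a, b[) /\ (b - inset a b n \in `]a, b[).
  have := inset_lt n ab; have := inset_gt0 n ab => h1 h2.
  by rewrite !in_itv/=; split; apply/andP; split; lra.
have UB n : U (b - inset a b n) - U (a + inset a b n) <= B + `|M| * (b - a).
  have [aI bI] := memI n.
  have -> : U (b - inset a b n) - U (a + inset a b n) =
      W (b - inset a b n) - W (a + inset a b n) +
      M * (b - inset a b n - (a + inset a b n)).
    by rewrite /U !fctE /GRing.scale/=; lra.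
  apply: lerD; first exact: WB.
  have := inset_lt n ab; have := inset_gt0 n ab => h1 h2.
  apply: le_trans (ler_norm _) _; rewrite normrM ler_wpM2l//.
  by rewrite ger0_norm; lra.
have mu' : measurable_fun `]a, b[%classic u.
  apply: open_continuous_measurable_fun; first exact: interval_open.
  by move=> t; rewrite inE => /cu.
have intuB : (\int[leb1 R]_(t in `]a, b[) (u t)%:E <=
    (B + `|M| * (b - a))%:E)%E.
  rewrite -(cvg_lim _ hU)//; apply: lime_le; first by apply/cvg_ex; eexists; exact: hU.
  by apply: nearW => n; rewrite lee_fin.
have iu : (leb1 R).-integrable `]a, b[%classic (EFin \o u).
  apply/integrableP; split; first exact/measurable_EFinP.
  apply: le_lt_trans (ltry (B + `|M| * (b - a))); apply: le_trans intuB.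
  apply: ge0_le_integral => //=.
  - by apply/measurable_EFinP; apply: measurableT_comp.
  - exact/measurable_EFinP.
  - by move=> t tab; rewrite ger0_norm// u0.
have iM := integrable_cst_itv a b M.
have iw : (leb1 R).-integrable `]a, b[%classic (EFin \o w).
  have := integrableB _ iu iM; rewrite (_ : (_ \- _)%E = EFin \o w).
    exact.
  by apply/funext => t /=; rewrite -EFinB addrK.
split => //.
have -> : \int[leb1 R]_(t in `]a, b[) w t =
    \int[leb1 R]_(t in `]a, b[) u t - M * (b - a).
  rewrite -[X in _ - X](Rintegral_cst_itv _ (ltW ab)) -RintegralB//.
  by apply: eq_Rintegral => t _; rewrite /u addrK.
have hU' : U (b - inset a b n) - U (a + inset a b n) @[n --> \oo] -->
    \int[leb1 R]_(t in `]a, b[) u t.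
  apply: (fine_cvg (f := fun n => (U (b - inset a b n) - U (a + inset a b n))%:E)).
  by rewrite /Rintegral fineK//; exact: integrable_fin_num.
have -> : (fun n => W (b - inset a b n) - W (a + inset a b n)) =
  (fun n => U (b - inset a b n) - U (a + inset a b n)
     - (M * (b - a) - 2 * M * inset a b n)).
  by apply/funext => n; rewrite /U !fctE /GRing.scale/=; lra.
have hM : M * (b - a) - 2 * M * inset a b n @[n --> \oo] -->
    M * (b - a) - 2 * M * 0.
  apply: cvgB; first exact: cvg_cst.
  exact: (@cvgM _ _ _ _ (fun=> 2 * M) _ _ _ (cvg_cst _) (@cvg_inset R a b)).
rewrite mulr0 subr0 in hM.
exact: cvgB hU' hM.
Qed.

(** Continuity of [G] on the closed interval identifies the limit of its increments, while [f] is
    controlled only inside. *)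
Lemma FTC_oo_bounded (R : realType) (a b M : R) (f G : R -> R) : a < b ->
  (forall t, t \in `]a, b[ -> is_derive t 1 G (f t)) ->
  (forall t, t \in `]a, b[ -> {for t, continuous f}) ->
  (forall t, t \in `]a, b[ -> `|f t| <= M) ->
  {within `[a, b], continuous G} ->
  (leb1 R).-integrable `]a, b[%classic (EFin \o f) /\
  \int[leb1 R]_(t in `]a, b[) f t = G b - G a.
Proof.
move=> ab dG cf fM cG.
have fM' t : t \in `]a, b[ -> - M <= f t.
  by move=> /fM; rewrite ler_norml => /andP[].
have [K GK] : exists K, forall t, t \in `[a, b] -> `|G t| <= K.
  have /compact_bounded[K [_ hK]] :=
    continuous_compact cG (@segment_compact _ a b).
  by exists (K + 1) => t tab; apply: hK; [rewrite ltrDl|exists t].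
have GB s t : s \in `]a, b[ -> t \in `]a, b[ -> G t - G s <= K + K.
  move=> /itv_oocc/GK sK /itv_oocc/GK tK; apply: le_trans (ler_norm _) _.
  by apply: le_trans (ler_normB _ _) _; exact: lerD.
have [iF cF] := FTC_oo ab dG cf fM' GB; split => //.
have [_ Ga Gb] := (continuous_within_itvP _ ab).1 cG.
apply: (cvg_unique _ cF) => //; apply: cvgB.
  have /cvg_at_leftP := Gb; apply; split.
    by move=> n; rewrite ltrBlDr ltrDl inset_gt0.
  rewrite -[X in _ --> X]subr0; apply: cvgB; first exact: cvg_cst.
  exact: cvg_inset.
have /cvg_at_rightP := Ga; apply; split.
  by move=> n; rewrite ltrDl inset_gt0.
rewrite -[X in _ --> X]addr0; apply: cvgD; first exact: cvg_cst.
exact: cvg_inset.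
Qed.

Lemma subitv_oo (R : realType) (a b c d t : R) : a <= c -> d <= b ->
  t \in `]c, d[ -> t \in `]a, b[.
Proof.
move=> ac db; rewrite !in_itv/= => /andP[ct td].
by rewrite (le_lt_trans ac)//= (lt_le_trans td).
Qed.

(** Where [w >= - M] one has [|w| <= w + 2 M], so the [L^1] norm is controlled by the increments of
    the primitive. The last bound takes cancellations into account: [M] does not contribute to it,
    and this is what makes the flux error as small as [eps_N]. *)
Lemma FTC_oo_estimate (R : realType) (T M B : R) (w W : R -> R) : 0 < T ->
  (forall t, t \in `]0, T[ -> is_derive t 1 W (w t)) ->
  (forall t, t \in `]0, T[ -> {for t, continuous w}) ->
  (forall t, t \in `]0, T[ -> - M <= w t) -> 0 <= M ->
  (forall s t : R, s \in `]0, T[ -> t \in `]0, T[ -> `|W t - W s| <= B) ->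
  [/\ (leb1 R).-integrable `]0, T[%classic (EFin \o w),
      \int[leb1 R]_(t in `]0, T[) `|w t| <= B + 2 * M * T &
      forall a b : R, 0 <= a -> a < b -> b <= T ->
        `|\int[leb1 R]_(t in `]a, b[) w t| <= B].
Proof.
move=> T0 dW cw wM M0 WB.
have H (a b : R) : 0 <= a -> a < b -> b <= T ->
    (leb1 R).-integrable `]a, b[%classic (EFin \o w) /\
    `|\int[leb1 R]_(t in `]a, b[) w t| <= B.
  move=> a0 ab bT.
  have sub t : t \in `]a, b[ -> t \in `]0, T[ by exact: subitv_oo.
  have dW' t : t \in `]a, b[ -> is_derive t 1 W (w t) by move=> /sub/dW.
  have cw' t : t \in `]a, b[ -> {for t, continuous w} by move=> /sub/cw.
  have wM' t : t \in `]a, b[ -> - M <= w t by move=> /sub/wM.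
  have WB' s t : s \in `]a, b[ -> t \in `]a, b[ -> W t - W s <= B.
    by move=> /sub sT /sub tT; apply: le_trans (ler_norm _) _; exact: WB.
  have [iw cvW] := FTC_oo ab dW' cw' wM' WB'; split => //.
  have cvn : `|W (b - inset a b n) - W (a + inset a b n)| @[n --> \oo] -->
      `|\int[leb1 R]_(t in `]a, b[) w t|.
    by apply: cvg_norm; exact: cvW.
  rewrite -(cvg_lim _ cvn)//; apply: limr_le; first by apply/cvg_ex; eexists; exact: cvn.
  apply: nearW => n; apply: WB; apply: sub; rewrite in_itv/=.
  - by have := inset_lt n ab; have := inset_gt0 n ab => h1 h2; apply/andP; split; lra.
  - by have := inset_lt n ab; have := inset_gt0 n ab => h1 h2; apply/andP; split; lra.
have [iw wB] := H 0 T (lexx _) T0 (lexx _).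
split => //; last by move=> a b a0 ab bT; have [] := H a b a0 ab bT.
have iM := integrable_cst_itv 0 T (2 * M).
have iwM : (leb1 R).-integrable `]0, T[%classic
    (EFin \o (fun t => w t + 2 * M)).
  have := integrableD _ iw iM; rewrite (_ : (_ \+ _)%E = EFin \o (fun t => w t + 2 * M)).
    exact.
  by apply/funext => t /=; rewrite -EFinD.
apply: (@le_trans _ _ (\int[leb1 R]_(t in `]0, T[) (w t + 2 * M))).
  apply: le_Rintegral => //.
    have := integrable_abse iw; apply: eq_integrable => //.
  move=> t /wM wMt; rewrite ler_norml; apply/andP; split; lra.
rewrite RintegralD// (Rintegral_cst_itv _ (ltW T0)) subr0 lerD2r.
by apply: le_trans (ler_norm _) _.
Qed.

(** * Weak-star compactness of densities *)

Lemma near_forall_lt (T : Type) (F : set_system T) {FF : Filter F}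
    (P : nat -> T -> Prop) (m : nat) :
  (forall j, \forall x \near F, P j x) ->
  \forall x \near F, forall j, (j < m)%N -> P j x.
Proof.
move=> hP; elim: m => [|m IH]; first by near=> x.
near=> x => j; rewrite ltnS leq_eqVlt => /predU1P[->|jm]; first by near: x.
by move: j jm; near: x.
Unshelve. all: by end_near. Qed.

(** The sequences lie in a product of segments, compact by Tychonoff's theorem, so they have a
    cluster point. The single index [m] sets both the number of coordinates tested and the
    precision. *)
Lemma bounded_cluster (R : realType) (a : nat -> nat -> R) (M : nat -> R) :
  (forall n j, `|a n j| <= M j) ->
  exists l : nat -> R, forall m p, exists n, (p <= n)%N /\
    forall j, (j < m)%N -> `|l j - a n j| < m.+1%:R^-1.
Proof.
move=> aM.
pose X := prod_topology (fun _ : nat => (R : topologicalType)).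
have cK := @tychonoff nat (fun _ => (R : topologicalType))
  (fun j => `[- M j, M j]%classic) (fun j => @segment_compact R (- M j) (M j)).
pose F : set_system X := (fun n => (a n : X)) @ \oo.
have FF : ProperFilter F by exact: fmap_proper_filter.
have FK : F [set f | forall j, `[- M j, M j]%classic (f j)].
  by exists 0%N => // n _ j /=; rewrite in_itv/= -ler_norml.
have [l [_ cl]] := cK F FF FK.
exists l => m p.
have nl : nbhs (l : X) [set f : X | forall j, (j < m)%N -> `|l j - f j| < m.+1%:R^-1].
  apply: (@near_forall_lt X (nbhs (l : X)) _ (fun j f => `|l j - f j| < m.+1%:R^-1)).
  move=> j.
  have pj : (fun f : X => (f j : R)) @ nbhs (l : X) --> (l j : R).
    exact: (@proj_continuous nat (fun _ => (R : topologicalType)) j l).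
  have e0 : 0 < (m.+1%:R^-1 : R) by rewrite invr_gt0.
  exact: ((@cvgrPdist_lt R R _ (nbhs (l : X)) _ (fun f : X => f j) (l j)).1 pj _ e0).
have Fp : F [set f | exists2 n, (p <= n)%N & f = a n].
  by exists p => // n /= pn; exists n.
by have [_ [[n pn ->] hn]] := cl _ _ Fp nl; exists n.
Qed.

(** No nested subsequences: successive terms are picked ever closer to one cluster point, on ever
    more coordinates, each after the preceding one. *)
Lemma diagonal_subseq (R : realType) (I : countType) (a : nat -> I -> R)
    (M : I -> R) : (forall n i, `|a n i| <= M i) ->
  exists k : nat -> nat, {homo k : m n / (m < n)%N} /\
    forall i, cvg (a (k n) i @[n --> \oo]).
Proof.
move=> aM.
(* Codes that name no element of [I] get the constant sequence 0. *)
pose a' n j := if unpickle j is Some i then a n i else 0.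
pose M' j : R := if @unpickle I j is Some i then M i else 0.
have aM' n j : `|a' n j| <= M' j.
  by rewrite /a' /M'; case: unpickle => [i|]; rewrite ?normr0.
have [l hl] := bounded_cluster aM'.
pose P (mp : nat * nat) n := (mp.2 <= n)%N /\
  forall j, (j < mp.1)%N -> `|l j - a' n j| < mp.1.+1%:R^-1.
have [g hg] : {g : nat * nat -> nat & forall mp, P mp (g mp)}.
  by apply: choice => -[m p]; exact: hl.
pose k := fix k n := if n is m.+1 then g (m.+1, (k m).+1) else g (0%N, 0%N).
have kS n : (k n < k n.+1)%N by have [] := hg (n.+1, (k n).+1).
have hk n j : (j < n)%N -> `|l j - a' (k n) j| < n.+1%:R^-1.
  case: n => [//|n]; have [_] := hg (n.+1, (k n).+1).
  exact.
exists k; split; first exact: (homo_ltn ltn_trans).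
move=> i; apply/cvg_ex; exists (l (pickle i)).
apply/cvgrPdist_lt => e e0; near=> n.
have -> : a (k n) i = a' (k n) (pickle i) by rewrite /a' pickleK.
apply: lt_trans (hk n _ _) _; first by near: n; exact: nbhs_infty_gt.
by near: n; exact: near_infty_natSinv_lt (PosNum e0).
Unshelve. all: by end_near. Qed.

Lemma subseq_cvg_infty (k : nat -> nat) : {homo k : m n / (m < n)%N} ->
  k @ \oo --> \oo.
Proof.
move=> hk P [m _ hm]; exists m => // n /= mn; apply: hm => /=.
apply: leq_trans mn _; elim: n => // n IH.
by apply: leq_ltn_trans IH _; exact: hk.
Qed.

Lemma cvg_sumr (R : realType) (I : Type) (r : seq I) (P : pred I)
    (f : I -> nat -> R) (l : I -> R) :
  (forall i, f i n @[n --> \oo] --> l i) ->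
  \sum_(i <- r | P i) f i n @[n --> \oo] --> \sum_(i <- r | P i) l i.
Proof.
move=> fl; elim: r => [|i r IH].
  by rewrite big_nil; under eq_fun do rewrite big_nil; exact: cvg_cst.
rewrite big_cons; under eq_fun do rewrite big_cons.
by case: ifP => _ //; exact: cvgD.
Qed.

Lemma cvg_approx (R : realType) (u : nat -> R) :
  (forall e, 0 < e -> exists2 v : nat -> R, cvg (v n @[n --> \oo]) &
    forall n, `|u n - v n| <= e) -> cvg (u n @[n --> \oo]).
Proof.
move=> happ; apply/cauchy_cvgP; apply: cauchy_exP => e e0.
have [|v cv uv] := happ (e / 2); first by rewrite divr_gt0.
exists (lim (v n @[n --> \oo])).
have /cvgrPdist_lt/(_ (e / 2)) := cv; rewrite divr_gt0// => /(_ isT) near_v.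
suff : \forall n \near \oo, ball (lim (v n @[n --> \oo])) e (u n) by [].
near=> n; rewrite /ball/= -(subrKA (v n)).
rewrite [ltRHS]splitr; apply: le_lt_trans (ler_normD _ _) _.
apply: ltr_leD; first by near: n.
by rewrite distrC.
Unshelve. all: by end_near. Qed.

Lemma lim_approx (R : realType) (u : nat -> R) (l : R) :
  (forall e, 0 < e -> exists v : nat -> R, exists l', [/\ v n @[n --> \oo] --> l',
    `|l - l'| <= e & forall n, `|u n - v n| <= e]) -> u n @[n --> \oo] --> l.
Proof.
move=> happ; apply/cvgrPdist_lt => e e0.
have [|v [l' [cv ll' uv]]] := happ (e / 4); first by rewrite divr_gt0.
have /cvgrPdist_lt/(_ (e / 4)) := cv; rewrite divr_gt0// => /(_ isT) near_v.
near=> n.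
have h1 : `|l' - v n| < e / 4 by near: n.
have h2 := uv n.
have -> : l - u n = (l - l') + (l' - v n) - (u n - v n) by lra.
apply: le_lt_trans (ler_normB _ _) _.
have := ler_normD (l - l') (l' - v n) => h3; lra.
Unshelve. all: by end_near. Qed.

Lemma bigcup_tail (X : Type) (F : nat -> set X) m :
  \bigcup_(i >= m) F i = F m `|` \bigcup_(i >= m.+1) F i.
Proof.
apply/seteqP; split => [x [i /= mi Fix]|x [Fx|[i /= mi Fix]]].
- move: mi; rewrite leq_eqVlt => /predU1P[mi|mi]; first by left; rewrite mi.
  by right; exists i.
- by exists m => //=.
- by exists i => //=; exact: ltnW.
Qed.

(** * Integrals of uniformly bounded densities over measurable sets *)

Section bounded_densities.
Context (d : measure_display) (X : measurableType d) (R : realType)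
  (mu : {sigma_finite_measure set X -> \bar R}) (D : set X) (M : R)
  (u : nat -> X -> R).
Context (mD : measurable D) (muD : (mu D < +oo)%E)
  (mu_ : forall n, measurable_fun setT (u n))
  (u0 : forall n z, 0 <= u n z) (uM : forall n z, u n z <= M)
  (uD : forall n z, ~ D z -> u n z = 0).

Lemma densities_integrable n : mu.-integrable setT (EFin \o u n).
Proof.
have -> : EFin \o u n = (EFin \o u n) \_ D.
  apply/funext => z; rewrite patchE; case: ifPn => //; rewrite notin_setE => Dz.
  by rewrite /= uD.
apply/(integrable_mkcond _ mD); apply: (@integrable_bounded _ _ _ _ _ _ M) => //.
  exact: measurable_funTS.
by move=> z _; rewrite ger0_norm.
Qed.

Lemma densities_integrableS n (B : set X) : measurable B ->
  mu.-integrable B (EFin \o u n).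
Proof. by move=> mB; apply: integrableS (densities_integrable n). Qed.

Lemma mu_capD_fin (B : set X) : measurable B -> mu (D `&` B) \is a fin_num.
Proof.
move=> mB; rewrite ge0_fin_numE//; apply: le_lt_trans muD.
by apply: le_measure; rewrite ?inE//; exact: measurableI.
Qed.

Lemma densities_le n (B : set X) : measurable B ->
  0 <= \int[mu]_(z in B) u n z <= M * fine (mu (D `&` B)).
Proof.
move=> mB; apply/andP; split; first by apply: Rintegral_ge0 => z _.
have -> : \int[mu]_(z in B) u n z = \int[mu]_(z in D `&` B) u n z.
  rewrite setIC Rintegral_mkcondr; apply: eq_Rintegral => z _.
  by rewrite patchE; case: ifPn => //; rewrite notin_setE => /uD.
have mDB : measurable (D `&` B) by exact: measurableI.
rewrite -[leRHS]Rintegral_cst//; apply: le_Rintegral => //.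
  exact: densities_integrableS.
apply: (@integrable_bounded _ _ _ _ _ _ `|M|) => //.
by rewrite -ge0_fin_numE//; exact: mu_capD_fin.
Qed.

Lemma densities_setU n (A B : set X) : measurable A -> measurable B ->
  A `&` B = set0 -> \int[mu]_(z in A `|` B) u n z =
  \int[mu]_(z in A) u n z + \int[mu]_(z in B) u n z.
Proof.
move=> mA mB AB; apply: Rintegral_setU => //.
  by apply: densities_integrableS; exact: measurableU.
by rewrite disj_set2E AB.
Qed.

Lemma densities_tail n (F : (set X)^nat) m : (forall i, measurable (F i)) ->
  trivIset setT F ->
  \int[mu]_(z in \bigcup_i F i) u n z =
  \sum_(i < m) \int[mu]_(z in F i) u n z + \int[mu]_(z in \bigcup_(i >= m) F i) u n z.
Proof.
move=> mF tF; elim: m => [|m IH].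
  by rewrite big_ord0 add0r; congr Rintegral; apply: eq_bigcupl.
rewrite IH big_ord_recr/= -addrA; congr (_ + _).
rewrite bigcup_tail densities_setU//; first exact: bigcup_measurable.
apply/seteqP; split => // z [Fmz [i /= mi Fiz]].
have E : m = i by apply: (tF m i I I); exists z.
by move: mi; rewrite E ltnn.
Qed.

Lemma tail_cvg0 (F : (set X)^nat) : (forall i, measurable (F i)) ->
  trivIset setT F ->
  fine (mu (D `&` \bigcup_(i >= m) F i)) @[m --> \oo] --> (0 : R).
Proof.
move=> mF tF; pose G m := D `&` \bigcup_(i >= m) F i.
have mG m : measurable (G m) by apply: measurableI => //; exact: bigcup_measurable.
have ndG : {homo G : n m / (n <= m)%N >-> (m <= n)%O}.
  move=> n m nm; apply/subsetPset => z [Dz [i /= mi Fiz]]; split => //.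
  by exists i => //=; exact: leq_trans mi.
have G0 : \bigcap_n G n = set0.
  apply/seteqP; split => // z zG.
  have [_ [i _ Fiz]] := zG 0%N I; have [_ [j /= ij Fjz]] := zG i.+1 I.
  have E : i = j by apply: (tF i j I I); exists z.
  by move: ij; rewrite E ltnn.
have := @nonincreasing_cvg_mu _ _ _ mu G _ mG _ ndG.
rewrite G0 measure0 => h; apply: fine_cvg; apply: h => //.
by rewrite -ge0_fin_numE//; apply: mu_capD_fin; exact: bigcup_measurable.
Qed.

(** Countable additivity uniform in [n]: inside [D] the tails of a disjoint union have [mu]-measure
    tending to 0, and the densities share the bound [M]. *)
Lemma tail_small (F : (set X)^nat) (e : R) : (forall i, measurable (F i)) ->
  trivIset setT F -> 0 < e ->
  \forall m \near \oo, forall n,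
    `|\int[mu]_(z in \bigcup_i F i) u n z -
      \sum_(i < m) \int[mu]_(z in F i) u n z| <= e.
Proof.
move=> mF tF e0; have M0 : 0 < `|M| + 1 by rewrite ltr_wpDl.
have /cvgrPdist_lt/(_ (e / (`|M| + 1))) := tail_cvg0 mF tF.
rewrite divr_gt0// => /(_ isT) near_m; near=> m => n.
rewrite (densities_tail n m mF tF) addrAC subrr add0r.
have mT : measurable (\bigcup_(i >= m) F i) by exact: bigcup_measurable.
have /andP[h0 h1] := densities_le n mT.
rewrite ger0_norm//; apply: le_trans h1 _.
have : `|0 - fine (mu (D `&` \bigcup_(i >= m) F i))| < e / (`|M| + 1) by near: m.
rewrite sub0r normrN ger0_norm ?fine_ge0// ltr_pdivlMr// mulrC => h.
apply: le_trans (ltW h); rewrite ler_wpM2r ?fine_ge0//.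
by apply: le_trans (ler_norm _) _; rewrite lerDl.
Unshelve. all: by end_near. Qed.

(** The sets over which the integrals converge form a Dynkin system: complements use convergence on
    the whole space, disjoint unions the uniform smallness of the tails. *)
Lemma densities_cvg_generated (G : set (set X)) :
  @measurable _ X = <<s G >> -> setI_closed G ->
  cvg (\int[mu]_z u n z @[n --> \oo]) ->
  (forall B, G B -> cvg (\int[mu]_(z in B) u n z @[n --> \oo])) ->
  forall B, measurable B -> cvg (\int[mu]_(z in B) u n z @[n --> \oo]).
Proof.
move=> mG GI cT cG B mB; have sGB : <<s G >> B by rewrite -mG.
pose P B := cvg (\int[mu]_(z in B) u n z @[n --> \oo]).
apply: (@dynkin_induction _ _ G P mG GI cT cG _ _ B sGB).
- move=> A mA cA; rewrite /P.
  have -> : (fun n => \int[mu]_(z in ~` A) u n z) =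
      (fun n => \int[mu]_z u n z - \int[mu]_(z in A) u n z).
    apply/funext => n; rewrite -[in RHS](setvU A) densities_setU ?setICl//.
      by rewrite addrK.
    exact: measurableC.
  exact: (is_cvgB cT cA).
- move=> F mF tF cF; rewrite /P; apply: cvg_approx => e e0.
  have [m _ hm] := tail_small mF tF e0.
  exists (fun n => \sum_(i < m) \int[mu]_(z in F i) u n z).
    apply/cvg_ex; exists (\sum_(i < m) lim (\int[mu]_(z in F i) u n z @[n --> \oo])).
    by apply: cvg_sumr => i; exact: cF.
  by move=> n; apply: hm => /=.
Qed.

End bounded_densities.

Section density_limit.
Context (d : measure_display) (X : measurableType d) (R : realType)
  (mu : {sigma_finite_measure set X -> \bar R}) (D : set X) (M : R)
  (u : nat -> X -> R).
Context (mD : measurable D) (muD : (mu D < +oo)%E)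
  (mu_ : forall n, measurable_fun setT (u n))
  (u0 : forall n z, 0 <= u n z) (uM : forall n z, u n z <= M)
  (uD : forall n z, ~ D z -> u n z = 0).
Context (uC : forall B, measurable B ->
  cvg (\int[mu]_(z in B) u n z @[n --> \oo])).

(** The maximum with 0 makes the value nonnegative on every set, also on nonmeasurable ones, where
    nothing is known of the limit. On measurable sets it changes nothing. *)
Definition limit_measure (B : set X) : \bar R :=
  (Num.max 0 (lim (\int[mu]_(z in B) u n z @[n --> \oo])))%:E.

Lemma limit_measureE (B : set X) : measurable B ->
  limit_measure B = (lim (\int[mu]_(z in B) u n z @[n --> \oo]))%:E.
Proof.
move=> mB; rewrite /limit_measure; congr (_%:E); apply/max_idPr.
apply: limr_ge; first exact: uC.
by apply: nearW => n; apply: Rintegral_ge0.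
Qed.

Lemma limit_measure0 : limit_measure set0 = 0%E.
Proof.
rewrite limit_measureE//; congr (_%:E); apply: cvg_lim => //.
by under eq_fun do rewrite Rintegral_set0; exact: cvg_cst.
Qed.

Lemma limit_measure_ge0 (B : set X) : (0 <= limit_measure B)%E.
Proof. by rewrite lee_fin le_max lexx. Qed.

Lemma limit_measure_sigma_additive : semi_sigma_additive limit_measure.
Proof.
move=> F mF tF mUF.
have -> : (fun n => \sum_(0 <= i < n) limit_measure (F i))%E = EFin \o
    (fun m => \sum_(i < m) lim (\int[mu]_(z in F i) u n z @[n --> \oo])).
  apply/funext => m /=; rewrite big_mkord -sumEFin.
  by apply: eq_bigr => i _; rewrite limit_measureE.
rewrite limit_measureE//; apply: cvg_EFin; first exact: nearW.
apply/cvgrPdist_le => e e0; near=> m.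
have cdiff : \int[mu]_(z in \bigcup_i F i) u n z -
      \sum_(i < m) \int[mu]_(z in F i) u n z @[n --> \oo] -->
    lim (\int[mu]_(z in \bigcup_i F i) u n z @[n --> \oo]) -
      \sum_(i < m) lim (\int[mu]_(z in F i) u n z @[n --> \oo]).
  by apply: cvgB; [exact: uC|apply: cvg_sumr => i; exact: uC].
have cn := cvg_norm cdiff.
have {cn}cn : `|\int[mu]_(z in \bigcup_i F i) u n z -
      \sum_(i < m) \int[mu]_(z in F i) u n z| @[n --> \oo] -->
    `|lim (\int[mu]_(z in \bigcup_i F i) u n z @[n --> \oo]) -
      \sum_(i < m) lim (\int[mu]_(z in F i) u n z @[n --> \oo])|.
  by apply: cvg_norm; exact: cdiff.
rewrite /= -(cvg_lim _ cn)//; apply: limr_le; first by apply/cvg_ex; eexists; exact: cn.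
apply: nearW => n; move: n; near: m.
exact: (tail_small mD muD mu_ u0 uM uD mF tF e0).
Unshelve. all: by end_near. Qed.

(** The limits of the integrals form a measure dominated by [M mu] on [D], and the limit density is
    its Radon-Nikodym derivative. That derivative obeys the bounds only up to a null set; truncating
    it gives them everywhere. *)
Lemma density_limit : exists f : X -> R, [/\ measurable_fun setT f,
    forall z, 0 <= f z <= M, forall z, ~ D z -> f z = 0 &
    forall B, measurable B ->
      \int[mu]_(z in B) u n z @[n --> \oo] --> \int[mu]_(z in B) f z].
Proof.
pose nuM : {measure set X -> \bar R} := HB.pack limit_measure
  (isMeasure.Build _ _ _ limit_measure limit_measure0 limit_measure_ge0
     limit_measure_sigma_additive).
have fin : fin_num_fun nuM by move=> B mB.
pose H1 := isFinite.Build _ _ _ _ fin.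
have sfin : sigma_finite setT nuM.
  by apply: fin_num_fun_sigma_finite; [rewrite measure0|exact: fin].
pose H2 := isSFinite.Build _ _ _ _ (sfinite_measure_sigma_finite sfin).
pose H3 := isSigmaFinite.Build _ _ _ _ sfin.
pose nu := HB.pack_for (FiniteMeasure.type X R) (Measure.sort nuM) H1 H2 H3.
have nuE B : nu B = limit_measure B by [].
have nule B : measurable B -> (nu B <= M%:E * mu (D `&` B))%E.
  move=> mB; rewrite nuE limit_measureE//.
  rewrite -(fineK (mu_capD_fin mD muD mB)) -EFinM lee_fin.
  apply: limr_le; first exact: uC.
  by apply: nearW => n; have /andP[] := densities_le mD muD mu_ u0 uM uD n mB.
have dom :  nu `<< mu.
  apply/null_content_dominatesP => B mB B0; apply/eqP.
  rewrite eq_le limit_measure_ge0 andbT; apply: le_trans (nule B mB) _.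
  suff -> : mu (D `&` B) = 0%E by rewrite mule0.
  apply/eqP; rewrite eq_le measure_ge0 andbT -B0; apply: le_measure; rewrite ?inE//.
  exact: measurableI.
have [g [g0 gfin ig gE]] := radon_nikodym_sigma_finite dom.
pose G z := fine (g z).
have gG : g = EFin \o G by apply/funext => z; rewrite /G/= fineK.
have G0 z : 0 <= G z by rewrite fine_ge0.
have iG : mu.-integrable setT (EFin \o G) by rewrite -gG.
have iGS B : measurable B -> mu.-integrable B (EFin \o G).
  by move=> mB; apply: integrableS iG.
have mG : measurable_fun setT G by apply/measurable_EFinP; exact: measurable_int iG.
have GE B : measurable B -> \int[mu]_(z in B) u n z @[n --> \oo] --> \int[mu]_(z in B) G z.
  move=> mB; have := gE B mB; rewrite nuE limit_measureE// gG => E.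
  by rewrite /Rintegral -E; exact: uC.
have Gle B : measurable B -> \int[mu]_(z in B) G z <= M * fine (mu (D `&` B)).
  move=> mB; rewrite -(cvg_lim _ (GE B mB))//; apply: limr_le; first exact: uC.
  by apply: nearW => n; have /andP[] := densities_le mD muD mu_ u0 uM uD n mB.
(* The derivative truncated at [M] and cut off outside [D]; it remains to see that no integral
   changes. *)
pose f := (fun z => Num.min (G z) M) \_ D.
have mminG : measurable_fun setT (fun z => Num.min (G z) M).
  exact: measurable_minr.
have mf : measurable_fun setT f.
  by apply/(measurable_restrictT _ mD); exact: measurable_funTS.
have M0 (z : X) : 0 <= M by apply: le_trans (u0 0%N z) (uM 0%N z).
have f0 z : 0 <= f z.
  by rewrite /f patchE; case: ifP => // _; rewrite le_min G0 (M0 z).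
have fM z : f z <= M.
  by rewrite /f patchE; case: ifP => _; rewrite ?(M0 z)// ge_min lexx orbT.
have fG z : f z <= G z.
  by rewrite /f patchE; case: ifP => _; rewrite ?G0// ge_min lexx.
have iF : mu.-integrable setT (EFin \o f).
  apply: le_integrable iG => //; first exact/measurable_EFinP.
  by move=> z _ /=; rewrite lee_fin !ger0_norm.
pose B1 := D `&` [set z | M < G z].
have mB1 : measurable B1.
  have := @emeasurable_fun_o_infty _ _ _ D (EFin \o G) mD _ M%:E.
  by apply; apply/measurable_EFinP; exact: measurable_funTS.
have B1D : D `&` B1 = B1 by rewrite /B1 setIA setIid.
have B1fin : (mu B1 < +oo)%E.
  by rewrite -B1D -ge0_fin_numE//; exact: mu_capD_fin.
pose h z := G z - f z.
have h0 z : 0 <= h z by rewrite /h subr_ge0.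
have ih : mu.-integrable setT (EFin \o h).
  have := integrableB measurableT iG iF.
  by rewrite (_ : (_ \- _)%E = EFin \o h)//; apply/funext => z.
(* The loss [G - f] is carried by [B1], where [G] exceeds [M], and by the complement of [D]. On
   both, [Gle] makes its integral nonpositive; being nonnegative, the loss integrates to 0 over
   every measurable set. *)
have hE z : h z = ((fun z => G z - M) \_ B1) z + (G \_ (~` D)) z.
  rewrite /h /f !patchE; have [Dz|nDz] := pselect (D z).
    rewrite (mem_set Dz) (memNset (_ : ~ (~` D) z)); last exact.
    rewrite addr0; have [MG|GM] := ltP M (G z).
      by rewrite mem_set.
    by rewrite memNset ?subrr// => -[_ /=]; rewrite ltNge GM.
  rewrite (memNset nDz) (memNset (_ : ~ B1 z)); last by case.
  by rewrite (mem_set (_ : (~` D) z))// subr0 add0r.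
have iM : mu.-integrable B1 (EFin \o cst M).
  by apply: (@integrable_bounded _ _ _ _ _ _ `|M|).
have iGM : mu.-integrable B1 (EFin \o (fun z => G z - M)).
  have := integrableB mB1 (iGS _ mB1) iM.
  by rewrite (_ : (_ \- _)%E = EFin \o (fun z => G z - M))//; apply/funext => z.
have mDC : measurable (~` D) by exact: measurableC.
have hle0 : \int[mu]_z h z <= 0.
  rewrite (@eq_Rintegral _ _ _ mu _
    (fun z => ((fun z => G z - M) \_ B1) z + (G \_ (~` D)) z)); last first.
    by move=> z _; exact: hE.
  rewrite RintegralD//; first last.
  - by rewrite -restrict_EFin; apply/(integrable_mkcond _ mDC); exact: iGS.
  - by rewrite -restrict_EFin; apply/(integrable_mkcond _ mB1).
  rewrite -!Rintegral_mkcond RintegralB//; last exact: iGS.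
  rewrite (Rintegral_cst _ mB1).
  have := Gle _ mB1; rewrite B1D; have := Gle _ mDC; rewrite setICr measure0 mulr0.
  by move=> h1 h2; rewrite -[leRHS]addr0 lerD// subr_le0.
exists f; split => //.
- by move=> z; rewrite f0 fM.
- by move=> z nDz; rewrite /f patchE memNset.
- move=> B mB; suff <- : \int[mu]_(z in B) G z = \int[mu]_(z in B) f z by exact: GE.
  have iFB : mu.-integrable B (EFin \o f) by apply: integrableS iF.
  have ihB : mu.-integrable B (EFin \o h) by apply: integrableS ih.
  apply/eqP; rewrite -subr_eq0 -RintegralB//; last exact: iGS.
  rewrite eq_le; apply/andP; split; last by apply: Rintegral_ge0 => z _; exact: h0.
  apply: le_trans hle0; rewrite Rintegral_mkcond; apply: le_Rintegral => //.
    by rewrite -restrict_EFin; apply/(integrable_mkcond _ mB).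
  by move=> z _; rewrite patchE; case: ifP.
Qed.

End density_limit.

(** * From measurable sets to integrable test functions *)

Lemma Rintegral_sum (d : measure_display) (X : measurableType d) (R : realType)
    (mu : {measure set X -> \bar R}) (I : Type) (r : seq I) (f : I -> X -> R)
    (D : set X) : measurable D ->
  (forall i, mu.-integrable D (EFin \o f i)) ->
  \int[mu]_(z in D) (\sum_(i <- r) f i z) = \sum_(i <- r) \int[mu]_(z in D) f i z /\
  mu.-integrable D (EFin \o (fun z => \sum_(i <- r) f i z)).
Proof.
move=> mD intf; elim: r => [|i r [IH1 IH2]].
  rewrite big_nil; split.
    under eq_Rintegral do rewrite big_nil.
    by rewrite Rintegral_cst// mul0r.
  rewrite (_ : _ \o _ = cst 0%E); last by apply/funext => z /=; rewrite big_nil.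
  exact: integrable0.
have isum : mu.-integrable D (EFin \o (fun z => f i z + \sum_(j <- r) f j z)).
  have := integrableD mD (intf i) IH2.
  by rewrite (_ : (_ \+ _)%E = EFin \o (fun z => f i z + \sum_(j <- r) f j z)).
split; last first.
  rewrite (_ : _ \o _ = EFin \o (fun z => f i z + \sum_(j <- r) f j z))//.
  by apply/funext => z /=; rewrite big_cons.
under eq_Rintegral do rewrite big_cons.
by rewrite RintegralD// big_cons IH1.
Qed.

Lemma integrableZr (d : measure_display) (X : measurableType d) (R : realType)
    (mu : {measure set X -> \bar R}) (f g : X -> R) (M : R) (D : set X) :
  measurable D -> measurable_fun D f -> (forall z, D z -> `|f z| <= M) ->
  mu.-integrable D (EFin \o g) -> mu.-integrable D (EFin \o (fun z => f z * g z)).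
Proof.
move=> mD mf fM ig.
have iMg : mu.-integrable D (fun z => (M%:E * (EFin \o g) z)%E) by exact: integrableZl.
apply: le_integrable iMg => //.
  apply/measurable_EFinP; apply: measurable_funM => //.
  by apply/measurable_EFinP; exact: measurable_int ig.
move=> z Dz /=; rewrite !normrM lee_fin ler_wpM2r// (le_trans (fM z Dz))//.
exact: ler_norm.
Qed.

Import HBSimple.

Lemma Rintegral_mul_simple (d : measure_display) (X : measurableType d)
    (R : realType) (mu : {measure set X -> \bar R}) (w : X -> R)
    (phi : {sfun X >-> R}) : mu.-integrable setT (EFin \o w) ->
  \int[mu]_z (w z * phi z) = \sum_(y <- fset_set (range phi))
    y * \int[mu]_(z in phi @^-1` [set y]) w z.
Proof.
move=> iw.
have mA y : measurable (phi @^-1` [set y]) by exact: measurable_sfunP.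
have iwA y : mu.-integrable setT (EFin \o (w \_ (phi @^-1` [set y]))).
  by rewrite -restrict_EFin; apply/(integrable_mkcond _ (mA y)); apply: integrableS iw.
have [E _] : \int[mu]_z (\sum_(y <- fset_set (range phi)) y * (w \_ (phi @^-1` [set y])) z) =
    \sum_(y <- fset_set (range phi)) \int[mu]_z (y * (w \_ (phi @^-1` [set y])) z) /\
    mu.-integrable setT (EFin \o
      (fun z => \sum_(y <- fset_set (range phi)) y * (w \_ (phi @^-1` [set y])) z)).
  apply: Rintegral_sum => // y.
  have := integrableZl measurableT y (iwA y).
  by [].
transitivity (\sum_(y <- fset_set (range phi))
    \int[mu]_z (y * (w \_ (phi @^-1` [set y])) z)); last first.
  by apply: eq_bigr => y _; rewrite RintegralZl// -Rintegral_mkcond.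
rewrite -E.
apply: eq_Rintegral => z _; rewrite fimfunE fsbig_finite//= big_distrr/=.
apply: eq_bigr => y _; rewrite mulrCA; congr (_ * _).
by rewrite patchE indicE; case: ifP => /= _; rewrite ?mulr1 ?mulr0.
Qed.

(** Convergence on measurable sets gives it for simple functions; these are dense in [L^1], and the
    common bound [M] makes the approximation uniform in [n]. *)
Lemma weakstar_simple_dense (d : measure_display) (X : measurableType d)
    (R : realType) (mu : {measure set X -> \bar R}) (M : R) (u : nat -> X -> R)
    (f g : X -> R) : 0 <= M ->
  (forall n, mu.-integrable setT (EFin \o u n)) ->
  mu.-integrable setT (EFin \o f) ->
  (forall n z, `|u n z| <= M) -> (forall z, `|f z| <= M) ->
  (forall B, measurable B ->
      \int[mu]_(z in B) u n z @[n --> \oo] --> \int[mu]_(z in B) f z) ->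
  mu.-integrable setT (EFin \o g) ->
  \int[mu]_z (u n z * g z) @[n --> \oo] --> \int[mu]_z (f z * g z).
Proof.
move=> M0 iu iF uM fM uf ig; apply: lim_approx => e e0.
have [phi_ [iphi _ phig]] := approximation_sfun_integrable measurableT ig.
(* Dividing by [M + 1] covers the case [M = 0]. *)
have e1 : 0 < e / (M + 1) by rewrite divr_gt0// ltr_wpDl.
have [p hp] : exists p, (\int[mu]_z `|(g z)%:E - (phi_ p z)%:E| <= (e / (M + 1))%:E)%E.
  have /fine_cvgP[_ /cvgrPdist_le/(_ _ e1)[p _ hp]] := phig.
  exists p; have := hp p (leqnn p); rewrite /= sub0r normrN => /(le_trans (ler_norm _)).
  rewrite -lee_fin fineK//; apply: integrable_fin_num => //.
  exact: (integrable_abse (integrableB measurableT ig (iphi p))).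
set phi := phi_ p in hp; have {}iphi := iphi p; rewrite -/phi in iphi.
have igp : mu.-integrable setT (EFin \o (fun z => g z - phi z)).
  have := integrableB measurableT ig iphi.
  by rewrite (_ : (_ \- _)%E = EFin \o (fun z => g z - phi z)).
have close (w : X -> R) : measurable_fun setT w -> (forall z, `|w z| <= M) ->
    `|\int[mu]_z (w z * g z) - \int[mu]_z (w z * phi z)| <= e.
  move=> mw wM.
  rewrite -RintegralB//; [|exact: (@integrableZr _ _ _ _ _ _ M)..].
  have iwgp : mu.-integrable setT (EFin \o (fun z => w z * (g z - phi z))).
    exact: (@integrableZr _ _ _ _ _ _ M).
  under eq_Rintegral do rewrite -mulrBr.
  apply: le_trans (le_normr_Rintegral _ _) _ => //.
  apply: (@le_trans _ _ (\int[mu]_z (M * `|g z - phi z|))).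
    apply: le_Rintegral => //.
    - exact: integrable_norm.
    - have := integrable_norm igp; exact: integrableZl.
    - by move=> z _; rewrite normrM ler_wpM2r.
  rewrite RintegralZl//; last exact: integrable_norm.
  apply: (@le_trans _ _ (M * (e / (M + 1)))).
    rewrite ler_wpM2l// -lee_fin fineK; last first.
      by apply: integrable_fin_num => //; exact: integrable_norm.
    exact: hp.
  by rewrite mulrCA ger_pMr// ler_pdivrMr ?ltr_wpDl// mul1r lerDl.
have mu_ n : measurable_fun setT (u n) by apply/measurable_EFinP; exact: measurable_int (iu n).
have mf : measurable_fun setT f by apply/measurable_EFinP; exact: measurable_int iF.
exists (fun n => \int[mu]_z (u n z * phi z)), (\int[mu]_z (f z * phi z)); split.
- rewrite Rintegral_mul_simple//.
  under eq_fun do rewrite Rintegral_mul_simple//.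
  apply: cvg_sumr => y; apply: cvgM; first exact: cvg_cst.
  by apply: uf; exact: measurable_sfunP.
- exact: close.
- by move=> n; exact: close.
Qed.

(** * Countable generators of the Borel sets of the line and of the plane *)

(** Rational rays are countably many, so one diagonal extraction handles all of them, and closed
    under intersection, so that convergence extends to all Borel sets. *)
Definition rat_ray (R : realType) (q : rat) : set R := `]ratr q, +oo[%classic.

Definition rat_quadrant (R : realType) (pq : rat * rat) : set (R * R) :=
  @rat_ray R pq.1 `*` @rat_ray R pq.2.

Lemma measurable_fun_rat_ray (d : measure_display) (X : measurableType d)
    (R : realType) (f : X -> R) :
  (forall q, measurable (f @^-1` @rat_ray R q)) -> measurable_fun setT f.
Proof.
move=> hf; apply: (measurability _ (RGenOInfty.measurableE R)).
move=> /= _ [_ [x ->] <-]; rewrite setTI.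
have -> : f @^-1` `]x, +oo[ =
    \bigcup_(q in [set: rat]) (if x < ratr q then f @^-1` @rat_ray R q else set0).
  apply/seteqP; split => [z|z [q _]].
    rewrite /= in_itv/= andbT => xz; have [q] := rat_in_itvoo xz.
    rewrite in_itv/= => /andP[xq qz]; exists q => //.
    by rewrite xq /rat_ray/= in_itv/= qz.
  case: ifP => // xq; rewrite /rat_ray/= !in_itv/= !andbT.
  exact: lt_trans.
by apply: bigcupT_measurable_rat => q; case: ifP.
Qed.

Lemma measurable_rat_ray (R : realType) (q : rat) :
  measurable (@rat_ray R q : set (measurableTypeR R)).
Proof. exact: measurable_itv. Qed.

Lemma rat_ray_generates (R : realType) :
  @measurable _ (measurableTypeR R) = <<s range (@rat_ray R) >>.
Proof.
apply/seteqP; split; last first.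
  apply: smallest_sub; first exact: sigma_algebra_measurable.
  by move=> _ [q _ <-]; exact: measurable_rat_ray.
move=> B mB.
have mid : measurable_fun setT (id : g_sigma_algebraType (range (@rat_ray R)) -> R).
  apply: measurable_fun_rat_ray => q; apply: sub_sigma_algebra.
  by exists q.
by have := mid measurableT B mB; rewrite setTI.
Qed.

Lemma rat_rayI (R : realType) (p q : rat) :
  @rat_ray R p `&` @rat_ray R q = @rat_ray R (Num.max p q).
Proof.
apply/seteqP; split => x; rewrite /rat_ray/= !in_itv/= !andbT; case: (leP p q) => pq.
- by case.
- by case.
- by move=> qx; split => //; apply: le_lt_trans qx; rewrite ler_rat.
- by move=> px; split => //; apply: lt_trans px; rewrite ltr_rat.
Qed.

(** Both coordinates are measurable for the generated algebra, because a half-plane is the union of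
    the rational quadrants whose other corner coordinate runs over the rationals. *)
Lemma rat_quadrant_generates (R : realType) :
  @measurable _ (measurableTypeR R * measurableTypeR R)%type =
  <<s range (@rat_quadrant R) >>.
Proof.
apply/seteqP; split; last first.
  apply: smallest_sub; first exact: sigma_algebra_measurable.
  by move=> _ [q _ <-]; apply: measurableX; exact: measurable_rat_ray.
have ex_lt (x : R) : exists q : rat, ratr q < x.
  have [q] := @rat_in_itvoo R (x - 1) x ltac:(lra).
  by rewrite in_itv/= => /andP[_ qx]; exists q.
pose X := g_sigma_algebraType (range (@rat_quadrant R)).
have m1 : measurable_fun setT (fst : X -> R).
  apply: measurable_fun_rat_ray => p.
  have -> : (fst : X -> R) @^-1` @rat_ray R p =
      \bigcup_(q in [set: rat]) (@rat_quadrant R (p, q) : set X).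
    apply/seteqP; split => [[x y] /= px|[x y] [q _ []]//].
    by have [q qy] := ex_lt y; exists q => //; split => //=; rewrite /rat_ray/= in_itv/= qy.
  by apply: bigcupT_measurable_rat => q; apply: sub_sigma_algebra; exists (p, q).
have m2 : measurable_fun setT (snd : X -> R).
  apply: measurable_fun_rat_ray => p.
  have -> : (snd : X -> R) @^-1` @rat_ray R p =
      \bigcup_(q in [set: rat]) (@rat_quadrant R (q, p) : set X).
    apply/seteqP; split => [[x y] /= px|[x y] [q _ []]//].
    by have [q qy] := ex_lt x; exists q => //; split => //=; rewrite /rat_ray/= in_itv/= qy.
  by apply: bigcupT_measurable_rat => q; apply: sub_sigma_algebra; exists (q, p).
apply: smallest_sub; first exact: smallest_sigma_algebra.
rewrite subUset; split => _ [B mB <-].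
  exact: m1 measurableT B mB.
exact: m2 measurableT B mB.
Qed.

Lemma rat_ray_setI_closed (R : realType) : setI_closed (range (@rat_ray R)).
Proof. by move=> _ _ [p _ <-] [q _ <-]; rewrite rat_rayI; exists (Num.max p q). Qed.

Lemma rat_quadrant_setI_closed (R : realType) :
  setI_closed (range (@rat_quadrant R)).
Proof.
move=> _ _ [[p p'] _ <-] [[q q'] _ <-]; exists (Num.max p q, Num.max p' q') => //.
by rewrite /rat_quadrant/= -!rat_rayI setXI.
Qed.

(** Convergence over the generating sets is a hypothesis: one subsequence has to serve several
    densities at once and is extracted beforehand. *)
Lemma weakstar_compactness (d : measure_display) (X : measurableType d)
    (R : realType) (mu : {sigma_finite_measure set X -> \bar R}) (D : set X)
    (M : R) (u : nat -> X -> R) (G : set (set X)) :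
  measurable D -> (mu D < +oo)%E -> 0 <= M ->
  (forall n, measurable_fun setT (u n)) ->
  (forall n z, 0 <= u n z <= M) -> (forall n z, ~ D z -> u n z = 0) ->
  @measurable _ X = <<s G >> -> setI_closed G ->
  cvg (\int[mu]_z u n z @[n --> \oo]) ->
  (forall B, G B -> cvg (\int[mu]_(z in B) u n z @[n --> \oo])) ->
  exists f : X -> R, [/\ measurable_fun setT f,
    forall z, 0 <= f z <= M, forall z, ~ D z -> f z = 0,
    mu.-integrable setT (EFin \o f) &
    forall g, mu.-integrable setT (EFin \o g) ->
      \int[mu]_z (u n z * g z) @[n --> \oo] --> \int[mu]_z (f z * g z)].
Proof.
move=> mD muD M0 mu_ uM uD GE GI cT cG.
have u0 n z : 0 <= u n z by have /andP[] := uM n z.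
have uM' n z : u n z <= M by have /andP[] := uM n z.
have cB := densities_cvg_generated mD muD mu_ u0 uM' uD GE GI cT cG.
have [f [mf f0 fD fB]] := density_limit mD muD mu_ u0 uM' uD cB.
have iF : mu.-integrable setT (EFin \o f).
  have fM z : f z <= M by have /andP[] := f0 z.
  have fge0 z : 0 <= f z by have /andP[] := f0 z.
  exact: (@densities_integrable _ _ _ mu D M (fun=> f) mD muD (fun=> mf)
    (fun=> fge0) (fun=> fM) (fun=> fD) 0%N).
exists f; split => // g ig.
apply: (weakstar_simple_dense M0) => //.
- by move=> n; exact: (densities_integrable mD muD mu_ u0 uM' uD n).
- by move=> n z; rewrite ger0_norm.
- by move=> z; have /andP[z0 zM] := f0 z; rewrite ger0_norm.
Qed.

(** * Sums over the cells *)

(** The plane carries the product sigma-algebra; an open set belongs to it as a countable union of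
    rational rectangles. *)
Lemma open_measurable2 (R : realType) (U : set (R * R)) :
  open U -> measurable (U : set (measurableTypeR R * measurableTypeR R)).
Proof.
move=> oU.
pose Q (p q r s : rat) : set (R * R) :=
  (`]ratr p, ratr q[%classic : set R) `*` (`]ratr r, ratr s[%classic : set R).
have -> : U = \bigcup_(p in [set: rat]) \bigcup_(q in [set: rat])
    \bigcup_(r in [set: rat]) \bigcup_(s in [set: rat])
      (if pselect (Q p q r s `<=` U) then Q p q r s else set0).
  apply/seteqP; split => [[a b] Uab|z [p _ [q _ [r _ [s _]]]]]; last first.
    by case: pselect => // QU /QU.
  have /nbhs_ballP[e /= e0 eU] : nbhs (a, b) U by apply: open_nbhs_nbhs.
  have [p] := @rat_in_itvoo R (a - e) a ltac:(lra).
  have [q] := @rat_in_itvoo R a (a + e) ltac:(lra).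
  have [r] := @rat_in_itvoo R (b - e) b ltac:(lra).
  have [s] := @rat_in_itvoo R b (b + e) ltac:(lra).
  rewrite !in_itv/= => /andP[s1 s2] /andP[r1 r2] /andP[q1 q2] /andP[p1 p2].
  exists p => //; exists q => //; exists r => //; exists s => //.
  case: pselect => [QU|]; first by split; rewrite /= in_itv/= ?p2 ?q1 ?r2 ?s1.
  case; case=> a' b' [/=]; rewrite !in_itv/= => /andP[a1 a2] /andP[b1 b2].
  apply: eU; split; rewrite /ball/= ltr_norml; apply/andP; split; lra.
apply: bigcupT_measurable_rat => p; apply: bigcupT_measurable_rat => q.
apply: bigcupT_measurable_rat => r; apply: bigcupT_measurable_rat => s.
case: pselect => [QU|QU]; last exact: measurable0.
have m1 (a b : R) : measurable (`]a, b[%classic : set (measurableTypeR R)).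
  exact: measurable_itv.
exact: measurableX (m1 _ _) (m1 _ _).
Qed.

Lemma continuous_measurable_fun2 (R : realType) (G : R * R -> R) :
  continuous G ->
  measurable_fun setT (G : measurableTypeR R * measurableTypeR R -> R).
Proof.
move=> cG; apply: (measurability _ (RGenOInfty.measurableE R)).
move=> /= _ [_ [x ->] <-]; rewrite setTI; apply: open_measurable2.
by apply: open_comp; [move=> z _; exact: cG|exact: interval_open].
Qed.

(** * Extension of functions from a box to the plane *)

Definition clamp (R : realType) (a b t : R) : R := Num.max a (Num.min b t).

Lemma clamp_itv (R : realType) (a b t : R) : a <= b -> clamp a b t \in `[a, b].
Proof. by move=> ab; rewrite in_itv/= le_max lexx/= ge_max ab ge_min lexx. Qed.

Lemma clamp_id (R : realType) (a b t : R) : t \in `[a, b] -> clamp a b t = t.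
Proof.
by rewrite in_itv/= => /andP[at_ tb]; rewrite /clamp (min_idPr tb) (max_idPr at_).
Qed.

Lemma clamp_lipschitz (R : realType) (a b t u : R) :
  `|clamp a b t - clamp a b u| <= `|t - u|.
Proof.
rewrite ler_norml; have := ler_norm (t - u); have := ler_norm (u - t).
rewrite (distrC u t); move: `|t - u| => c h h'.
rewrite /clamp; case: (leP b t) => bt; case: (leP b u) => bu.
- by case: (leP a b) => h1; apply/andP; split; lra.
- by case: (leP a b) => h1; case: (leP a u) => h2; apply/andP; split; lra.
- by case: (leP a t) => h1; case: (leP a b) => h2; apply/andP; split; lra.
- by case: (leP a t) => h1; case: (leP a u) => h2; apply/andP; split; lra.
Qed.

(** The form in which uniform continuity enters the estimates, on the whole plane so that no
    membership in the strip has to be tracked. *)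
Definition almost_lip (R : realType) (G : R * R -> R) := forall eta : R, 0 < eta ->
  exists2 K : R, 0 < K & forall t y t' y' : R,
    `|G (t, y) - G (t', y')| <= eta + K * (`|t - t'| + `|y - y'|).

Lemma almost_lip_continuous (R : realType) (G : R * R -> R) :
  almost_lip G -> continuous G.
Proof.
move=> aG [t y]; apply/cvgrPdist_le => e e0.
have [|K K0 hK] := aG (e / 2); first by rewrite divr_gt0.
have d0 : 0 < e / (4 * K) by rewrite divr_gt0// mulr_gt0.
apply: (filterS _ (nbhsx_ballx (t, y) _ d0)) => -[t' y'] [/= h1 h2].
apply: le_trans (hK _ _ _ _) _.
have : K * (`|t - t'| + `|y - y'|) <= K * (e / (4 * K) + e / (4 * K)).
  by rewrite ler_pM2l// lerD// ltW.
have -> : K * (e / (4 * K) + e / (4 * K)) = e / 2.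
  by field; rewrite gt_eqF.
lra.
Qed.

(** Composition with the projection onto the box [[0, T] x [s, S]]. All trajectories stay in this
    box, so pairings with cell sums are unchanged, while functions controlled only on the strip
    become bounded and almost Lipschitz on the plane. *)
Definition box_ext (R : realType) (T s S : R) (G : R * R -> R) (z : R * R) : R :=
  G (clamp 0 T z.1, clamp s S z.2).

Lemma box_extE (R : realType) (T s S : R) (G : R * R -> R) (t y : R) :
  t \in `[0, T] -> y \in `[s, S] -> box_ext T s S G (t, y) = G (t, y).
Proof. by move=> tT yS; rewrite /box_ext/= !clamp_id. Qed.

Lemma box_ext_almost_lip (R : realType) (T s S : R) (G : R * R -> R) :
  0 <= T -> s <= S -> {within strip T, continuous G} ->
  almost_lip (box_ext T s S G).
Proof.
move=> T0 sS cG eta eta0.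
have [K K0 hK] := almost_lipschitz s S cG eta0.
exists K => // t y t' y'; rewrite /box_ext/=.
apply: le_trans (hK _ _ _ _ _ _ _ _) _; rewrite ?clamp_itv//.
by rewrite lerD2l ler_pM2l// lerD// clamp_lipschitz.
Qed.

Lemma box_ext_bounded (R : realType) (T s S : R) (G : R * R -> R) :
  0 <= T -> s <= S -> {within strip T, continuous G} ->
  exists2 M, 0 < M & forall z, `|box_ext T s S G z| <= M.
Proof.
move=> T0 sS cG; have [M M0 hM] := box_bounded s S cG.
by exists M => // z; rewrite /box_ext hM// clamp_itv.
Qed.

(** * Cells of the vehicles and their densities *)

Definition cell (R : realType) (T : R) (x : nat -> R -> R) (i : nat) :
  set (R * R) := [set z | (z.1 \in `]0, T[) /\ x i z.1 <= z.2 < x i.+1 z.1].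

(** The share of vehicle [i] in [rho^N]; it has mass [1 / N] on every time slice in []0, T[]. *)
Definition cell_density (R : realType) (T : R) (N : nat) (x : nat -> R -> R)
  (i : nat) (z : R * R) : R := density N x i z.1 * \1_(cell T x i) z.

(** Over []0, T[] the weights 1, [vel] and [vel / theta (density)] give [rho^N], [e_1^N] and
    [e_1^N / theta (rho^N)], so that the three limits share their estimates. *)
Definition cell_sum (R : realType) (T : R) (N : nat) (x : nat -> R -> R)
  (h : nat -> R -> R) (z : R * R) : R :=
  \sum_(i < N) h i z.1 * cell_density T N x i z.

Lemma integrable_indic_fin (d : measure_display) (X : measurableType d)
    (R : realType) (mu : {measure set X -> \bar R}) (A : set X) :
  measurable A -> (mu A < +oo)%E -> mu.-integrable setT (EFin \o \1_A).
Proof.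
move=> mA Aoo; apply/integrableP; split; first exact/measurable_EFinP.
have -> : (fun z => `|(EFin \o \1_A) z|)%E = (fun z => (\1_A z : R)%:E).
  by apply/funext => z /=; rewrite ger0_norm.
by rewrite integral_indic// setIT.
Qed.

Section cells.
Context (R : realType) (T s S L rhobar : R) (N : nat) (x : nat -> R -> R).
Context (N0 : (0 < N)%N) (T0 : 0 < T) (tr : trajectories T s S L rhobar N x).

Local Notation mu1 := (leb1 R).
Local Notation mu2 := (leb2 R).

Lemma traj_continuous i t : (i <= N)%N -> t \in `]0, T[ -> {for t, continuous (x i)}.
Proof.
move=> iN tT; have h := traj_lipschitz tr iN.
exact: within_continuous_at (nbhs_itvcc tT) (lipschitz_within_continuous h).
Qed.

Lemma continuous_measurable_itv (f : R -> R) (a b : R) :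
  (forall t, t \in `]a, b[ -> {for t, continuous f}) ->
  measurable_fun setT (f \_ `]a, b[%classic).
Proof.
move=> cf; apply/(measurable_restrictT _ (measurable_itv _)).
apply: open_continuous_measurable_fun; first exact: interval_open.
by move=> t /set_mem; exact: cf.
Qed.

Lemma measurable_fst_comp (f : R -> R) : measurable_fun setT f ->
  measurable_fun setT (fun z : measurableTypeR R * measurableTypeR R => f z.1).
Proof. by move=> mf; apply: measurableT_comp. Qed.

Lemma measurable_cell i : (i < N)%N ->
  measurable (cell T x i : set (measurableTypeR R * measurableTypeR R)).
Proof.
move=> iN.
(* Positions are unconstrained outside [[0, T]], so they are set to 0 off []0, T[] before
   measurability is used. *)
pose X j := x j \_ `]0, T[%classic.
have mX j : (j <= N)%N -> measurable_fun setT (X j).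
  by move=> jN; apply: continuous_measurable_itv => t; exact: traj_continuous.
have mI : measurable (`]0, T[%classic `*` [set: R] :
    set (measurableTypeR R * measurableTypeR R)).
  by apply: measurableX => //; exact: measurable_itv.
have -> : cell T x i = (`]0, T[%classic `*` [set: R]) `&`
   (([set: R * R] `&` [set z | ((X i z.1)%:E <= z.2%:E)%E]) `&`
    ([set: R * R] `&` [set z | (z.2%:E < (X i.+1 z.1)%:E)%E])).
  apply/seteqP; split => -[t y]; rewrite /cell /X/= !lee_fin !lte_fin !patchE.
    by move=> [tT /andP[h1 h2]]; rewrite !mem_set.
  by move=> [[tT _]]; rewrite !mem_set// => -[[_ h1] [_ h2]]; rewrite h1 h2.
have msnd : measurable_fun setT
   (fun z : measurableTypeR R * measurableTypeR R => (z.2%:E : \bar R)).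
  by apply/measurable_EFinP; exact: measurable_snd.
have mfst j : (j <= N)%N -> measurable_fun setT
   (fun z : measurableTypeR R * measurableTypeR R => ((X j z.1)%:E : \bar R)).
  by move=> jN; apply/measurable_EFinP; apply: measurable_fst_comp; exact: mX.
apply: measurableI => //; apply: measurableI.
  by apply: measurable_lee => //; apply: mfst; exact: ltnW.
by apply: measurable_lte => //; exact: mfst.
Qed.

Lemma continuous_density i t : (i < N)%N -> t \in `]0, T[ ->
  {for t, continuous (density N x i)}.
Proof.
move=> iN tT; apply: cvgV.
  rewrite mulf_neq0 ?pnatr_eq0 -?lt0n// subr_eq0 gt_eqF//.
  by apply: (traj_lt tr) => //; exact: itv_oocc.
apply: cvgM; first exact: cvg_cst.
by apply: cvgB; apply: traj_continuous => //; exact: ltnW.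
Qed.

Lemma measurable_cell_density i : (i < N)%N -> measurable_fun setT
  (cell_density T N x i : measurableTypeR R * measurableTypeR R -> R).
Proof.
move=> iN.
have -> : cell_density T N x i =
    (fun z => (density N x i \_ `]0, T[%classic) z.1 * \1_(cell T x i) z).
  apply/funext => z; rewrite /cell_density indicE patchE.
  have [zc|zc] := boolP (z \in cell T x i); last by rewrite !mulr0.
  by rewrite mem_set//; move: zc; rewrite inE => -[].
apply: measurable_funM; last by apply: measurable_indic; exact: measurable_cell.
by apply: measurable_fst_comp; apply: continuous_measurable_itv => t; exact: continuous_density.
Qed.

Lemma cell_density_ge0 i z : (i < N)%N -> 0 <= cell_density T N x i z.
Proof.
move=> iN; rewrite /cell_density indicE; have [zc|zc] := boolP (z \in cell T x i).
  move: zc; rewrite inE => -[zT _].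
  rewrite mulr_ge0// invr_ge0 mulr_ge0// subr_ge0 ltW//.
  by apply: (traj_lt tr) => //; exact: itv_oocc.
by rewrite mulr0.
Qed.

Lemma integral_cell_slice i (c t : R) : (i < N)%N ->
  (\int[mu1]_y (c * cell_density T N x i (t, y))%:E =
   (c * N%:R^-1 * \1_(`]0%R, T[%classic) t)%:E)%E.
Proof.
move=> iN; have [tT|tT] := boolP (t \in `]0, T[); last first.
  rewrite indicE memNset ?mulr0; last by move=> /= h; rewrite h in tT.
  apply: integral0_eq => y _; rewrite /cell_density indicE memNset ?mulr0//.
  by move=> -[/= h]; rewrite h in tT.
rewrite indicE mem_set// mulr1.
have xt := traj_lt tr iN (itv_oocc tT).
have -> : (fun y => (c * cell_density T N x i (t, y))%:E) =
    (fun y => ((c * density N x i t)%:E * (\1_(`[x i t, x i.+1 t[%classic) y)%:E)%E).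
  apply/funext => y; rewrite -EFinM -mulrA /cell_density/= !indicE; congr (_ * (_ * _))%:E.
  congr (nat_of_bool _)%:R; apply/idP/idP; rewrite !inE /cell/= in_itv/=.
    by case.
  by split.
rewrite integralZl//; last first.
  apply: integrable_indic_fin; first exact: measurable_itv.
  have := @lebesgue_measure_itv R `[x i t, x i.+1 t[.
  by rewrite /= lte_fin xt -EFinB => ->; exact: ltry.
rewrite integral_indic// setIT.
have E : mu1 (`[x i t, x i.+1 t[%classic) = (x i.+1 t - x i t)%:E.
  have := @lebesgue_measure_itv R `[x i t, x i.+1 t[.
  by rewrite /= lte_fin xt -EFinB => ->.
transitivity ((c * density N x i t)%:E * (x i.+1 t - x i t)%:E)%E.
  by congr (_ * _)%E; exact: E.
rewrite -EFinM; congr (_%:E); rewrite /density; field.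
by rewrite pnatr_eq0 -lt0n N0 subr_eq0 gt_eqF.
Qed.

(** Fubini's theorem with slices of mass [1 / N]. Integrability of [k] in time is all that is asked,
    since the flux weights come with no bound. *)
Lemma cell_integral i (k : R -> R) : (i < N)%N ->
  mu1.-integrable `]0, T[%classic (EFin \o k) ->
  mu2.-integrable setT (EFin \o (fun z => k z.1 * cell_density T N x i z)) /\
  \int[mu2]_z (k z.1 * cell_density T N x i z) =
    N%:R^-1 * \int[mu1]_(t in `]0, T[) k t.
Proof.
move=> iN ik.
have mI : measurable (`]0, T[%classic : set (measurableTypeR R)) by exact: measurable_itv.
pose kT := k \_ `]0, T[%classic.
have mkT : measurable_fun setT kT.
  apply/(measurable_restrictT _ mI).
  by apply/measurable_EFinP; exact: measurable_int ik.
have kE : (fun z => k z.1 * cell_density T N x i z) =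
          (fun z => kT z.1 * cell_density T N x i z).
  apply/funext => z; rewrite /cell_density indicE /kT patchE.
  have [zc|zc] := boolP (z \in cell T x i); last by rewrite !mulr0.
  by rewrite mem_set//; move: zc; rewrite inE => -[].
have mK : measurable_fun setT (EFin \o
    (fun z : measurableTypeR R * measurableTypeR R => kT z.1 * cell_density T N x i z)).
  apply/measurable_EFinP; apply: measurable_funM.
    exact: measurable_fst_comp.
  exact: measurable_cell_density.
have ikT : mu1.-integrable setT (EFin \o kT).
  by rewrite /kT -restrict_EFin; apply/(integrable_mkcond _ mI).
have indkT t : kT t * N%:R^-1 * \1_(`]0, T[%classic) t = N%:R^-1 * kT t.
  rewrite /kT patchE indicE; case: ifP => h; first by rewrite mulr1 mulrC.
  by rewrite !mulr0.
rewrite kE; have iK : mu2.-integrable setT (EFin \o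
    (fun z : measurableTypeR R * measurableTypeR R => kT z.1 * cell_density T N x i z)).
  apply/integrable12ltyP => //=.
  have -> : (fun t => \int[mu1]_y `|(kT t * cell_density T N x i (t, y))%:E|)%E =
      (fun t => (N%:R^-1)%:E * (abse \o (EFin \o kT)) t)%E.
    apply/funext => t.
    have -> : (fun y => `|(kT t * cell_density T N x i (t, y))%:E|)%E =
              (fun y => (`|kT t| * cell_density T N x i (t, y))%:E)%E.
      by apply/funext => y /=; rewrite normrM (ger0_norm (cell_density_ge0 _ iN)).
    rewrite integral_cell_slice//= -EFinM; congr (_%:E).
    rewrite /kT patchE indicE; case: ifP => h; first by rewrite mulr1 mulrC.
    by rewrite normr0 !mulr0.
  rewrite integralZl//; last exact: integrable_abse.
  have /integrableP[_ kfin] := ikT.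
  have fin : (\int[mu1]_t (abse \o (EFin \o kT)) t)%E \is a fin_num.
    rewrite ge0_fin_numE; first exact: kfin.
    by apply: integral_ge0 => t _; exact: abse_ge0.
  by rewrite -(fineK fin) -EFinM ltry.
split => //.
rewrite /Rintegral -integral12_prod_meas1//=.
have -> : (fun t => \int[mu1]_y (kT t * cell_density T N x i (t, y))%:E)%E =
   (fun t => (N%:R^-1)%:E * (EFin \o kT) t)%E.
  by apply/funext => t; rewrite integral_cell_slice//= -EFinM indkT.
rewrite integralZl// fineM//; last exact: integrable_fin_num.
by congr (_ * fine _); rewrite [RHS]integral_mkcond restrict_EFin.
Qed.

End cells.

Lemma normr_sum_le (R : realType) (I : Type) (r : seq I) (a b : I -> R) :
  (forall i, `|a i| <= b i) -> `|\sum_(i <- r) a i| <= \sum_(i <- r) b i.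
Proof.
move=> ab; elim: r => [|i r IH]; first by rewrite !big_nil normr0.
by rewrite !big_cons; apply: le_trans (ler_normD _ _) _; rewrite lerD.
Qed.

Section cell_sums.
Context (R : realType) (T s S L rhobar : R) (N : nat) (x : nat -> R -> R).
Context (N0 : (0 < N)%N) (T0 : 0 < T) (tr : trajectories T s S L rhobar N x).

Local Notation mu1 := (leb1 R).
Local Notation mu2 := (leb2 R).

Lemma traj_le i j t : (i <= j)%N -> (j <= N)%N -> t \in `[0, T] -> x i t <= x j t.
Proof.
move=> + + tT; elim: j => [|j IH]; first by rewrite leqn0 => /eqP->.
rewrite leq_eqVlt => /predU1P[->//|ij jN]; apply: le_trans (IH ij (ltnW jN)) _.
exact/ltW/(traj_lt tr).
Qed.

Lemma cell_unique i j z : (i < N)%N -> (j < N)%N ->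
  cell T x i z -> cell T x j z -> i = j.
Proof.
have aux i' j' : (i' < j')%N -> (j' < N)%N -> cell T x i' z -> cell T x j' z -> False.
  move=> ij jN [zT /andP[_ h1]] [_ /andP[h2 _]].
  have := traj_le ij (ltnW jN) (itv_oocc zT); rewrite leNgt.
  by rewrite (le_lt_trans h2 h1).
move=> iN jN ci cj; case: (ltngtP i j) => // ij; exfalso.
  exact: aux ij jN ci cj.
exact: aux ij iN cj ci.
Qed.

Lemma cell_sum_in (h : nat -> R -> R) i z : (i < N)%N -> cell T x i z ->
  cell_sum T N x h z = h i z.1 * density N x i z.1.
Proof.
move=> iN ci; rewrite /cell_sum (bigD1 (Ordinal iN))//= big1 ?addr0.
  by rewrite /cell_density indicE mem_set// mulr1.
move=> j ji; rewrite /cell_density indicE memNset ?mulr0// => cj.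
by move: ji; rewrite -val_eqE/= (cell_unique (ltn_ord j) iN cj ci) eqxx.
Qed.

Lemma cell_sum_out (h : nat -> R -> R) z :
  (forall i, (i < N)%N -> ~ cell T x i z) -> cell_sum T N x h z = 0.
Proof.
move=> nc; rewrite /cell_sum big1// => i _.
by rewrite /cell_density indicE memNset ?mulr0//; exact: nc.
Qed.

Lemma cellP z : (exists2 i, (i < N)%N & cell T x i z) \/
  (forall i, (i < N)%N -> ~ cell T x i z).
Proof.
have [[i iN ci]|nc] := pselect (exists2 i, (i < N)%N & cell T x i z).
  by left; exists i.
by right => i iN ci; apply: nc; exists i.
Qed.

Lemma cell_box i z : (i < N)%N -> cell T x i z ->
  (z.1 \in `]0, T[) /\ (z.2 \in `[s, S]).
Proof.
move=> iN [zT /andP[h1 h2]]; split => //.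
have := traj_itv tr (ltnW iN) (itv_oocc zT); have := traj_itv tr iN (itv_oocc zT).
rewrite !in_itv/= => /andP[_ xS] /andP[sx _].
by rewrite (le_trans sx h1)/= (le_trans (ltW h2) xS).
Qed.

Lemma density_bounds i t : (i < N)%N -> t \in `[0, T] ->
  0 < density N x i t <= rhobar.
Proof.
move=> iN tT; rewrite (traj_density tr iN tT) andbT invr_gt0 mulr_gt0 ?ltr0n//.
by rewrite subr_gt0; exact: traj_lt tr _ _ iN tT.
Qed.

Lemma cell_sum_bounds (h : nat -> R -> R) (H : R) z : 0 <= H -> 0 <= rhobar ->
  (forall i t, (i < N)%N -> t \in `]0, T[ -> 0 <= h i t <= H) ->
  0 <= cell_sum T N x h z <= H * rhobar.
Proof.
move=> H0 r0 hb; have [[i iN ci]|nc] := cellP z.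
  rewrite (cell_sum_in _ iN ci); have [zT _] := ci.
  have /andP[h0 hH] := hb _ _ iN zT.
  have /andP[d0 dr] := density_bounds iN (itv_oocc zT).
  by rewrite mulr_ge0 ?(ltW d0)//= ler_pM// ltW.
by rewrite (cell_sum_out _ nc) lexx mulr_ge0.
Qed.

Lemma cell_sum_supp (h : nat -> R -> R) z :
  ~ (`]0, T[%classic `*` `[s, S]%classic) z -> cell_sum T N x h z = 0.
Proof.
move=> nz; apply: cell_sum_out => i iN /(cell_box iN)[z1 z2].
by apply: nz; split.
Qed.

Lemma rho_interpE z : z.1 \in `]0, T[ ->
  rho_interp N x z = cell_sum T N x (fun _ _ => 1) z.
Proof.
move=> zT; apply: eq_bigr => i _; rewrite mul1r /cell_density !indicE.
congr (_ * (nat_of_bool _)%:R); apply/idP/idP; rewrite !inE /cell/= in_itv/=.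
  by split.
by case.
Qed.

Lemma e1_interpE z : z.1 \in `]0, T[ ->
  e1_interp T N x z = cell_sum T N x (vel T x) z.
Proof.
move=> zT; apply: eq_bigr => i _; rewrite /cell_density !indicE.
rewrite [_ * deriv_in _ _ _]mulrC -mulrA -/(vel T x i).
congr (_ * (_ * (nat_of_bool _)%:R)); apply/idP/idP; rewrite !inE /cell/= in_itv/=.
  by split.
by case.
Qed.

(** The quotient is nonlinear in the interpolants, but at each point at most one cell contributes;
    off the cells the numerator vanishes. *)
Lemma flux_quotientE (theta : R -> R) z : z.1 \in `]0, T[ ->
  e1_interp T N x z / theta (rho_interp N x z) =
  cell_sum T N x (fun i t => vel T x i t / theta (density N x i t)) z.
Proof.
move=> zT; rewrite rho_interpE// e1_interpE//.
have [[i iN ci]|nc] := cellP z.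
  by rewrite !(cell_sum_in _ iN ci) mul1r mulrAC.
by rewrite !(cell_sum_out _ nc) mul0r.
Qed.

Lemma measurable_cell_sum (h : nat -> R -> R) :
  (forall i, (i < N)%N -> mu1.-integrable `]0, T[%classic (EFin \o h i)) ->
  mu2.-integrable setT (EFin \o cell_sum T N x h).
Proof.
move=> ih; have [_] := @Rintegral_sum _ _ _ mu2 'I_N (index_enum 'I_N)
  (fun i z => h i z.1 * cell_density T N x i z) setT measurableT
  (fun i => (cell_integral N0 tr (ltn_ord i) (ih i (ltn_ord i))).1).
by [].
Qed.

Lemma cell_average i (h c : R -> R) (G : R * R -> R) (Gm delta : R) :
  (i < N)%N -> mu1.-integrable `]0, T[%classic (EFin \o h) ->
  mu1.-integrable `]0, T[%classic (EFin \o (fun t => h t * c t)) ->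
  measurable_fun setT (G : measurableTypeR R * measurableTypeR R -> R) ->
  (forall z, `|G z| <= Gm) -> 0 <= delta ->
  (forall z, cell T x i z -> `|G z - c z.1| <= delta) ->
  mu2.-integrable setT (EFin \o (fun z => h z.1 * cell_density T N x i z * G z)) /\
  `|\int[mu2]_z (h z.1 * cell_density T N x i z * G z) -
    N%:R^-1 * \int[mu1]_(t in `]0, T[) (h t * c t)| <=
  N%:R^-1 * (delta * \int[mu1]_(t in `]0, T[) `|h t|).
Proof.
move=> iN ih ihc mG GM d0 Gc.
have [iP PE] := cell_integral N0 tr iN ih.
have [iPc PcE] := cell_integral N0 tr iN ihc.
have inh : mu1.-integrable `]0, T[%classic (EFin \o (fun t => `|h t|)).
  by apply: integrable_norm.
have [iPn PnE] := cell_integral N0 tr iN inh.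
have iPG : mu2.-integrable setT
    (EFin \o (fun z => h z.1 * cell_density T N x i z * G z)).
  have := @integrableZr _ _ _ mu2 G (fun z => h z.1 * cell_density T N x i z) Gm
    setT measurableT mG (fun z _ => GM z) iP.
  by apply: eq_integrable => // z _ /=; rewrite mulrC.
split => //.
rewrite -PcE -RintegralB//.
apply: le_trans (le_normr_Rintegral _ _) _ => //.
  have := integrableB measurableT iPG iPc.
  by apply: eq_integrable => // z _ /=.
rewrite mulrCA -PnE -RintegralZl//.
apply: le_Rintegral => //.
- apply: integrable_norm; have := integrableB measurableT iPG iPc.
  by apply: eq_integrable => // z _ /=.
- have := integrableZl measurableT delta iPn.
  by apply: eq_integrable => // z _ /=.
move=> z _.
have -> : h z.1 * cell_density T N x i z * G z -
    h z.1 * c z.1 * cell_density T N x i z =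
    (h z.1 * (G z - c z.1)) * cell_density T N x i z by lra.
have P0 := cell_density_ge0 tr z iN.
rewrite normrM (ger0_norm P0) mulrA; have [ci|nci] := pselect (cell T x i z).
  by rewrite ler_wpM2r// normrM mulrC ler_wpM2r// Gc.
have -> : cell_density T N x i z = 0.
  by rewrite /cell_density indicE memNset ?mulr0.
by rewrite !mulr0.
Qed.

(** The comparison function [c] is free because it serves both as [G] along the trajectories and as
    [G] frozen on a time grid. Each error is weighted by the [L^1] norm of [h i] only, as the flux
    weights have no uniform bound. *)
Lemma cell_sum_average (h c : nat -> R -> R) (G : R * R -> R) (Gm : R)
    (delta : nat -> R) :
  (forall i, (i < N)%N -> [/\
    mu1.-integrable `]0, T[%classic (EFin \o h i),
    mu1.-integrable `]0, T[%classic (EFin \o (fun t => h i t * c i t)),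
    0 <= delta i &
    forall z, cell T x i z -> `|G z - c i z.1| <= delta i]) ->
  measurable_fun setT (G : measurableTypeR R * measurableTypeR R -> R) ->
  (forall z, `|G z| <= Gm) ->
  mu2.-integrable setT (EFin \o (fun z => cell_sum T N x h z * G z)) /\
  `|\int[mu2]_z (cell_sum T N x h z * G z) -
    N%:R^-1 * \sum_(i < N) \int[mu1]_(t in `]0, T[) (h i t * c i t)| <=
  N%:R^-1 * \sum_(i < N) (delta i * \int[mu1]_(t in `]0, T[) `|h i t|).
Proof.
move=> H mG GM.
have ca (i : 'I_N) : _ /\ _ := let: And4 a b d e := H i (ltn_ord i) in
  cell_average (ltn_ord i) a b mG GM d e.
have fE : (fun z => cell_sum T N x h z * G z) =
  (fun z => \sum_(i < N) (h i z.1 * cell_density T N x i z * G z)).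
  by apply/funext => z; rewrite /cell_sum big_distrl.
have [sE sI] := @Rintegral_sum _ _ _ mu2 'I_N (index_enum 'I_N)
  (fun i z => h i z.1 * cell_density T N x i z * G z) setT measurableT
  (fun i => (ca i).1).
rewrite fE sE; split => //.
rewrite !mulr_sumr -sumrB; apply: normr_sum_le => i.
exact: (ca i).2.
Qed.

End cell_sums.

(** * Cell lengths, uniformly in time *)

Lemma grid_index (R : realType) (T t : R) (M : nat) : (0 < M)%N -> 0 < T ->
  0 <= t < T -> exists2 j : nat, (j < M)%N &
    T / M%:R * j%:R <= t < T / M%:R * j.+1%:R.
Proof.
move=> M0 T0 /andP[t0 tT]; have m0 : 0 < M%:R :> R by rewrite ltr0n.
have tau0 : 0 < T / M%:R by rewrite divr_gt0.
pose j := Num.truncn (t / (T / M%:R)).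
have /andP[j1 j2] := truncn_itv (divr_ge0 t0 (ltW tau0)).
exists j; last first.
  by rewrite mulrC -ler_pdivlMr// j1 [_ * _.+1%:R]mulrC -ltr_pdivrMr.
rewrite -(ltr_nat R); apply: le_lt_trans j1 _.
by rewrite ltr_pdivrMr// mulrCA divff ?gt_eqF// mulr1.
Qed.

Section cell_lengths.
Context (R : realType) (T s S L rhobar : R) (N : nat) (x : nat -> R -> R).
Context (N0 : (0 < N)%N) (T0 : 0 < T) (tr : trajectories T s S L rhobar N x).

Lemma sum_cell_lengths t : t \in `[0, T] ->
  \sum_(i < N) (x i.+1 t - x i t) <= S - s.
Proof.
move=> tT; rewrite -(big_mkord xpredT (fun i => x i.+1 t - x i t)) telescope_sumr//.
have := traj_itv tr (leqnn N) tT; have := traj_itv tr (leq0n N) tT.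
rewrite !in_itv/= => /andP[a0 _] /andP[_ bN].
by rewrite lerB.
Qed.

Lemma lipschitz_ge0 : 0 <= L.
Proof.
have h0 : 0 \in `[0, T] by rewrite in_itv/= lexx ltW.
have hT : T \in `[0, T] by rewrite in_itv/= lexx ltW.
have := traj_lipschitz tr (leq0n N) hT h0; rewrite subr0 (gtr0_norm T0) => h.
by have := le_trans (normr_ge0 _) h; rewrite pmulr_lge0.
Qed.

(* [l i] bounds the length of the [i]-th cell at all times: sum over a time
   grid and use the Lipschitz bound in between. *)
Lemma uniform_cell_lengths (M : nat) : (0 < M)%N ->
  exists l : nat -> R, (forall i t, (i < N)%N -> t \in `]0, T[ ->
      0 <= l i /\ x i.+1 t - x i t <= l i) /\
    N%:R^-1 * \sum_(i < N) l i <= 2 * L * (T / M%:R) + M%:R * (S - s) / N%:R.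
Proof.
move=> M0; have m0 : 0 < M%:R :> R by rewrite ltr0n.
have n0 : 0 < N%:R :> R by rewrite ltr0n.
set tau := T / M%:R; have tau0 : 0 < tau by rewrite divr_gt0.
have L0 := lipschitz_ge0.
have gT j : (j < M)%N -> tau * j%:R \in `[0, T].
  move=> jM; rewrite in_itv/= mulr_ge0 ?(ltW tau0)//=.
  by rewrite /tau mulrAC ler_pdivrMr// ler_pM2l// ler_nat ltnW.
pose len i t := x i.+1 t - x i t.
have len0 i t : (i < N)%N -> t \in `[0, T] -> 0 <= len i t.
  by move=> iN tT; rewrite subr_ge0 ltW// (traj_lt tr).
exists (fun i => 2 * L * tau + \sum_(j < M) len i (tau * j%:R)); split.
  move=> i t iN tT; split.
    apply: addr_ge0; first by apply: mulr_ge0; [exact: mulr_ge0|exact: ltW].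
    by apply: sumr_ge0 => j _; apply: len0 => //; exact: gT.
  have t01 : 0 <= t < T by move: tT; rewrite in_itv/= => /andP[/ltW-> ->].
  have [j jM /andP[t1 t2]] := grid_index M0 T0 t01.
  rewrite -/tau in t1 t2.
  have tj : `|t - tau * j%:R| <= tau.
    rewrite ger0_norm ?subr_ge0// lerBlDl.
    by move: t2; rewrite -natr1 mulrDr mulr1 => /ltW.
  have h1 := traj_lipschitz tr iN (itv_oocc tT) (gT j jM).
  have h2 := traj_lipschitz tr (ltnW iN) (itv_oocc tT) (gT j jM).
  have Lt : L * `|t - tau * j%:R| <= L * tau by rewrite ler_wpM2l.
  have lj : len i (tau * j%:R) <= \sum_(j < M) len i (tau * j%:R).
    rewrite (bigD1 (Ordinal jM))//= lerDl; apply: sumr_ge0 => k _.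
    by apply: len0 => //; exact: gT.
  move: h1 h2; rewrite !ler_norml => /andP[_ h1] /andP[h2 _].
  move: lj; rewrite {1}/len; lra.
rewrite big_split/= sumr_const card_ord mulrDr.
rewrite -[(2 * L * tau) *+ N]mulr_natr [N%:R^-1 * (_ * N%:R)]mulrC.
rewrite mulfK ?gt_eqF// lerD2l.
rewrite exchange_big/= mulrC ler_pM2r ?invr_gt0//.
apply: (@le_trans _ _ (\sum_(j < M) (S - s))).
  by apply: ler_sum => j _; apply: sum_cell_lengths; exact: gT.
by rewrite sumr_const card_ord mulr_natl.
Qed.

End cell_lengths.

(** The number [M] of time steps is fixed first, to absorb the motion between grid times; then a
    large [N] makes the [M] sums of lengths, each at most [S - s], negligible after division by [N].
    The threshold is the same for all trajectories with the same constants. *)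
Lemma small_cells (R : realType) (T s S L e : R) : 0 < T -> 0 <= L -> 0 < e ->
  exists N1 : nat, forall N rhobar (x : nat -> R -> R), (N1 < N)%N ->
    trajectories T s S L rhobar N x ->
    exists l : nat -> R, (forall i t, (i < N)%N -> t \in `]0, T[ ->
      0 <= l i /\ x i.+1 t - x i t <= l i) /\
    N%:R^-1 * \sum_(i < N) l i <= e.
Proof.
move=> T0 L0 e0.
pose M := (Num.truncn (4 * L * T / e)).+1.
have m0 : 0 < M%:R :> R by rewrite ltr0n.
have hM : 2 * L * (T / M%:R) <= e / 2.
  have := truncnS_gt (4 * L * T / e).
  rewrite -/M ltr_pdivrMr// => h.
  rewrite mulrA ler_pdivrMr//; lra.
pose N1 := Num.truncn (2 * (M%:R * `|S - s|) / e).
exists N1 => N rhobar x NN tr.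
have n0 : 0 < N%:R :> R by rewrite ltr0n (leq_ltn_trans _ NN).
have [l [hl sl]] := uniform_cell_lengths (leq_ltn_trans (leq0n _) NN) T0 tr (ltn0Sn _ : (0 < M)%N).
exists l; split => //; apply: le_trans sl _.
have hN : M%:R * (S - s) / N%:R <= e / 2.
  have : 2 * (M%:R * `|S - s|) / e < N%:R.
    by apply: lt_le_trans (truncnS_gt _) _; rewrite ler_nat.
  rewrite ltr_pdivrMr// => h; rewrite ler_pdivrMr//.
  have : M%:R * (S - s) <= M%:R * `|S - s| by rewrite ler_pM2l// ler_norm.
  lra.
lra.
Qed.

(** * Cell sums as averages over the vehicles *)

Section averages.
Context (R : realType) (T s S L : R) (G : R * R -> R) (Gm C : R).
Context (T0 : 0 < T) (L0 : 0 <= L) (C0 : 0 <= C) (Gm0 : 0 <= Gm)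
  (aG : almost_lip G) (GM : forall z, `|G z| <= Gm).

Local Notation mu1 := (leb1 R).
Local Notation mu2 := (leb2 R).

Lemma measurable_almost_lip :
  measurable_fun setT (G : measurableTypeR R * measurableTypeR R -> R).
Proof. exact: (continuous_measurable_fun2 (almost_lip_continuous aG)). Qed.

Lemma continuous_along (y : R -> R) t : {for t, continuous y} ->
  {for t, continuous (fun t => G (t, y t))}.
Proof.
move=> cy; have cG := almost_lip_continuous aG.
have cp : (fun t => (t, y t)) @ t --> (t, y t).
  exact: (@cvg_pair R R R (nbhs t) (nbhs t) (nbhs (y t)) _ _ _ id y cvg_id cy).
exact: (continuous_comp cp (cG _)).
Qed.

Lemma integrable_along N rhobar (x : nat -> R -> R) i (h : R -> R) :
  trajectories T s S L rhobar N x -> (i <= N)%N ->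
  mu1.-integrable `]0, T[%classic (EFin \o h) ->
  mu1.-integrable `]0, T[%classic (EFin \o (fun t => h t * G (t, x i t))).
Proof.
move=> tr iN ih.
have mGx : measurable_fun `]0, T[%classic (fun t => G (t, x i t)).
  apply: open_continuous_measurable_fun; first exact: interval_open.
  move=> t /set_mem tT; apply: continuous_along.
  exact: (traj_continuous tr iN tT).
have := @integrableZr _ _ _ mu1 (fun t => G (t, x i t)) h Gm `]0, T[%classic
  (measurable_itv _) mGx (fun t _ => GM _) ih.
by apply: eq_integrable => // t _ /=; rewrite mulrC.
Qed.

Lemma cell_sum_at_positions (e : R) : 0 < e ->
  exists N1 : nat, forall N rhobar (x : nat -> R -> R), (N1 < N)%N ->
    trajectories T s S L rhobar N x ->
    forall h : nat -> R -> R,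
    (forall i, (i < N)%N -> mu1.-integrable `]0, T[%classic (EFin \o h i) /\
      \int[mu1]_(t in `]0, T[) `|h i t| <= C) ->
    `|\int[mu2]_z (cell_sum T N x h z * G z) -
      N%:R^-1 * \sum_(i < N) \int[mu1]_(t in `]0, T[) (h i t * G (t, x i t))| <= e.
Proof.
move=> e0; have C1 : 0 < C + 1 by rewrite ltr_wpDl.
(* The error is [eta C] plus [K C] times the mean cell length; each summand gets [e / 2], and
   [C + 1] avoids a division by zero. *)
have eta0 : 0 < e / (2 * (C + 1)) by rewrite divr_gt0// mulr_gt0.
have [K K0 hK] := aG eta0.
have e1 : 0 < e / (2 * (K * (C + 1))) by rewrite divr_gt0// !mulr_gt0.
have [N1 hN1] := small_cells s S T0 L0 e1.
exists N1 => N rhobar x NN tr h hh.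
have N0 : (0 < N)%N by exact: leq_ltn_trans NN.
have n0 : 0 < N%:R :> R by rewrite ltr0n.
have [l [hl sl]] := hN1 N rhobar x NN tr.
have T2 : T / 2 \in `]0, T[ by rewrite in_itv/= divr_gt0//= ltr_pdivrMr// ltr_pMr// ltr1n.
have l0 i : (i < N)%N -> 0 <= l i by move=> iN; have [] := hl i _ iN T2.
pose delta i := e / (2 * (C + 1)) + K * l i.
have [|_] := @cell_sum_average R T s S L rhobar N x N0 tr h
  (fun i t => G (t, x i t)) G Gm delta _ measurable_almost_lip GM.
  move=> i iN; have [ih _] := hh i iN; split => //.
  - by apply: integrable_along tr _ ih; exact: ltnW.
  - by rewrite addr_ge0 ?(ltW eta0)// mulr_ge0 ?(ltW K0)// l0.
  - move=> [t y] [/= tT /andP[h1 h2]]; apply: le_trans (hK _ _ _ _) _.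
    rewrite subrr normr0 add0r lerD2l ler_pM2l//.
    have [_] := hl i t iN tT; rewrite ger0_norm ?subr_ge0//; lra.
move=> /le_trans; apply.
apply: (@le_trans _ _ (N%:R^-1 * \sum_(i < N) (delta i * C))).
  rewrite ler_pM2l ?invr_gt0//; apply: ler_sum => i _.
  have [_ hC] := hh i (ltn_ord i); apply: ler_wpM2l => //.
  by rewrite addr_ge0 ?(ltW eta0)// mulr_ge0 ?(ltW K0)// l0.
have -> : N%:R^-1 * \sum_(i < N) (delta i * C) =
    e / (2 * (C + 1)) * C + K * C * (N%:R^-1 * \sum_(i < N) l i).
  rewrite -big_distrl/=.
  have -> : \sum_(i < N) delta i = e / (2 * (C + 1)) * N%:R + K * \sum_(i < N) l i.
    rewrite big_split/=; congr (_ + _); last by rewrite -mulr_sumr.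
    by rewrite sumr_const card_ord mulr_natr.
  by field; rewrite !gt_eqF.
have h1 : e / (2 * (C + 1)) * C <= e / 2.
  rewrite mulrAC ler_pdivrMr ?mulr_gt0//.
  have -> : e / 2 * (2 * (C + 1)) = e * (C + 1) by field.
  by rewrite ler_pM2l// lerDl.
have h2 : K * C * (N%:R^-1 * \sum_(i < N) l i) <= e / 2.
  apply: (@le_trans _ _ (K * C * (e / (2 * (K * (C + 1)))))).
    by rewrite ler_wpM2l// mulr_ge0// ltW.
  rewrite mulrA ler_pdivrMr ?mulr_gt0//.
  have -> : e / 2 * (2 * (K * (C + 1))) = K * (C + 1) * e by field.
  by rewrite ler_pM2r// ler_pM2l// lerDl.
lra.
Qed.

End averages.

Section oscillations.
Context (R : realType) (T s S L : R) (G : R * R -> R) (Gm C : R).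
Context (T0 : 0 < T) (L0 : 0 <= L) (C0 : 0 <= C) (Gm0 : 0 <= Gm)
  (aG : almost_lip G) (GM : forall z, `|G z| <= Gm).

Local Notation mu1 := (leb1 R).
Local Notation mu2 := (leb2 R).

(** Closed on the left and open on the right, so that the slots are disjoint and cover [[0, T[]. *)
Definition slot (M j : nat) : set R :=
  `[T / M%:R * j%:R, T / M%:R * j.+1%:R[%classic.

Definition slot_step (M : nat) (a : nat -> R) (t : R) : R :=
  \sum_(j < M) a j * \1_(slot M j) t.

Lemma slot_stepE M a j t : (j < M)%N -> slot M j t -> slot_step M a t = a j.
Proof.
move=> jM tj; have M0 : (0 < M)%N by exact: leq_ltn_trans jM.
have tau0 : 0 < T / M%:R by rewrite divr_gt0// ltr0n.
rewrite /slot_step (bigD1 (Ordinal jM))//= indicE mem_set// mulr1.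
rewrite big1 ?addr0// => k kj; rewrite indicE memNset ?mulr0// => tk.
move: tj tk kj; rewrite /slot/= !in_itv/= => /andP[j1 j2] /andP[k1 k2].
have := le_lt_trans j1 k2; have := le_lt_trans k1 j2.
rewrite !ltr_pM2l// !ltr_nat !ltnS -val_eqE/= => h1 h2.
by rewrite eqn_leq h1 h2.
Qed.

Lemma integral_slot (B : R) (w : R -> R) M j : (j < M)%N ->
  mu1.-integrable `]0, T[%classic (EFin \o w) ->
  (forall a b : R, 0 <= a -> a < b -> b <= T ->
    `|\int[mu1]_(t in `]a, b[) w t| <= B) ->
  mu1.-integrable `]0, T[%classic (EFin \o (fun t => w t * \1_(slot M j) t)) /\
  `|\int[mu1]_(t in `]0, T[) (w t * \1_(slot M j) t)| <= B.
Proof.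
move=> jM iw hB; have M0 : (0 < M)%N by exact: leq_ltn_trans jM.
have m0 : 0 < M%:R :> R by rewrite ltr0n.
have tau0 : 0 < T / M%:R by rewrite divr_gt0.
set a := T / M%:R * j%:R; set b := T / M%:R * j.+1%:R.
have a0 : 0 <= a by rewrite mulr_ge0// ltW.
have ab : a < b by rewrite ltr_pM2l// ltr_nat.
have bT : b <= T by rewrite /b mulrAC ler_pdivrMr// ler_pM2l// ler_nat.
have mI : measurable (`]0, T[%classic : set (measurableTypeR R)) by exact: measurable_itv.
have mJ : measurable (slot M j : set (measurableTypeR R)) by exact: measurable_itv.
have E : (fun t => w t * \1_(slot M j) t) = w \_ (slot M j).
  apply/funext => t; rewrite patchE indicE.
  by case: ifP => _; rewrite ?mulr1 ?mulr0.
split.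
  have m1J : measurable_fun `]0, T[%classic (\1_(slot M j) : R -> R).
    by apply: measurable_indic.
  have b1J t : `]0, T[%classic t -> `|\1_(slot M j) t| <= (1 : R).
    by move=> _; rewrite indicE; case: (_ \in _); rewrite ?normr1 ?normr0.
  have := integrableZr mI m1J b1J iw.
  by apply: eq_integrable => // t _ /=; rewrite mulrC.
rewrite (@eq_Rintegral _ _ _ mu1 _ (w \_ (slot M j))); last first.
  by move=> t _; rewrite -E.
rewrite -Rintegral_mkcondr.
have : `|\int[mu1]_(t in `]a, b[) w t| <= B by exact: hB.
suff -> : \int[mu1]_(t in `]0, T[ `&` slot M j) w t = \int[mu1]_(t in `]a, b[) w t by [].
(* Within []0, T[] the slot starting at 0 loses its left endpoint; the other slots keep it, and a
   single point is negligible. *)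
have [a00|a00] := eqVneq a 0.
  congr Rintegral; apply/seteqP; split => t; rewrite /slot/= !in_itv/= -/a -/b a00.
    by move=> [/andP[-> _] /andP[_ ->]].
  by move=> /andP[t0 tb]; rewrite t0 tb (ltW t0) (lt_le_trans tb bT).
have a1 : 0 < a by rewrite lt_neqAle eq_sym a00.
have E2 : `]0, T[%classic `&` slot M j = `[a, b[%classic.
  apply/seteqP; split => t; rewrite /slot/= !in_itv/= -/a -/b; first by case.
  by move=> /andP[at_ tb]; rewrite at_ tb (lt_le_trans a1 at_) (lt_le_trans tb bT).
rewrite E2 -Rintegral_itv_obnd_cbnd//.
apply: integrableS iw => //.
by move=> t; rewrite /= !in_itv/= => /andP[at_ tb]; rewrite (lt_trans a1 at_) (lt_le_trans tb bT).
Qed.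

(* Freezing the test function on the cells of a space-time grid, only the time
   integrals of [w] over the slots remain. *)
Lemma cell_sum_oscillating (e : R) : 0 < e ->
  exists N1 M : nat, forall N rhobar (x : nat -> R -> R), (N1 < N)%N ->
    trajectories T s S L rhobar N x ->
    forall (w : nat -> R -> R) (B : R), 0 <= B ->
    (forall i, (i < N)%N -> [/\
      mu1.-integrable `]0, T[%classic (EFin \o w i),
      \int[mu1]_(t in `]0, T[) `|w i t| <= C &
      forall a b : R, 0 <= a -> a < b -> b <= T ->
        `|\int[mu1]_(t in `]a, b[) w i t| <= B]) ->
    `|\int[mu2]_z (cell_sum T N x w z * G z)| <= e + M%:R * Gm * B.
Proof.
move=> e0; have C1 : 0 < C + 1 by rewrite ltr_wpDl.
have eta0 : 0 < e / (3 * (C + 1)) by rewrite divr_gt0// mulr_gt0.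
have [K K0 hK] := aG eta0.
have e1 : 0 < e / (3 * (K * (C + 1))) by rewrite divr_gt0// !mulr_gt0.
have [N1 hN1] := small_cells s S T0 L0 e1.
(* Moving [t] back to a grid time shifts the position by at most [L] times the step, so freezing
   costs [K (1 + L) T / M]; this [M] brings its contribution below [e / 3] and does not depend on
   [N]. *)
pose M := (Num.truncn (3 * K * (1 + L) * T * (C + 1) / e)).+1.
have m0 : 0 < M%:R :> R by rewrite ltr0n.
have hM : K * (1 + L) * (T / M%:R) * C <= e / 3.
  have := truncnS_gt (3 * K * (1 + L) * T * (C + 1) / e).
  rewrite -/M ltr_pdivrMr// => h.
  rewrite mulrA mulrAC ler_pdivrMr//.
  have : K * (1 + L) * T * C <= K * (1 + L) * T * (C + 1).
    by rewrite ler_wpM2l ?lerDl// !mulr_ge0 ?addr_ge0// ltW.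
  lra.
exists N1, M => N rhobar x NN tr w B B0 hw.
have N0 : (0 < N)%N by exact: leq_ltn_trans NN.
have n0 : 0 < N%:R :> R by rewrite ltr0n.
have [l [hl sl]] := hN1 N rhobar x NN tr.
have T2 : T / 2 \in `]0, T[ by rewrite in_itv/= divr_gt0//= ltr_pdivrMr// ltr_pMr// ltr1n.
have l0 i : (i < N)%N -> 0 <= l i by move=> iN; have [] := hl i _ iN T2.
pose tau := T / M%:R; have tau0 : 0 < tau by rewrite divr_gt0.
(* The slack of [almost_lip], the displacement to the grid time, and the distance from a point of
   the cell to its left end. *)
pose delta i := e / (3 * (C + 1)) + K * ((1 + L) * tau + l i).
have delta0 i : (i < N)%N -> 0 <= delta i.
  move=> iN; apply: addr_ge0; first exact: ltW.
  apply: mulr_ge0; first exact: ltW.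
  by apply: addr_ge0; [apply: mulr_ge0; [exact: addr_ge0|exact: ltW]|exact: l0].
pose a i j := G (tau * j%:R, x i (tau * j%:R)).
pose c i := slot_step M (a i).
have mI : measurable (`]0, T[%classic : set (measurableTypeR R)) by exact: measurable_itv.
have wc i : (i < N)%N ->
    mu1.-integrable `]0, T[%classic (EFin \o (fun t => w i t * c i t)) /\
    `|\int[mu1]_(t in `]0, T[) (w i t * c i t)| <= M%:R * Gm * B.
  move=> iN; have [iw _ wB] := hw i iN.
  have E : (fun t => w i t * c i t) =
      (fun t => \sum_(j < M) a i j * (w i t * \1_(slot M j) t)).
    apply/funext => t; rewrite /c /slot_step mulr_sumr; apply: eq_bigr => j _.
    by rewrite mulrCA.
  have iS (j : 'I_M) := integral_slot (ltn_ord j) iw wB.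
  have [sE sI] := @Rintegral_sum _ _ _ mu1 'I_M (index_enum 'I_M)
    (fun j t => a i j * (w i t * \1_(slot M j) t)) `]0, T[%classic mI
    (fun j => integrableZl mI (a i j) (iS j).1).
  rewrite E sE; split => //.
  apply: (@le_trans _ _ (\sum_(j < M) Gm * B)).
    apply: normr_sum_le => j; rewrite RintegralZl//; last exact: (iS j).1.
    by rewrite normrM ler_pM//; [exact: GM|exact: (iS j).2].
  by rewrite sumr_const card_ord -mulrA mulr_natl.
have [|_] := @cell_sum_average R T s S L rhobar N x N0 tr w c G Gm delta _
  (measurable_almost_lip aG) GM.
  move=> i iN; have [iw _ _] := hw i iN; split => //.
  - exact: (wc i iN).1.
  - exact: delta0.
  - move=> [t y] [/= tT /andP[h1 h2]].
    have t01 : 0 <= t < T by move: tT; rewrite in_itv/= => /andP[/ltW-> ->].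
    have [j jM /andP[t1 t2]] := grid_index (isT : (0 < M)%N) T0 t01.
    rewrite /c (slot_stepE _ jM); last by rewrite /slot/= in_itv/= t1 t2.
    have gT : tau * j%:R \in `[0, T].
      rewrite in_itv/= mulr_ge0 ?(ltW tau0)//=.
      by rewrite /tau mulrAC ler_pdivrMr// ler_pM2l// ler_nat ltnW.
    apply: le_trans (hK _ _ _ _) _; rewrite lerD2l ler_pM2l//.
    have tj : `|t - tau * j%:R| <= tau.
      rewrite ger0_norm ?subr_ge0// lerBlDl.
      by move: t2; rewrite -natr1 mulrDr mulr1 => /ltW.
    have := traj_lipschitz tr (ltnW iN) (itv_oocc tT) gT => hx.
    have Lt : L * `|t - tau * j%:R| <= L * tau by rewrite ler_wpM2l.
    have [_ hli] := hl i t iN tT.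
    have : `|y - x i (tau * j%:R)| <= l i + L * tau.
      have -> : y - x i (tau * j%:R) = (y - x i t) + (x i t - x i (tau * j%:R)) by lra.
      apply: le_trans (ler_normD _ _) _; rewrite (ger0_norm (_ : 0 <= y - x i t)) ?subr_ge0//.
      lra.
    lra.
move=> avg.
rewrite -(subrK (N%:R^-1 * \sum_(i < N) \int[mu1]_(t in `]0, T[) (w i t * c i t))
  (\int[mu2]_z (cell_sum T N x w z * G z))).
apply: le_trans (ler_normD _ _) _; apply: lerD; last first.
  rewrite normrM ger0_norm ?invr_ge0// ler_pdivrMl//.
  apply: (@le_trans _ _ (\sum_(i < N) M%:R * Gm * B)).
    by apply: normr_sum_le => i; exact: (wc i (ltn_ord i)).2.
  by rewrite sumr_const card_ord -[leLHS]mulr_natl.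
apply: le_trans avg _.
apply: (@le_trans _ _ (N%:R^-1 * \sum_(i < N) (delta i * C))).
  rewrite ler_pM2l ?invr_gt0//; apply: ler_sum => i _.
  have [_ hC _] := hw i (ltn_ord i); apply: ler_wpM2l => //.
  exact: delta0.
have -> : N%:R^-1 * \sum_(i < N) (delta i * C) =
    e / (3 * (C + 1)) * C + K * (1 + L) * tau * C + K * C * (N%:R^-1 * \sum_(i < N) l i).
  rewrite -big_distrl/=.
  have -> : \sum_(i < N) delta i =
      (e / (3 * (C + 1)) + K * ((1 + L) * tau)) * N%:R + K * \sum_(i < N) l i.
    have dE i : delta i = (e / (3 * (C + 1)) + K * ((1 + L) * tau)) + K * l i.
      by rewrite /delta; ring.
    under eq_bigr do rewrite dE.
    rewrite big_split/=; congr (_ + _); last by rewrite -mulr_sumr.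
    by rewrite sumr_const card_ord mulr_natr.
  by field; rewrite !gt_eqF.
have h1 : e / (3 * (C + 1)) * C <= e / 3.
  rewrite mulrAC ler_pdivrMr ?mulr_gt0//.
  have -> : e / 3 * (3 * (C + 1)) = e * (C + 1) by field.
  by rewrite ler_pM2l// lerDl.
have h2 : K * C * (N%:R^-1 * \sum_(i < N) l i) <= e / 3.
  apply: (@le_trans _ _ (K * C * (e / (3 * (K * (C + 1)))))).
    by rewrite ler_wpM2l// mulr_ge0// ltW.
  rewrite mulrA ler_pdivrMr ?mulr_gt0//.
  have -> : e / 3 * (3 * (K * (C + 1))) = K * (C + 1) * e by field.
  by rewrite ler_pM2r// ler_pM2l// lerDl.
rewrite -/tau in hM; lra.
Qed.

End oscillations.

(** * The follower equation divided by [theta] *)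

(** By the equation [w = - eps x_i''], with primitive [- eps x_i'], whose increments are at most
    [eps L] because velocities lie in [[0, L]]. The one-sided bound [w >= - Fm] comes from the sign
    of the velocity. *)
Lemma micro_flux (R : realType) (T gamma eps rhobar s S C0 Fm L : R)
    (theta : R -> R) (F : R * R -> R) (N : nat) (x0 v0 : nat -> R)
    (x : nat -> R -> R) :
  0 < T -> 0 < gamma -> 0 < eps -> (0 < N)%N -> 0 <= Fm -> s <= S ->
  nonlinearities T rhobar theta F ->
  admissible_data T rhobar s S C0 N x0 v0 (x N) ->
  micro_solution T gamma eps rhobar theta F N x0 v0 x ->
  (forall z, `|box_ext T s S F z| <= Fm) ->
  trajectories T s S L rhobar N x ->
  forall i, (i < N)%N ->
  let w t := gamma * (vel T x i t / theta (density N x i t))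
             - box_ext T s S F (t, x i t) in
  [/\ (leb1 R).-integrable `]0, T[%classic (EFin \o w),
      \int[leb1 R]_(t in `]0, T[) `|w t| <= eps * L + 2 * Fm * T &
      forall a b : R, 0 <= a -> a < b -> b <= T ->
        `|\int[leb1 R]_(t in `]a, b[) w t| <= eps * L].
Proof.
move=> T0 g0 e0 N0 Fm0 sS nl data sol FM tr i iN w.
have Fx t : t \in `]0, T[ -> box_ext T s S F (t, x i t) = F (t, x i t).
  move=> tT; rewrite box_extE//; first exact: itv_oocc.
  by apply: (traj_itv tr) (itv_oocc tT); exact: ltnW.
have Fb j t : (j < N)%N -> t \in `[0, T] -> F (t, x j t) <= Fm.
  move=> jN tT; rewrite -(@box_extE _ T s S F)//.
    by apply: le_trans (ler_norm _) (FM _).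
  by apply: (traj_itv tr) tT; exact: ltnW.
have reg t (tT : t \in `]0, T[) :=
  micro_regular T0 g0 e0 N0 Fm0 nl data sol Fb (subnK (ltnW iN)) tT.
have dgt0 t : t \in `]0, T[ -> 0 < density N x i t.
  by move=> tT; have /andP[] := density_bounds N0 tr iN (itv_oocc tT).
have thgt0 t : t \in `]0, T[ -> 0 < theta (density N x i t).
  move=> tT; have dge := ltW (dgt0 t tT); have [_ _ _ /(_ iN)[dr _ _]] := reg t tT.
  rewrite lt_neqAle (theta_ge0 nl dge) andbT eq_sym; apply/eqP.
  by move/(theta_eq0 nl dge); rewrite leNgt dr.
have cth t : t \in `]0, T[ -> {for t, continuous (theta \o density N x i)}.
  move=> tT; apply: continuous_comp; first exact: (continuous_density N0 tr iN tT).
  apply: (within_continuous_at _ (theta_continuous nl)).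
  near=> r; rewrite /= in_itv/= andbT; near: r.
  by apply: filterS (lt_nbhsr (dgt0 t tT)) => r; exact: ltW.
have aF := box_ext_almost_lip (ltW T0) sS (F_continuous nl).
apply: (@FTC_oo_estimate R T Fm (eps * L) w (- eps *: vel T x i) T0 _ _ _ Fm0).
- move=> t tT; have [_ _ _ /(_ iN)[_ dv eqv]] := reg t tT.
  have -> : w t = - eps *: deriv_in `[0, T] (vel T x i) t.
    have := thgt0 t tT => th0; rewrite /w Fx// /GRing.scale/=.
    have -> : F (t, x i t) = (theta (density N x i t) * F (t, x i t)) /
        theta (density N x i t) by rewrite mulrAC mulfV ?mul1r ?gt_eqF.
    by rewrite -eqv; field; rewrite gt_eqF.
  exact: is_deriveZ.
- move=> t tT; apply: cvgB; last first.
    by apply: (continuous_along aF); exact: (traj_continuous tr (ltnW iN) tT).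
  apply: cvgM; first exact: cvg_cst.
  apply: cvgM; first exact: (traj_vel_continuous tr iN tT).
  by apply: cvgV; [rewrite gt_eqF// thgt0|exact: cth].
- move=> t tT; rewrite /w.
  have : box_ext T s S F (t, x i t) <= Fm by apply: le_trans (ler_norm _) (FM _).
  have : 0 <= gamma * (vel T x i t / theta (density N x i t)).
    have /andP[v0' _] := traj_vel tr iN tT.
    by rewrite mulr_ge0 ?(ltW g0)// divr_ge0// ltW// thgt0.
  lra.
- move=> a b aT bT; rewrite -[X in `|X|]/((- eps * vel T x i b) - (- eps * vel T x i a)).
  rewrite -mulrBr normrM normrN (gtr0_norm e0) ler_pM2l//.
  have /andP[a0 aL] := traj_vel tr iN aT; have /andP[b0 bL] := traj_vel tr iN bT.
  rewrite ler_norml; apply/andP; split; lra.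
Unshelve. all: by end_near. Qed.

(** * The initial density *)

Lemma deriv_in_cst (R : realType) (A : set R) (c t : R) :
  nbhs t A -> deriv_in A (fun=> c) t = 0.
Proof.
move=> At; have dc : derivable_in A (fun=> c) t.
  rewrite /derivable_in /diff_quot_in.
  rewrite (_ : (fun s => (c - c) / (s - t)) = fun=> 0); first exact: is_cvg_cst.
  by apply/funext => s; rewrite subrr mul0r.
exact: is_derive_unique (deriv_in_is_derive At dc) (is_derive_cst _ _ _).
Qed.

(** The initial density has no time variable; it is treated as that of a motion at rest, to which
    the estimates on cells apply. *)
Lemma frozen_trajectories (R : realType) (T s S L rhobar t0 : R) (N : nat)
    (x : nat -> R -> R) : 0 < T -> (0 < N)%N -> t0 \in `[0, T] ->
  trajectories T s S L rhobar N x ->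
  trajectories T s S L rhobar N (fun i _ => x i t0).
Proof.
move=> T0 N0 t0T tr; have L0 := lipschitz_ge0 T0 tr.
split.
- by move=> i iN a b _ _; rewrite subrr normr0 mulr_ge0.
- by move=> i t iN _; exact: (traj_itv tr).
- by move=> i t iN _; exact: (traj_lt tr).
- by move=> i t iN _; exact: (traj_density tr iN t0T).
- move=> i t iN tT; rewrite /vel deriv_in_cst; last exact: nbhs_itvcc.
  exact: is_derive_cst.
- move=> i t iN tT.
  have near0 : \forall u \near t, 0 = vel T (fun i _ => x i t0) i u.
    near=> u; rewrite /vel deriv_in_cst//; apply: nbhs_itvcc.
    by near: u; exact: nbhs_itvoo.
  rewrite /prop_for /continuous_at -(nbhs_singleton near0).
  apply: cvg_trans; last exact: (@cvg_cst _ _ _ (nbhs t)).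
  by apply: near_eq_cvg; exact: near0.
- move=> i t iN tT; rewrite /vel deriv_in_cst ?lexx ?L0//; exact: nbhs_itvcc.
Unshelve. all: by end_near. Qed.

Lemma measurable_indic_co (R : realType) (a b : R) : measurable_fun setT
  (\1_(`[a, b[%classic) : measurableTypeR R -> R).
Proof. by apply: measurable_indic; exact: measurable_itv. Qed.

Section initial_density.
Context (R : realType) (T s S L rhobar : R) (N : nat) (x : nat -> R -> R).
Context (N0 : (0 < N)%N) (T0 : 0 < T) (r0 : 0 <= rhobar)
  (tr : trajectories T s S L rhobar N x).

Local Notation mu1 := (leb1 R).

Let frozen : nat -> R -> R := fun i _ => x i 0.

Let tr0 : trajectories T s S L rhobar N frozen.
Proof. by apply: frozen_trajectories => //; rewrite in_itv/= lexx ltW. Qed.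

Let T2 : T / 2 \in `]0, T[.
Proof. by rewrite in_itv/= divr_gt0//= ltr_pdivrMr// ltr_pMr// ltr1n. Qed.

(** Cells only live over the open time interval; [T / 2] serves as a sample time for the motion at
    rest. *)
Lemma rho_interp0E y :
  rho_interp N x (0, y) = cell_sum T N frozen (fun _ _ => 1) (T / 2, y).
Proof. by rewrite -(rho_interpE N frozen (T2 : (T / 2, y).1 \in _)). Qed.

Lemma rho_interp0_bounds y : 0 <= rho_interp N x (0, y) <= rhobar.
Proof.
rewrite rho_interp0E -[rhobar in X in _ && X]mul1r.
by apply: (cell_sum_bounds N0 tr0 _ ler01) => // i t _ _; rewrite ler01 lexx.
Qed.

Lemma rho_interp0_supp y : ~ `[s, S]%classic y -> rho_interp N x (0, y) = 0.
Proof. by move=> ny; rewrite rho_interp0E (cell_sum_supp tr0)// => -[]. Qed.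

Lemma measurable_rho_interp0 :
  measurable_fun setT (fun y : measurableTypeR R => rho_interp N x (0, y)).
Proof.
rewrite (_ : (fun _ => _) = fun y => \sum_(i < N)
  density N x i 0 * \1_(`[x i 0, x i.+1 0[%classic) y)//.
apply: measurable_sum => i; apply: measurable_funM; first exact: measurable_cst.
exact: measurable_indic_co.
Qed.

Lemma rho_interp0_at_positions (g : R -> R) (gm : R) (delta : nat -> R) :
  measurable_fun setT (g : measurableTypeR R -> R) -> (forall y, `|g y| <= gm) ->
  (forall i y, (i < N)%N -> x i 0 <= y < x i.+1 0 -> `|g y - g (x i 0)| <= delta i) ->
  `|\int[mu1]_y (rho_interp N x (0, y) * g y) -
    N%:R^-1 * \sum_(i < N) g (x i 0)| <= N%:R^-1 * \sum_(i < N) delta i.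
Proof.
move=> mg gM gd.
have n0 : 0 < N%:R :> R by rewrite ltr0n.
pose P i y := density N x i 0 * \1_(`[x i 0, x i.+1 0[%classic) y.
have PE (i : 'I_N) y : P i y = cell_density T N frozen i (T / 2, y).
  rewrite /P /cell_density !indicE; congr (_ * (nat_of_bool _)%:R).
  apply/idP/idP; rewrite !inE /cell/= in_itv/=; first by split.
  by case.
have slice (i : 'I_N) c : (\int[mu1]_y (c * P i y)%:E = (c * N%:R^-1)%:E)%E.
  under eq_integral do rewrite PE.
  rewrite (integral_cell_slice N0 tr0 c _ (ltn_ord i)).
  by rewrite indicE mem_set ?mulr1.
have P0 (i : 'I_N) y : 0 <= P i y by rewrite PE (cell_density_ge0 tr0).
have mP (i : 'I_N) : measurable_fun setT (P i : measurableTypeR R -> R).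
  apply: measurable_funM; first exact: measurable_cst.
  exact: measurable_indic_co.
have iP (i : 'I_N) : mu1.-integrable setT (EFin \o P i).
  apply/integrableP; split; first exact/measurable_EFinP.
  have -> : (\int[mu1]_y `|(EFin \o P i) y|)%E = (\int[mu1]_y (1 * P i y)%:E)%E.
    by apply: eq_integral => y _ /=; rewrite mul1r ger0_norm.
  by rewrite slice ltry.
have IP (i : 'I_N) c : \int[mu1]_y (c * P i y) = c / N%:R.
  by rewrite /Rintegral slice.
have iPg (i : 'I_N) : mu1.-integrable setT (EFin \o (fun y => P i y * g y)).
  have := integrableZr measurableT mg (fun z _ => gM z) (iP i).
  by apply: eq_integrable => // y _ /=; rewrite mulrC.
have [sE _] := @Rintegral_sum _ _ _ mu1 'I_N (index_enum 'I_N)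
  (fun i y => P i y * g y) setT measurableT iPg.
have -> : (fun y => rho_interp N x (0, y) * g y) = (fun y => \sum_(i < N) P i y * g y).
  by apply/funext => y; rewrite /rho_interp mulr_suml.
rewrite sE !mulr_sumr -sumrB; apply: normr_sum_le => i.
have iPc (c : R) : mu1.-integrable setT (EFin \o (fun y => c * P i y)).
  by have := integrableZl measurableT c (iP i); apply: eq_integrable.
have -> : N%:R^-1 * g (x i 0) = \int[mu1]_y (g (x i 0) * P i y) by rewrite IP mulrC.
rewrite -RintegralB//; apply: le_trans (le_normr_Rintegral _ _) _ => //.
  by have := integrableB measurableT (iPg i) (iPc (g (x i 0))); apply: eq_integrable.
rewrite [leRHS]mulrC -(IP i); apply: le_Rintegral => //.
  apply: integrable_norm.
  by have := integrableB measurableT (iPg i) (iPc (g (x i 0))); apply: eq_integrable.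
move=> y _; rewrite [g (x i 0) * _]mulrC -mulrBr normrM (ger0_norm (P0 i y)) mulrC.
have [yc|yc] := boolP (y \in `[x i 0, x i.+1 0[); last first.
  rewrite /P indicE memNset ?mulr0 ?mulr0//.
  by move=> /= yc'; rewrite yc' in yc.
rewrite ler_wpM2r// gd//; by move: yc; rewrite in_itv.
Qed.

End initial_density.

(** * Extraction and passage to the limit *)

(** The bounds hold at every point and not merely almost everywhere, so that [f] can be restricted
    and multiplied without tracking null sets. *)
Definition density_limit_of (d : measure_display) (X : measurableType d)
    (R : realType) (mu : {measure set X -> \bar R}) (D : set X) (M : R)
    (u : nat -> X -> R) (f : X -> R) : Prop :=
  [/\ measurable_fun setT f, forall z, 0 <= f z <= M,
      forall z, ~ D z -> f z = 0, mu.-integrable setT (EFin \o f) &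
      forall g, mu.-integrable setT (EFin \o g) ->
        \int[mu]_z (u n z * g z) @[n --> \oo] --> \int[mu]_z (f z * g z)].

Lemma Rintegral_density_bound (d : measure_display) (X : measurableType d)
    (R : realType) (mu : {sigma_finite_measure set X -> \bar R}) (D B : set X)
    (M : R) (u : X -> R) : measurable D -> (mu D < +oo)%E ->
  measurable_fun setT u -> (forall z, 0 <= u z <= M) -> 0 <= M ->
  (forall z, ~ D z -> u z = 0) -> measurable B ->
  `|\int[mu]_(z in B) u z| <= M * fine (mu D).
Proof.
move=> mD muD mu_ uM M0 uD mB.
have u0 z : 0 <= u z by have /andP[] := uM z.
have uM' z : u z <= M by have /andP[] := uM z.
have /andP[h0 h1] := @densities_le _ _ _ mu D M (fun=> u) mD muD (fun=> mu_)
  (fun=> u0) (fun=> uM') (fun=> uD) 0%N B mB.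
rewrite ger0_norm//; apply: le_trans h1 _; rewrite ler_wpM2l//.
apply: fine_le; [exact: mu_capD_fin|by rewrite ge0_fin_numE|].
by apply: le_measure; rewrite ?inE//; exact: measurableI.
Qed.

Lemma plane_sigma_finite (R : realType) : sigma_finite setT
  (leb2 R).
Proof.
pose I n : set (measurableTypeR R) := `[- n%:R, n%:R]%classic.
have mI n : measurable (I n) by exact: measurable_itv.
have Ifin n : (leb1 R (I n) < +oo)%E.
  have := @lebesgue_measure_itv R `[- n%:R, n%:R]; rewrite /I => -> /=.
  by case: ifP => _; rewrite ?ltry// -EFinB ltry.
exists (fun n => I n `*` I n).
  apply/seteqP; split => // -[a b] _.
  exists (Num.truncn (`|a| + `|b|)).+1 => //.
  have := truncnS_gt (`|a| + `|b|); set n := _.+1 => h.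
  split; rewrite /I/= in_itv/= -ler_norml; apply/ltW/(le_lt_trans _ h).
    by rewrite lerDl.
  by rewrite lerDr.
move=> n; split; first exact: measurableX.
rewrite product_measure1E//; apply: lte_mul_pinfty => //.
  by rewrite ge0_fin_numE; [exact: Ifin|exact: measure_ge0].
exact: Ifin.
Qed.

(** Planar Lebesgue measure with its sigma-finiteness attached, as the Radon-Nikodym argument
    requires. *)
Definition plane_measure (R : realType) : {sigma_finite_measure set
    (measurableTypeR R * measurableTypeR R)%type -> \bar R} :=
  HB.pack_for (SigmaFiniteMeasure.type (measurableTypeR R * measurableTypeR R)%type R)
    (leb2 R)
    (isSFinite.Build _ _ _ _ (sfinite_measure_sigma_finite (@plane_sigma_finite R)))
    (isSigmaFinite.Build _ _ _ _ (@plane_sigma_finite R)).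

Section extraction.
Context (R : realType) (T s S L rhobar : R) (x : nat -> nat -> R -> R).
Context (T0 : 0 < T) (L0 : 0 <= L) (r0 : 0 <= rhobar)
  (tr : forall N, (0 < N)%N -> trajectories T s S L rhobar N (x N)).

Local Notation mu1 := (leb1 R).
Local Notation mu2 := (leb2 R).

Definition space_box : set (measurableTypeR R) := `[s, S]%classic.
Definition spacetime_box : set (measurableTypeR R * measurableTypeR R) :=
  `]0, T[%classic `*` `[s, S]%classic.

Definition rho_cells N := cell_sum T N (x N) (fun _ _ => 1).
Definition e1_cells N := cell_sum T N (x N) (vel T (x N)).
Definition rho_init N y := rho_interp N (x N) (0, y).

Lemma measurable_space_box : measurable space_box.
Proof. exact: measurable_itv. Qed.

Lemma space_box_fin : (mu1 space_box < +oo)%E.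
Proof.
have := @lebesgue_measure_itv R `[s, S]; rewrite /space_box => -> /=.
by case: ifP => _; rewrite ?ltry// -EFinB ltry.
Qed.

Lemma measurable_spacetime_box : measurable spacetime_box.
Proof. by apply: measurableX; exact: measurable_itv. Qed.

Lemma spacetime_box_fin : (mu2 spacetime_box < +oo)%E.
Proof.
rewrite /spacetime_box product_measure1E; [|exact: measurable_itv..].
rewrite lte_mul_pinfty//; last exact: space_box_fin.
by rewrite ge0_fin_numE//; exact: itv_finite.
Qed.

Lemma vel_integrable N i : (0 < N)%N -> (i < N)%N ->
  mu1.-integrable `]0, T[%classic (EFin \o vel T (x N) i).
Proof.
move=> N0 iN; apply: (@integrable_bounded _ _ _ _ _ _ L).
- exact: measurable_itv.
- exact: itv_finite.
- apply: open_continuous_measurable_fun; first exact: interval_open.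
  by move=> t /set_mem tT; exact: (traj_vel_continuous (tr N0) iN tT).
- by move=> t tT; have /andP[v0 vL] := traj_vel (tr N0) iN tT; rewrite ger0_norm.
Qed.

Lemma rho_cells_measurable N : (0 < N)%N ->
  measurable_fun setT (rho_cells N : measurableTypeR R * measurableTypeR R -> R).
Proof.
move=> N0; apply/measurable_EFinP; apply: (@measurable_int _ _ _ mu2).
by apply: (measurable_cell_sum N0 (tr N0)) => i _; exact: integrable_cst_itv.
Qed.

Lemma e1_cells_measurable N : (0 < N)%N ->
  measurable_fun setT (e1_cells N : measurableTypeR R * measurableTypeR R -> R).
Proof.
move=> N0; apply/measurable_EFinP; apply: (@measurable_int _ _ _ mu2).
by apply: (measurable_cell_sum N0 (tr N0)) => i iN; exact: vel_integrable.
Qed.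

Lemma rho_cells_bounds N z : (0 < N)%N -> 0 <= rho_cells N z <= rhobar.
Proof.
move=> N0; rewrite -[rhobar in X in _ && X]mul1r.
by apply: (cell_sum_bounds N0 (tr N0) _ ler01) => // i t _ _; rewrite ler01 lexx.
Qed.

Lemma e1_cells_bounds N z : (0 < N)%N -> 0 <= e1_cells N z <= L * rhobar.
Proof.
by move=> N0; apply: (cell_sum_bounds N0 (tr N0) _ L0) => // i t; exact: (traj_vel (tr N0)).
Qed.

(** One countable index for all scalar sequences that must converge, so that a single subsequence
    serves every limit: integrals of [rho^N] and of [e_1^N] over quadrants, of the initial density
    over rays, positions of the rearmost vehicle and of the leader at rational times. [None] stands
    for the whole space, on which convergence is needed to pass to complements. *)
Definition observable : Type :=
  (((option (rat * rat) + option (rat * rat)) + option rat) + (rat + rat))%type.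

Definition quadrant_of (o : option (rat * rat)) : set (measurableTypeR R * measurableTypeR R) :=
  if o is Some pq then @rat_quadrant R pq else setT.

Definition ray_of (o : option rat) : set (measurableTypeR R) :=
  if o is Some q then @rat_ray R q else setT.

Definition observe (N : nat) (i : observable) : R :=
  match i with
  | inl (inl (inl o)) => \int[mu2]_(z in quadrant_of o) rho_cells N z
  | inl (inl (inr o)) => \int[mu2]_(z in quadrant_of o) e1_cells N z
  | inl (inr o) => \int[mu1]_(y in ray_of o) rho_init N y
  | inr (inl q) => x N 0%N (clamp 0 T (ratr q))
  | inr (inr q) => x N N (clamp 0 T (ratr q))
  end.

Definition observe_bound (i : observable) : R :=
  match i with
  | inl (inl (inl _)) => rhobar * fine (mu2 spacetime_box)
  | inl (inl (inr _)) => L * rhobar * fine (mu2 spacetime_box)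
  | inl (inr _) => rhobar * fine (mu1 space_box)
  | inr _ => `|s| + `|S|
  end.

Lemma measurable_quadrant_of o : measurable (quadrant_of o).
Proof.
by case: o => [pq|]//=; apply: measurableX; exact: measurable_rat_ray.
Qed.

Lemma measurable_ray_of o : measurable (ray_of o).
Proof. by case: o => [pq|]//=; exact: measurable_rat_ray. Qed.

Lemma observe_le N i : (0 < N)%N -> `|observe N i| <= observe_bound i.
Proof.
move=> N0; have pos j t : (j <= N)%N -> `|x N j (clamp 0 T t)| <= `|s| + `|S|.
  move=> jN; have := traj_itv (tr N0) jN (clamp_itv t (ltW T0)).
  rewrite in_itv/= => /andP[h1 h2]; rewrite ler_norml.
  have := ler_norm S; have := ler_norm (- s); rewrite normrN => h3 h4.
  have := normr_ge0 s; have := normr_ge0 S => h5 h6.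
  by apply/andP; split; lra.
case: i => [i|i] /=; last by case: i => q; exact: pos.
case: i => [i|o]; first (case: i => o).
- rewrite /=; apply: (@Rintegral_density_bound _ _ R (plane_measure R) spacetime_box _ _ _
    measurable_spacetime_box spacetime_box_fin) => //.
  + exact: rho_cells_measurable.
  + by move=> z; exact: rho_cells_bounds.
  + by move=> z; exact: (cell_sum_supp (tr N0)).
  + exact: measurable_quadrant_of.
- rewrite /=; apply: (@Rintegral_density_bound _ _ R (plane_measure R) spacetime_box _ _ _
    measurable_spacetime_box spacetime_box_fin) => //.
  + exact: e1_cells_measurable.
  + by move=> z; exact: e1_cells_bounds.
  + exact: mulr_ge0.
  + by move=> z; exact: (cell_sum_supp (tr N0)).
  + exact: measurable_quadrant_of.
- rewrite /=; apply: (@Rintegral_density_bound _ _ R mu1 space_box _ _ _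
    measurable_space_box space_box_fin) => //.
  + exact: measurable_rho_interp0.
  + by move=> y; exact: (rho_interp0_bounds N0 T0 r0 (tr N0)).
  + by move=> y; exact: (rho_interp0_supp N0 T0 (tr N0)).
  + exact: measurable_ray_of.
Qed.

Lemma extraction : exists k : nat -> nat, exists rho0 : R -> R,
  exists rho e1 : R * R -> R,
  [/\ (forall n, (0 < k n)%N) /\ {homo k : m n / (m < n)%N},
      forall q : rat, cvg (x (k n) 0%N (clamp 0 T (ratr q)) @[n --> \oo]) /\
        cvg (x (k n) (k n) (clamp 0 T (ratr q)) @[n --> \oo]),
      density_limit_of mu1 space_box rhobar (fun n => rho_init (k n)) rho0,
      density_limit_of mu2 spacetime_box rhobar (fun n => rho_cells (k n)) rho &
      density_limit_of mu2 spacetime_box (L * rhobar) (fun n => e1_cells (k n)) e1].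
Proof.
(* The shift keeps the number of vehicles positive, as the model starts at [N = 1]. *)
have [k0 [hk0 ck0]] := @diagonal_subseq R observable (fun n => observe n.+1)
  observe_bound (fun n i => observe_le i (ltn0Sn n)).
pose k n := (k0 n).+1; have kgt0 n : (0 < k n)%N by [].
have ck i : cvg (observe (k n) i @[n --> \oo]) by exact: ck0.
have Lr : 0 <= L * rhobar by rewrite mulr_ge0.
have [|rho Hrho] := @weakstar_compactness _ _ R (plane_measure R) spacetime_box rhobar
  (fun n => rho_cells (k n)) (range (@rat_quadrant R))
  measurable_spacetime_box spacetime_box_fin r0
  (fun n => rho_cells_measurable (kgt0 n))
  (fun n z => rho_cells_bounds z (kgt0 n))
  (fun n z nz => cell_sum_supp (tr (kgt0 n)) _ nz)
  (@rat_quadrant_generates R) (@rat_quadrant_setI_closed R)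
  (ck (inl (inl (inl None)))) _.
  by move=> _ [pq _ <-]; exact: (ck (inl (inl (inl (Some pq))))).
have [|e1 He1] := @weakstar_compactness _ _ R (plane_measure R) spacetime_box
  (L * rhobar) (fun n => e1_cells (k n)) (range (@rat_quadrant R))
  measurable_spacetime_box spacetime_box_fin Lr
  (fun n => e1_cells_measurable (kgt0 n))
  (fun n z => e1_cells_bounds z (kgt0 n))
  (fun n z nz => cell_sum_supp (tr (kgt0 n)) _ nz)
  (@rat_quadrant_generates R) (@rat_quadrant_setI_closed R)
  (ck (inl (inl (inr None)))) _.
  by move=> _ [pq _ <-]; exact: (ck (inl (inl (inr (Some pq))))).
have [|rho0 Hrho0] := @weakstar_compactness _ _ R mu1 space_box
  rhobar (fun n => rho_init (k n)) (range (@rat_ray R))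
  measurable_space_box space_box_fin r0
  (fun n => measurable_rho_interp0 (k n) (x (k n)))
  (fun n y => rho_interp0_bounds (kgt0 n) T0 r0 (tr (kgt0 n)) y)
  (fun n y ny => rho_interp0_supp (kgt0 n) T0 (tr (kgt0 n)) ny)
  (@rat_ray_generates R) (@rat_ray_setI_closed R)
  (ck (inl (inr None))) _.
  by move=> _ [q _ <-]; exact: (ck (inl (inr (Some q)))).
exists k, rho0, rho, e1; split => //.
by move=> q; split; [exact: (ck (inr (inl q)))|exact: (ck (inr (inr q)))].
Qed.

End extraction.

(** * Chain rule along a trajectory *)

Lemma strip_nbhs (R : realType) (T t y : R) : t \in `]0, T[ ->
  nbhs (t, y) (strip T).
Proof.
move=> tT; exists (`[0, T]%classic, [set: R]) => //=.
by split; [exact: nbhs_itvcc|exact: filterT].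
Qed.

(** Only the partial derivatives of [phi] are given. The increment is split through [phi (t, y u)]:
    the part in space is an ordinary composition, and the part in time is handled by the mean value
    theorem and the joint continuity of [partial_t T phi]. *)
Lemma chain_rule_strip (R : realType) (T t v : R) (phi : R * R -> R) (y : R -> R) :
  C1_strip T phi -> t \in `]0, T[ -> is_derive t 1 y v ->
  is_derive t 1 (fun u => phi (u, y u))
    (partial_t T phi (t, y t) + v * partial_x phi (t, y t)).
Proof.
move=> [_ dphi ct cx] tT dy.
have cy := is_derive_continuous dy.
have dt u z : u \in `]0, T[ ->
    is_derive u 1 (fun s => phi (s, z)) (partial_t T phi (u, z)).
  move=> uT; have [h _] := dphi (u, z) (conj (itv_oocc uT) I).
  exact: (deriv_in_is_derive (nbhs_itvcc uT) h).
have dx : is_derive (y t) 1 (fun z => phi (t, z)) (partial_x phi (t, y t)).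
  have [_ /= h] := dphi (t, y t) (conj (itv_oocc tT) I).
  by split => //; rewrite /partial_x/= derive1E.
have d2 : is_derive t 1 ((fun z => phi (t, z)) \o y) (partial_x phi (t, y t) * v).
  exact: is_derive1_comp dx dy.
pose f1 u := phi (u, y u) - phi (t, y u).
pose A u := if u == t then partial_t T phi (t, y t) else f1 u / (u - t).
have d1 : is_derive t 1 f1 (partial_t T phi (t, y t)).
  apply/is_derive1_caratheodory; exists A; split; last by rewrite /A eqxx.
    move=> u; rewrite /A; case: eqP => [->|/eqP ut]; first by rewrite !subrr mulr0.
    by rewrite /f1 subrr subr0 divfK// subr_eq0.
  have ctt : {for (t, y t), continuous (partial_t T phi)}.
    exact: within_continuous_at (strip_nbhs _ tT) ct.
  have At : A t = partial_t T phi (t, y t) by rewrite /A eqxx.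
  apply/cvgrPdist_le => e e0.
  have /cvgrPdist_le/(_ e e0)/nbhs_ballP[r /= r0 hr] := ctt.
  have near_t : \forall u \near t, `|t - u| < r.
    by apply/nbhs_ballP; exists r.
  have near_yt : \forall u \near t, `|y t - y u| < r.
    by have /cvgrPdist_lt/(_ r r0) := cy.
  near=> u; rewrite At /A; case: eqP => [_|/eqP ut]; first by rewrite subrr normr0 ltW.
  have uT : u \in `]0, T[ by near: u; exact: nbhs_itvoo.
  have ur : ball t r u by rewrite /ball/=; near: u.
  have yur : ball (y t) r (y u) by rewrite /ball/=; near: u.
  have key a b : a < b -> a \in `]0, T[ -> b \in `]0, T[ -> ball t r a -> ball t r b ->
      `|partial_t T phi (t, y t) - (phi (b, y u) - phi (a, y u)) / (b - a)| <= e.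
    move=> ab aT bT ar br.
    have sub c : c \in `[a, b] -> c \in `]0, T[.
      move: aT bT; rewrite !in_itv/= => /andP[a0 _] /andP[_ bT] /andP[ac cb].
      by rewrite (lt_le_trans a0)//= (le_lt_trans cb).
    have d c : c \in `]a, b[ -> is_derive c 1 (fun s => phi (s, y u)) (partial_t T phi (c, y u)).
      by move=> /itv_oocc/sub/dt; exact.
    have cc : {within `[a, b], continuous (fun s => phi (s, y u))}.
      apply: derivable_within_continuous => c /sub cT.
      exact: is_derive_derivable (dt c (y u) cT).
    have [c cab ->] := MVT ab d cc.
    rewrite mulfK ?subr_eq0 ?gt_eqF//; apply: (hr (c, y u)); split => //=.
    move: cab ar br; rewrite in_itv/ball/= !ltr_norml => /andP[ac cb] /andP[a1 a2] /andP[b1 b2].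
    by apply/andP; split; lra.
  have [tu|tu] := ltP t u.
    by apply: key => //; exact: ballxx.
  have ut' : u < t by rewrite lt_neqAle ut.
  have := key u t ut' uT tT ur (ballxx _ r0).
  rewrite (_ : (phi (t, y u) - phi (u, y u)) / (t - u) = f1 u / (u - t))//.
  by rewrite /f1 -opprB mulNr -mulrN -invrN opprB.
have := is_deriveD d1 d2.
rewrite [partial_x _ _ * v]mulrC => h; apply: near_eq_is_derive h.
near=> u.
have -> : (f1 + ((fun z => phi (t, z)) \o y)) u =
  phi (u, y u) - phi (t, y u) + phi (t, y u) by [].
by rewrite subrK.
Unshelve. all: by end_near. Qed.

Lemma within_continuous_along (R : realType) (T : R) (phi : R * R -> R) (y : R -> R) :
  {within strip T, continuous phi} -> {within `[0, T], continuous y} ->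
  {within `[0, T], continuous (fun u => phi (u, y u))}.
Proof.
move=> /subspace_continuousP cphi /subspace_continuousP cy.
apply/subspace_continuousP => t tT.
have /cvgrPdist_le := cphi (t, y t) (conj tT I) => h.
apply/cvgrPdist_le => e e0; have := h e e0.
rewrite !near_withinE => /nbhs_ballP[r /= r0 hr].
have /cvgrPdist_lt/(_ r r0) := cy t tT; rewrite near_withinE => near_y.
have near_t : \forall u \near t, `|t - u| < r by apply/nbhs_ballP; exists r.
near=> u => uT; apply: (hr (u, y u)) => //; split => /=.
  by rewrite /ball/=; near: u.
by have := near near_y u; apply.
Unshelve. all: by end_near. Qed.

Lemma trajectory_identity (R : realType) (T s S L rhobar : R) (N : nat)
    (x : nat -> R -> R) (phi : R * R -> R) (i : nat) :
  0 < T -> s <= S -> (i < N)%N -> trajectories T s S L rhobar N x ->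
  C1_strip T phi ->
  \int[leb1 R]_(t in `]0, T[)
    (box_ext T s S (partial_t T phi) (t, x i t)
     + vel T x i t * box_ext T s S (partial_x phi) (t, x i t))
  = phi (T, x i T) - phi (0, x i 0).
Proof.
move=> T0 sS iN tr C1; have [cphi _ ct cx] := C1.
have at_ := box_ext_almost_lip (ltW T0) sS ct.
have ax := box_ext_almost_lip (ltW T0) sS cx.
have [Mt Mt0 hMt] := box_ext_bounded (ltW T0) sS ct.
have [Mx Mx0 hMx] := box_ext_bounded (ltW T0) sS cx.
have [||||_ fE] := @FTC_oo_bounded R 0 T (Mt + L * Mx) (fun t =>
  box_ext T s S (partial_t T phi) (t, x i t)
     + vel T x i t * box_ext T s S (partial_x phi) (t, x i t))
  (fun u => phi (u, x i u)) T0.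
- move=> t tT; have xS := traj_itv tr (ltnW iN) (itv_oocc tT).
  rewrite !box_extE//; try exact: itv_oocc.
  exact: chain_rule_strip C1 tT (traj_derive tr iN tT).
- move=> t tT; have cxi := traj_continuous tr (ltnW iN) tT.
  apply: cvgD; first exact: (continuous_along at_ cxi).
  by apply: cvgM; [exact: traj_vel_continuous tr _ _ iN tT|exact: (continuous_along ax cxi)].
- move=> t tT; have /andP[v0 vL] := traj_vel tr iN tT.
  apply: le_trans (ler_normD _ _) _; apply: lerD => //.
  by rewrite normrM ler_pM// ger0_norm.
- apply: within_continuous_along => //.
  exact: lipschitz_within_continuous (traj_lipschitz tr (ltnW iN)).
- exact: fE.
Qed.

(** A bounded [G] need not be integrable, but its restriction to [D] is, and [D] carries all the
    densities. *)
Lemma density_limit_bounded (d : measure_display) (X : measurableType d)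
    (R : realType) (mu : {measure set X -> \bar R}) (D : set X) (M Gm : R)
    (u : nat -> X -> R) (f G : X -> R) :
  measurable D -> (mu D < +oo)%E -> (forall n z, ~ D z -> u n z = 0) ->
  density_limit_of mu D M u f -> measurable_fun setT G ->
  (forall z, `|G z| <= Gm) ->
  \int[mu]_z (u n z * G z) @[n --> \oo] --> \int[mu]_z (f z * G z).
Proof.
move=> mD muD uD [_ _ fD _ conv] mG GM.
have iG : mu.-integrable setT (EFin \o (G \_ D)).
  rewrite -restrict_EFin; apply/(integrable_mkcond _ mD).
  by apply: (@integrable_bounded _ _ _ _ _ _ Gm) => //; exact: measurable_funTS.
have E w : (forall z, ~ D z -> w z = 0) ->
    (fun z => w z * (G \_ D) z) = (fun z => w z * G z).
  move=> wD; apply/funext => z; rewrite patchE; case: ifPn => //.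
  by rewrite notin_setE => /wD ->; rewrite !mul0r.
have := conv _ iG; rewrite E//.
by under eq_fun do rewrite (E _ (uD _)).
Qed.

Lemma cvg_close0 (R : realType) (a : nat -> R) :
  (forall e, 0 < e -> \forall n \near \oo, `|a n| <= e) -> a n @[n --> \oo] --> 0.
Proof.
move=> h; apply/cvgrPdist_le => e e0; have := h e e0.
by apply: filterS => n; rewrite sub0r normrN.
Qed.

Lemma near_subseq (k : nat -> nat) (N1 : nat) : {homo k : m n / (m < n)%N} ->
  \forall n \near \oo, (N1 < k n)%N.
Proof. by move=> hk; exact: (subseq_cvg_infty hk (nbhs_infty_gt N1)). Qed.

Lemma sum3_close (R : realType) (a b c a' b' c' e : R) :
  `|a - a'| <= e / 3 -> `|b - b'| <= e / 3 -> `|c - c'| <= e / 3 ->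
  a' + b' + c' = 0 -> `|a + b + c| <= e.
Proof.
move=> h1 h2 h3 h.
have -> : a + b + c = (a - a') + (b - b') + (c - c') by move: h; lra.
apply: le_trans (ler_normD _ _) _; apply: le_trans (lerD (ler_normD _ _) h3) _; lra.
Qed.

Lemma sub_close (R : realType) (a b c e : R) :
  `|a - c| <= e / 2 -> `|b - c| <= e / 2 -> `|a - b| <= e.
Proof.
move=> h1 h2; have -> : a - b = (a - c) - (b - c) by lra.
by apply: le_trans (ler_normB _ _) _; lra.
Qed.

(** * Limits of the pairings with test functions *)

Section limits.
Context (R : realType) (T s S L rhobar : R) (x : nat -> nat -> R -> R).
Context (T0 : 0 < T) (L0 : 0 <= L) (sS : s <= S)
  (tr : forall N, (0 < N)%N -> trajectories T s S L rhobar N (x N)).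
Context (k : nat -> nat) (k0 : forall n, (0 < k n)%N)
  (hk : {homo k : m n / (m < n)%N}).

Local Notation mu1 := (leb1 R).
Local Notation mu2 := (leb2 R).

Context (rho0 : R -> R) (rho e1 : R * R -> R).
Context (lim_rho0 : density_limit_of mu1 (space_box s S) rhobar
                      (fun n => rho_init x (k n)) rho0)
  (lim_rho : density_limit_of mu2 (spacetime_box T s S) rhobar
                      (fun n => rho_cells T x (k n)) rho)
  (lim_e1 : density_limit_of mu2 (spacetime_box T s S) (L * rhobar)
                      (fun n => e1_cells T x (k n)) e1).

Lemma rho_limit (G : R * R -> R) (Gm : R) : almost_lip G ->
  (forall z, `|G z| <= Gm) ->
  \int[mu2]_z (rho_cells T x (k n) z * G z) @[n --> \oo] -->
  \int[mu2]_z (rho z * G z).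
Proof.
move=> aG GM; apply: (density_limit_bounded (measurable_spacetime_box T s S)
  (spacetime_box_fin T s S) _ lim_rho (measurable_almost_lip aG) GM).
by move=> n z; exact: (cell_sum_supp (tr (k0 n))).
Qed.

Lemma e1_limit (G : R * R -> R) (Gm : R) : almost_lip G ->
  (forall z, `|G z| <= Gm) ->
  \int[mu2]_z (e1_cells T x (k n) z * G z) @[n --> \oo] -->
  \int[mu2]_z (e1 z * G z).
Proof.
move=> aG GM; apply: (density_limit_bounded (measurable_spacetime_box T s S)
  (spacetime_box_fin T s S) _ lim_e1 (measurable_almost_lip aG) GM).
by move=> n z; exact: (cell_sum_supp (tr (k0 n))).
Qed.

Lemma continuous_slice (G : R * R -> R) (t : R) : continuous G ->
  continuous (fun y => G (t, y)).
Proof.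
move=> cG y; have cp : (fun y : R => (t, y)) @ y --> (t, y).
  exact: (@cvg_pair R R R (nbhs y) (nbhs t) (nbhs y) _ _ _ (fun=> t) id
    (cvg_cst _) cvg_id).
exact: (continuous_comp cp (cG _)).
Qed.

Lemma rho0_limit (G : R * R -> R) (Gm : R) : almost_lip G ->
  (forall z, `|G z| <= Gm) ->
  \int[mu1]_y (rho_init x (k n) y * G (0, y)) @[n --> \oo] -->
  \int[mu1]_y (rho0 y * G (0, y)).
Proof.
move=> aG GM; apply: (density_limit_bounded (measurable_space_box s S)
  (space_box_fin s S) _ lim_rho0 _ (fun y => GM (0, y))).
  by move=> n y; exact: (rho_interp0_supp (k0 n) T0 (tr (k0 n))).
apply: measurable_realfun.continuous_measurable_fun.
exact: continuous_slice (almost_lip_continuous aG).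
Qed.

Lemma unit_integrable N i : (i < N)%N ->
  mu1.-integrable `]0, T[%classic (EFin \o (fun _ : R => 1 : R)) /\
  \int[mu1]_(t in `]0, T[) `|(1 : R)| <= T.
Proof.
move=> _; split; first exact: integrable_cst_itv.
by rewrite (Rintegral_cst_itv _ (ltW T0)) normr1 mul1r subr0.
Qed.

Lemma vel_integrable_le N i : (0 < N)%N -> (i < N)%N ->
  mu1.-integrable `]0, T[%classic (EFin \o vel T (x N) i) /\
  \int[mu1]_(t in `]0, T[) `|vel T (x N) i t| <= L * T.
Proof.
move=> N0 iN; have iv := vel_integrable tr N0 iN; split => //.
have -> : L * T = \int[mu1]_(t in `]0, T[) L.
  by rewrite (Rintegral_cst_itv _ (ltW T0)) subr0.
apply: le_Rintegral => //.
- by apply: integrable_norm => //; exact: measurable_itv.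
- exact: integrable_cst_itv.
- by move=> t tT; have /andP[v0 vL] := traj_vel (tr N0) iN tT; rewrite ger0_norm.
Qed.

Lemma initial_positions_limit (G : R * R -> R) (Gm e : R) : almost_lip G ->
  (forall z, `|G z| <= Gm) -> 0 < e ->
  exists N1, forall N, (N1 < N)%N ->
  `|\int[mu1]_y (rho_init x N y * G (0, y)) -
    N%:R^-1 * \sum_(i < N) G (0, x N i 0)| <= e.
Proof.
move=> aG GM e0; have e2 : 0 < e / 2 by rewrite divr_gt0.
have [K K0 hK] := aG _ e2.
(* The lengths at time 0 sum to at most [S - s], so the error [K (S - s) / N] is at most [e / 2]
   past this index. *)
exists (Num.truncn (2 * (K * (S - s)) / e)) => N NN.
have N0 : (0 < N)%N by exact: leq_ltn_trans NN.
have n0 : 0 < N%:R :> R by rewrite ltr0n.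
have h0 : 0 \in `[0, T] by rewrite in_itv/= lexx ltW.
apply: le_trans (@rho_interp0_at_positions R T s S L rhobar N (x N) N0 T0 (tr N0)
  (fun y => G (0, y)) Gm (fun i => e / 2 + K * (x N i.+1 0 - x N i 0)) _ _ _) _.
- apply: measurable_realfun.continuous_measurable_fun.
  exact: continuous_slice (almost_lip_continuous aG).
- by move=> y; exact: GM.
- move=> i y iN /andP[h1 h2]; apply: le_trans (hK _ _ _ _) _.
  rewrite subrr normr0 add0r lerD2l ler_pM2l// ger0_norm ?subr_ge0//; lra.
rewrite big_split/= sumr_const card_ord -mulr_sumr mulrDr.
have h1 : N%:R^-1 * (e / 2 *+ N) = e / 2.
  by rewrite -(mulr_natr (e / 2)) mulrC mulfK ?gt_eqF.
have h2 : N%:R^-1 * (K * \sum_(i < N) (x N i.+1 0 - x N i 0)) <= e / 2.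
  rewrite ler_pdivrMl//.
  have := sum_cell_lengths (tr N0) h0; rewrite -(ler_pM2l K0) => /le_trans; apply.
  have : 2 * (K * (S - s)) / e < N%:R.
    by apply: lt_le_trans (truncnS_gt _) _; rewrite ler_nat.
  rewrite ltr_pdivrMr//; lra.
by rewrite h1; lra.
Qed.

(** The pairings with [rho^N], [e_1^N] and the initial density approach averages over [i] whose sum
    is exactly 0 for each [N]: the derivative of [phi (t, x_i t)] has integral [- phi (0, x_i 0)],
    as [phi] vanishes at time [T]. *)
Lemma transport_limit (phi : R * R -> R) : C1_strip T phi ->
  (forall y, phi (T, y) = 0) ->
  \int[mu2]_z (rho z * box_ext T s S (partial_t T phi) z) +
  \int[mu2]_z (e1 z * box_ext T s S (partial_x phi) z) =
  - \int[mu1]_y (rho0 y * box_ext T s S phi (0, y)).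
Proof.
move=> C1 phiT; have [cphi _ ct cx] := C1.
have ap := box_ext_almost_lip (ltW T0) sS cphi.
have at_ := box_ext_almost_lip (ltW T0) sS ct.
have ax := box_ext_almost_lip (ltW T0) sS cx.
have [Mp Mp0 hMp] := box_ext_bounded (ltW T0) sS cphi.
have [Mt Mt0 hMt] := box_ext_bounded (ltW T0) sS ct.
have [Mx Mx0 hMx] := box_ext_bounded (ltW T0) sS cx.
apply/eqP; rewrite -subr_eq0 opprK; apply/eqP.
apply: (cvg_unique _ (cvgD (cvgD (rho_limit at_ hMt) (e1_limit ax hMx))
  (rho0_limit ap hMp))) => //.
apply: cvg_close0 => e e0; have e3 : 0 < e / 3 by rewrite divr_gt0.
have LT0 : 0 <= L * T by rewrite mulr_ge0// ltW.
have [N1 hN1] := cell_sum_at_positions s S T0 L0 (ltW T0) at_ hMt e3.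
have [N2 hN2] := cell_sum_at_positions s S T0 L0 LT0 ax hMx e3.
have [N3 hN3] := initial_positions_limit ap hMp e3.
have close N : (0 < N)%N -> (N1 < N)%N -> (N2 < N)%N -> (N3 < N)%N ->
    `|\int[mu2]_z (rho_cells T x N z * box_ext T s S (partial_t T phi) z) +
      \int[mu2]_z (e1_cells T x N z * box_ext T s S (partial_x phi) z) +
      \int[mu1]_y (rho_init x N y * box_ext T s S phi (0, y))| <= e.
  move=> N0 nN1 nN2 nN3.
  have n0 : 0 < N%:R :> R by rewrite ltr0n.
  have h1 := hN1 N rhobar (x N) nN1 (tr N0) (fun _ _ => 1) (@unit_integrable N).
  have h2 := hN2 N rhobar (x N) nN2 (tr N0) (vel T (x N)) (fun i => vel_integrable_le N0).
  have h3 := hN3 N nN3.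
  rewrite -/(rho_cells T x N) in h1; rewrite -/(e1_cells T x N) in h2.
  have h0T : 0 \in `[0, T] by rewrite in_itv/= lexx ltW.
  have key : \sum_(i < N) \int[mu1]_(t in `]0, T[)
      (1 * box_ext T s S (partial_t T phi) (t, x N i t))
    + \sum_(i < N) \int[mu1]_(t in `]0, T[)
      (vel T (x N) i t * box_ext T s S (partial_x phi) (t, x N i t))
    = - \sum_(i < N) box_ext T s S phi (0, x N i 0).
    rewrite -big_split/= -sumrN; apply: eq_bigr => i _.
    have iN := ltn_ord i.
    rewrite box_extE//; last by apply: (traj_itv (tr N0)) => //; exact: ltnW.
    have := trajectory_identity T0 sS iN (tr N0) C1; rewrite phiT sub0r => <-.
    have i1 := integrable_along at_ hMt (tr N0) (ltnW iN) (@unit_integrable N i iN).1.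
    have i2 := integrable_along ax hMx (tr N0) (ltnW iN) (vel_integrable_le N0 iN).1.
    rewrite -RintegralD//.
    by apply: eq_Rintegral => t _; rewrite mul1r.
  refine (sum3_close h1 h2 h3 _).
  by rewrite -mulrDr -mulrDr key addNr mulr0.
near=> n; apply: (close (k n)) => //; near: n; exact: near_subseq.
Unshelve. all: by end_near. Qed.

(** Along trajectories [gamma q = w + Fx]. The part from [w] tends to 0 because its integrals over
    time intervals are of size [eps N]. For the other part, the cell sum of weight [Fx] tested with
    [G] and the density tested with [Fx G] have the same averages at the positions. *)
Lemma flux_limit (gamma Fm Gm : R) (eps : nat -> R) (Fx G : R * R -> R)
    (q : nat -> nat -> R -> R) : 0 < gamma -> 0 <= Fm -> 0 <= Gm ->
  almost_lip Fx -> almost_lip G -> almost_lip (fun z => Fx z * G z) ->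
  (forall z, `|Fx z| <= Fm) -> (forall z, `|G z| <= Gm) ->
  (forall N, (0 < N)%N -> 0 < eps N) -> eps @ \oo --> (0 : R) ->
  (forall N i, (0 < N)%N -> (i < N)%N ->
    let w t := gamma * q N i t - Fx (t, x N i t) in
    [/\ mu1.-integrable `]0, T[%classic (EFin \o w),
      \int[mu1]_(t in `]0, T[) `|w t| <= eps N * L + 2 * Fm * T &
      forall a b : R, 0 <= a -> a < b -> b <= T ->
        `|\int[mu1]_(t in `]a, b[) w t| <= eps N * L]) ->
  \int[mu2]_z (cell_sum T (k n) (x (k n)) (q (k n)) z * G z) @[n --> \oo] -->
  gamma^-1 * \int[mu2]_z (rho z * (Fx z * G z)).
Proof.
move=> g0 Fm0 Gm0 aF aG aFG FM GM eps0 epsC hw.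
pose f N i t := Fx (t, x N i t).
pose w N i t := gamma * q N i t - f N i t.
have FGM z : `|Fx z * G z| <= Fm * Gm by rewrite normrM ler_pM.
have if_ N i : (0 < N)%N -> (i < N)%N ->
    mu1.-integrable `]0, T[%classic (EFin \o f N i) /\
    \int[mu1]_(t in `]0, T[) `|f N i t| <= Fm * T.
  move=> N0 iN; have i1 : mu1.-integrable `]0, T[%classic (EFin \o f N i).
    have := integrable_along aF FM (tr N0) (ltnW iN) (@unit_integrable N i iN).1.
    by apply: eq_integrable => // t _ /=; rewrite mul1r.
  split => //; have -> : Fm * T = \int[mu1]_(t in `]0, T[) Fm.
    by rewrite (Rintegral_cst_itv _ (ltW T0)) subr0.
  apply: le_Rintegral => //.
  - by apply: integrable_norm => //; exact: measurable_itv.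
  - exact: integrable_cst_itv.
  - by move=> t _; exact: FM.
have qE : forall n z, cell_sum T n (x n) (q n) z * G z = gamma^-1 *
    (cell_sum T n (x n) (w n) z * G z + cell_sum T n (x n) (f n) z * G z).
  move=> n z; rewrite -mulrDl mulrA; congr (_ * _); rewrite /cell_sum -big_split/= mulr_sumr.
  apply: eq_bigr => i _; rewrite -mulrDl [RHS]mulrA; congr (_ * _).
  by rewrite /w subrK mulKf// gt_eqF.
have iwG N : (0 < N)%N -> mu2.-integrable setT
    (EFin \o (fun z => cell_sum T N (x N) (w N) z * G z)).
  move=> N0; have := @integrableZr _ _ _ mu2 G (cell_sum T N (x N) (w N)) Gm setT
    measurableT (measurable_almost_lip aG) (fun z _ => GM z)
    (measurable_cell_sum N0 (tr N0) (fun i iN => let: And3 a _ _ := hw N i N0 iN in a)).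
  by apply: eq_integrable => // z _ /=; rewrite mulrC.
have ifG N : (0 < N)%N -> mu2.-integrable setT
    (EFin \o (fun z => cell_sum T N (x N) (f N) z * G z)).
  move=> N0; have := @integrableZr _ _ _ mu2 G (cell_sum T N (x N) (f N)) Gm setT
    measurableT (measurable_almost_lip aG) (fun z _ => GM z)
    (measurable_cell_sum N0 (tr N0) (fun i iN => (if_ N i N0 iN).1)).
  by apply: eq_integrable => // z _ /=; rewrite mulrC.
have -> : (fun n => \int[mu2]_z (cell_sum T (k n) (x (k n)) (q (k n)) z * G z)) =
    (fun n => gamma^-1 * (\int[mu2]_z (cell_sum T (k n) (x (k n)) (w (k n)) z * G z) +
       \int[mu2]_z (cell_sum T (k n) (x (k n)) (f (k n)) z * G z))).
  apply/funext => n; rewrite -RintegralD//; [|exact: iwG|exact: ifG].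
  rewrite -RintegralZl//; first by apply: eq_Rintegral => z _; exact: qE.
  have := integrableD measurableT (iwG (k n) (k0 n)) (ifG (k n) (k0 n)).
  by apply: eq_integrable.
apply: cvgM; first exact: cvg_cst.
rewrite -[X in _ --> X]add0r; apply: cvgD.
- have C0 : 0 <= L + 2 * Fm * T by rewrite addr_ge0// !mulr_ge0// ltW.
  apply: cvg_close0 => e e0; have e2 : 0 < e / 2 by rewrite divr_gt0.
  have [N1 [M hNM]] := cell_sum_oscillating s S T0 L0 C0 aG GM e2.
  have Q0 : 0 < M%:R * Gm * L + 1 by rewrite ltr_wpDl// !mulr_ge0.
  (* The bound 1 on [eps] keeps the [L^1] norms below the constant [L + 2 Fm T] used to choose [M];
     the other bound absorbs the factor [M], which is fixed by now. *)
  have q0 : 0 < Num.min 1 (e / 2 / (M%:R * Gm * L + 1)).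
    by rewrite lt_min ltr01/= divr_gt0.
  have epsk : eps (k n) @[n --> \oo] --> (0 : R).
    exact: (cvg_comp _ _ (subseq_cvg_infty hk) epsC).
  have /cvgrPdist_lt/(_ _ q0) := epsk => near_eps.
  near=> n; have N0 := k0 n.
  have nN1 : (N1 < k n)%N by near: n; exact: near_subseq.
  have : `|0 - eps (k n)| < Num.min 1 (e / 2 / (M%:R * Gm * L + 1)) by near: n.
  rewrite sub0r normrN gtr0_norm ?eps0// lt_min => /andP[eps1 epse].
  have epsL : eps (k n) * L <= L by rewrite ler_piMl// ltW.
  apply: le_trans (hNM (k n) rhobar (x (k n)) nN1 (tr N0) (w (k n)) (eps (k n) * L) _ _) _.
  + by rewrite mulr_ge0// ltW// eps0.
  + move=> i iN; have [w1 w2 w3] := hw (k n) i N0 iN; split => //.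
    by apply: le_trans w2 _; rewrite lerD2r.
  + have : M%:R * Gm * (eps (k n) * L) <= e / 2.
      rewrite mulrCA; apply: le_trans (_ : eps (k n) * (M%:R * Gm * L + 1) <= _).
        by rewrite ler_pM2l ?eps0// lerDl.
      by rewrite -ler_pdivlMr// ltW.
    lra.
- have lr := rho_limit aFG FGM.
  rewrite -[X in _ --> X]addr0.
  have -> : (fun n => \int[mu2]_z (cell_sum T (k n) (x (k n)) (f (k n)) z * G z)) =
    (fun n => \int[mu2]_z (rho_cells T x (k n) z * (Fx z * G z)) +
      (\int[mu2]_z (cell_sum T (k n) (x (k n)) (f (k n)) z * G z) -
       \int[mu2]_z (rho_cells T x (k n) z * (Fx z * G z)))).
    by apply/funext => n; rewrite addrC subrK.
  apply: cvgD lr _.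
  have FT0 : 0 <= Fm * T by rewrite mulr_ge0// ltW.
  apply: cvg_close0 => e e0; have e2 : 0 < e / 2 by rewrite divr_gt0.
  have [N1 hN1] := cell_sum_at_positions s S T0 L0 FT0 aG GM e2.
  have [N2 hN2] := cell_sum_at_positions s S T0 L0 (ltW T0) aFG FGM e2.
  near=> n; have N0 := k0 n.
  have nN1 : (N1 < k n)%N by near: n; exact: near_subseq.
  have nN2 : (N2 < k n)%N by near: n; exact: near_subseq.
  have h1 := hN1 (k n) rhobar (x (k n)) nN1 (tr N0) (f (k n)) (fun i iN => if_ (k n) i N0 iN).
  have h2 := hN2 (k n) rhobar (x (k n)) nN2 (tr N0) (fun _ _ => 1) (@unit_integrable (k n)).
  have E : \sum_(i < k n) \int[mu1]_(t in `]0, T[) (1 * (Fx (t, x (k n) i t) * G (t, x (k n) i t)))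
    = \sum_(i < k n) \int[mu1]_(t in `]0, T[) (f (k n) i t * G (t, x (k n) i t)).
    by apply: eq_bigr => i _; apply: eq_Rintegral => t _; rewrite mul1r.
  rewrite E -/(rho_cells T x (k n)) in h2.
  exact: (sub_close h1 h2).
Unshelve. all: by end_near. Qed.

End limits.

(** * Uniform and weak-star convergence *)

Lemma uniform_cvg_dist (R : realType) (A : set R) (f : nat -> R -> R) (g : R -> R) :
  (forall e, 0 < e -> \forall n \near \oo, forall t, A t -> `|g t - f n t| < e) ->
  {uniform A, f @ \oo --> g}.
Proof.
move=> h P /uniform_nbhs[E [+ EP]].
rewrite -entourage_ballE => -[e /= e0 eE]; have := h e e0.
by apply: filterS => n hn; apply: EP => y Ay; apply: eE; exact: hn.
Qed.

(** The common Lipschitz constant carries convergence from rational times to all times and, through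
    a finite grid, makes it uniform. Times are clamped because nothing is known outside [[0, T]]. *)
Lemma equilipschitz_uniform_cvg (R : realType) (T L : R) (f : nat -> R -> R) :
  0 < T -> 0 <= L ->
  (forall n (a b : R), a \in `[0, T] -> b \in `[0, T] ->
    `|f n a - f n b| <= L * `|a - b|) ->
  (forall q : rat, cvg (f n (clamp 0 T (ratr q)) @[n --> \oo])) ->
  exists2 g : R -> R, {uniform `[0, T], f @ \oo --> g} &
    (forall t, t \in `[0, T] -> f n t @[n --> \oo] --> g t) /\
    forall a b : R, a \in `[0, T] -> b \in `[0, T] ->
      `|g a - g b| <= L * `|a - b|.
Proof.
move=> T0 L0 fL fq; have L1 : 0 < L + 1 by rewrite ltr_wpDl.
have clampT (t : R) : clamp 0 T t \in `[0, T] by exact: clamp_itv (ltW T0).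
have ft t : t \in `[0, T] -> cvg (f n t @[n --> \oo]).
  move=> tT; apply: cvg_approx => e e0.
  have d0 : 0 < e / (L + 1) by rewrite divr_gt0.
  have [q] := @rat_in_itvoo R t (t + e / (L + 1)) (ltr_pwDr d0 (lexx t)).
  rewrite in_itv/= => /andP[tq qt].
  exists (fun n => f n (clamp 0 T (ratr q))) => // n.
  apply: le_trans (fL _ _ _ tT (clampT _)) _.
  rewrite -{1}(clamp_id tT).
  apply: (@le_trans _ _ ((L + 1) * (e / (L + 1)))); last first.
    by rewrite mulrCA divff ?mulr1 ?gt_eqF.
  apply: ler_pM => //; first by rewrite lerDl.
  apply: le_trans (clamp_lipschitz _ _ _ _) _.
  rewrite ler_norml; apply/andP; split; lra.
pose g t := lim (f n t @[n --> \oo]).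
have fg t : t \in `[0, T] -> f n t @[n --> \oo] --> g t by move=> /ft.
have gL (a b : R) : a \in `[0, T] -> b \in `[0, T] -> `|g a - g b| <= L * `|a - b|.
  move=> aT bT; have c : `|f n a - f n b| @[n --> \oo] --> `|g a - g b|.
    by apply: cvg_norm; apply: cvgB; exact: fg.
  rewrite -(cvg_lim _ c)//; apply: limr_le; last by near=> n; exact: fL.
  by apply/cvg_ex; exists `|g a - g b|.
exists g => //; apply: uniform_cvg_dist => e e0.
have e3 : 0 < e / 3 by rewrite divr_gt0.
pose d := e / (3 * (L + 1)); have d0 : 0 < d by rewrite divr_gt0// mulr_gt0.
have Ld : L * d <= e / 3.
  apply: (@le_trans _ _ ((L + 1) * d)); first by rewrite ler_pM2r// lerDl.
  by rewrite (_ : (L + 1) * d = e / 3)// /d; field; rewrite gt_eqF.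
have near_grid : \forall n \near \oo, forall j, (j < (Num.truncn (T / d)).+1)%N ->
    `|g (clamp 0 T (j%:R * d)) - f n (clamp 0 T (j%:R * d))| < e / 3.
  apply: near_forall_lt => j.
  by have /cvgrPdist_lt/(_ _ e3) := fg _ (clampT (j%:R * d)).
near=> n => t tT; have /andP[t0 tT'] : 0 <= t <= T by move: tT; rewrite /= in_itv.
have td0 : 0 <= t / d by rewrite divr_ge0// ltW.
pose j := Num.truncn (t / d).
have /andP[j1 j2] : j%:R <= t / d < j.+1%:R by exact: truncn_itv.
have jM : (j < (Num.truncn (T / d)).+1)%N.
  by rewrite ltnS; apply: le_truncn; rewrite ler_pM2r ?invr_gt0.
have tj : `|t - clamp 0 T (j%:R * d)| <= d.
  rewrite -{1}(clamp_id tT); apply: le_trans (clamp_lipschitz _ _ _ _) _.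
  move: j1 j2; rewrite ler_pdivlMr// ltr_pdivrMr// -natr1 mulrDl mul1r => j1 j2.
  by rewrite ger0_norm; lra.
have h1 : `|g (clamp 0 T (j%:R * d)) - f n (clamp 0 T (j%:R * d))| < e / 3.
  by move: j jM {j1 j2 tj}; near: n.
have h2 : `|g t - g (clamp 0 T (j%:R * d))| <= e / 3.
  by apply: le_trans (gL _ _ tT (clampT _)) _; apply: le_trans Ld; rewrite ler_wpM2l.
have h3 : `|f n t - f n (clamp 0 T (j%:R * d))| <= e / 3.
  by apply: le_trans (fL n _ _ tT (clampT _)) _; apply: le_trans Ld; rewrite ler_wpM2l.
move: h1 h2 h3; rewrite ltr_norml !ler_norml => /andP[a1 a2] /andP[b1 b2] /andP[c1 c2].
by rewrite ltr_norml; apply/andP; split; lra.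
Unshelve. all: by end_near. Qed.

Lemma Lnorm_infty_le (d : measure_display) (X : measurableType d) (R : realType)
    (mu : {measure set X -> \bar R}) (M : R) (f : X -> R) : 0 <= M ->
  (forall z, `|f z| <= M) -> ('N[mu]_+oo[EFin \o f] <= M%:E)%E.
Proof.
move=> M0 fM; rewrite unlock /=; case: ifP => _; last by rewrite lee_fin.
by apply/ess_supP; apply: nearW => z /=; rewrite lee_fin.
Qed.

Lemma bounded_Lfun_infty (d : measure_display) (X : measurableType d)
    (R : realType) (mu : {measure set X -> \bar R}) (M : R) (f : X -> R) :
  0 <= M -> measurable_fun setT f -> (forall z, `|f z| <= M) ->
  f \in Lfun mu +oo%E.
Proof.
move=> M0 mf fM; rewrite inE; apply/andP; split; rewrite inE//=.
exact: le_lt_trans (Lnorm_infty_le _ M0 fM) (ltry _).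
Qed.

Lemma restrict_id (X : Type) (R : realType) (D : set X) (f : X -> R) :
  (forall z, ~ D z -> f z = 0) -> f \_ D = f.
Proof.
move=> fD; apply/funext => z; rewrite patchE; case: ifPn => //.
by rewrite notin_setE => /fD ->.
Qed.

(** The interpolants [v] agree with the cell sums [u] only on [E]; elsewhere [u] vanishes while [v]
    is arbitrary, and the weak-star statement sees [E] alone. *)
Lemma weakstar_density_limit (d : measure_display) (X : measurableType d)
    (R : realType) (mu : {measure set X -> \bar R}) (D E : set X) (M : R)
    (u v : nat -> X -> R) (f : X -> R) : 0 <= M -> measurable E -> D `<=` E ->
  (forall n, measurable_fun setT (u n)) -> (forall n z, 0 <= u n z <= M) ->
  (forall n z, ~ D z -> u n z = 0) -> (forall n z, E z -> v n z = u n z) ->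
  density_limit_of mu D M u f -> weakstar_Linfty mu E v f.
Proof.
move=> M0 mE DE mu_ uM uD vu [mf fM fD intf conv].
have bM (w : X -> R) : (forall z, 0 <= w z <= M) -> forall z, `|w z| <= M.
  by move=> h z; have /andP[h1 h2] := h z; rewrite ger0_norm.
have uE n z : ~ E z -> u n z = 0 by move=> nE; apply: uD => /DE.
have fE z : ~ E z -> f z = 0 by move=> nE; apply: fD => /DE.
split.
- move=> n; rewrite /Linfty_on (_ : v n \_ E = u n); first exact:
    (bounded_Lfun_infty mu M0 (mu_ n) (bM _ (uM n))).
  rewrite -(restrict_id (uE n)); apply/funext => z; rewrite !patchE.
  by case: ifPn => //; rewrite inE => /vu.
- by rewrite /Linfty_on restrict_id//; exact: (bounded_Lfun_infty mu M0 mf (bM _ fM)).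
- move=> g ig; have ig' : mu.-integrable setT (EFin \o (g \_ E)).
    by rewrite -restrict_EFin; apply/(integrable_mkcond _ mE).
  have key (w : X -> R) : measurable_fun setT w -> (forall z, 0 <= w z <= M) ->
      (\int[mu]_(z in E) (w z * g z)%:E = (\int[mu]_z (w z * (g \_ E) z))%:E)%E.
    move=> mw wM; have iw : mu.-integrable setT (EFin \o (fun z => w z * (g \_ E) z)).
      by apply: (integrableZr measurableT mw) => // z _; exact: (bM _ wM).
    rewrite /Rintegral fineK; last exact: integrable_fin_num.
    rewrite integral_mkcond; apply: eq_integral => z _.
    by rewrite !patchE; case: ifPn => // _; rewrite mulr0.
  rewrite key//.
  have -> : (fun n => \int[mu]_(z in E) (v n z * g z)%:E)%E =
      (fun n => (\int[mu]_z (u n z * (g \_ E) z))%:E).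
    apply/funext => n; rewrite -key//; apply: eq_integral => z /set_mem zE.
    by rewrite vu.
  by apply: cvg_EFin; [exact: nearW|exact: conv].
Qed.

(** * Supports of the limits *)

Lemma open_setX (X Y : topologicalType) (A : set X) (B : set Y) :
  open A -> open B -> open (A `*` B).
Proof.
move=> oA oB; rewrite openE => -[a b] [/= Aa Bb].
by exists (A, B) => //; split; exact: open_nbhs_nbhs.
Qed.

(** The indicator of [U] inside [D] is integrable; testing with it gives a nonnegative function with
    integral 0. *)
Lemma density_limit_eq0 (d : measure_display) (X : measurableType d)
    (R : realType) (mu : {measure set X -> \bar R}) (D U : set X) (M : R)
    (u : nat -> X -> R) (f : X -> R) : measurable D -> (mu D < +oo)%E ->
  measurable U -> density_limit_of mu D M u f ->
  (\forall n \near \oo, forall z, U z -> u n z = 0) ->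
  {ae mu, forall z, U z -> f z = 0}.
Proof.
move=> mD muD mU [mf fM fD _ conv] uU.
have mUD : measurable (U `&` D) by exact: measurableI.
have g_int : mu.-integrable setT (EFin \o \1_(U `&` D)).
  apply: integrable_indic_fin => //; apply: le_lt_trans muD.
  by apply: le_measure; rewrite ?inE//; exact: subIsetr.
have fg_int : mu.-integrable setT (EFin \o (fun z => f z * \1_(U `&` D) z)).
  apply: (@integrableZr _ _ _ _ f _ M setT measurableT mf) => // z _.
  by have /andP[f0 f1] := fM z; rewrite ger0_norm.
have I0 : \int[mu]_z (f z * \1_(U `&` D) z) = 0.
  apply: (cvg_unique _ (conv _ g_int)) => //; apply: cvg_near_cst.
  apply: filterS uU => n hn; rewrite /Rintegral integral0_eq// => z _.
  rewrite indicE; case: (boolP (_ \in _)) => [|_]; last by rewrite mulr0.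
  by rewrite inE => -[/hn -> _]; rewrite mul0r.
pose w z := f z * \1_(U `&` D) z.
have I0' : (\int[mu]_z `|(EFin \o w) z| = 0)%E.
  transitivity (\int[mu]_z (EFin \o w) z)%E.
    apply: eq_integral => z _ /=; have /andP[f0 _] := fM z.
    by rewrite ger0_norm// mulr_ge0.
  by rewrite -(fineK (integrable_fin_num measurableT fg_int)) -/(Rintegral _ _ _) I0.
have [/(_ I0') h _] := ae_eq_integral_abs mu measurableT (measurable_int _ fg_int).
apply: filterS h => z /= h Uz.
have [Dz|nDz] := pselect (D z); last exact: fD.
by have := h I; rewrite indicE mem_set// mulr1 => -[].
Qed.

Lemma cell_sum_eq0 (R : realType) (T s S L rhobar : R) (N : nat)
    (x : nat -> R -> R) (h : nat -> R -> R) (z : R * R) :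
  trajectories T s S L rhobar N x ->
  (z.1 \in `]0, T[ -> ~ (x 0%N z.1 <= z.2 < x N z.1)) ->
  cell_sum T N x h z = 0.
Proof.
move=> tr hz; apply: cell_sum_out => i iN [zT /andP[h1 h2]]; apply: (hz zT).
have tT := itv_oocc zT.
rewrite (le_trans _ h1) ?(traj_le tr)//=; last exact: ltnW.
by apply: lt_le_trans h2 _; exact: (traj_le tr iN).
Qed.

Section supports.
Context (R : realType) (T s S L rhobar M : R) (x : nat -> nat -> R -> R).
Context (L0 : 0 <= L)
  (tr : forall N, (0 < N)%N -> trajectories T s S L rhobar N (x N)).
Context (k : nat -> nat) (k0 : forall n, (0 < k n)%N) (xlow xhigh : R -> R)
  (clow : forall t, t \in `[0, T] -> x (k n) 0%N t @[n --> \oo] --> xlow t)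
  (chigh : forall t, t \in `[0, T] -> x (k n) (k n) t @[n --> \oo] --> xhigh t).

Local Notation mu2 := (leb2 R).

(** Around a point outside the region the cell sums eventually vanish on a whole neighbourhood:
    either its time is outside [[0, T]], or by the common Lipschitz bound the rearmost vehicle stays
    ahead of it, or the leader behind it. *)
Lemma ess_supp_between (h : nat -> nat -> R -> R) (f : R * R -> R) :
  density_limit_of mu2 (spacetime_box T s S) M
    (fun n => cell_sum T (k n) (x (k n)) (h (k n))) f ->
  ess_supp (almost_everywhere mu2) f `<=`
    [set z : R * R | z.1 \in `[0, T] /\ xlow z.1 <= z.2 <= xhigh z.1].
Proof.
move=> lim_f [t y] supp_z; apply: contrapT => out.
have vanish (U : set (R * R)) : open U -> U (t, y) ->
    (\forall n \near \oo, forall z, U z ->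
       cell_sum T (k n) (x (k n)) (h (k n)) z = 0) -> False.
  move=> oU Uz hU; apply: (supp_z U oU Uz).
  exact: (density_limit_eq0 (measurable_spacetime_box T s S)
    (spacetime_box_fin T s S) (open_measurable2 oU) lim_f hU).
have [tT|ntT] := boolP (t \in `[0, T]); last first.
  apply: (vanish (~` `[0, T]%classic `*` setT)).
  - apply: open_setX; last exact: openT.
    by apply: closed_openC; exact: interval_closed.
  - by split => //=; apply/negP.
  - apply: nearW => n z [zT _]; apply: (cell_sum_eq0 _ (tr (k0 n))) => z01.
    by exfalso; apply: zT; exact: itv_oocc.
have Lr d (t' : R) n i : 0 < d -> (i <= k n)%N -> t' \in `[0, T] ->
    `|t - t'| < d / (L + 1) -> `|x (k n) i t - x (k n) i t'| <= d.
  move=> d0 iN t'T; have L1 : 0 < L + 1 by rewrite ltr_wpDl.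
  rewrite ltr_pdivlMr// => h1.
  apply: le_trans (traj_lipschitz (tr (k0 n)) iN tT t'T) _.
  have := normr_ge0 (t - t'); move: `|t - t'| h1 => c; nra.
pose U (d : R) := ball t (d / (L + 1)) `*` ball y d.
have oU d : 0 < d -> open (U d) by move=> d0; apply: open_setX; exact: ball_open.
have Uty d : 0 < d -> U d (t, y).
  by move=> d0; split; apply: ballxx => //; rewrite divr_gt0// ltr_wpDl.
have : ~ (xlow t <= y) \/ ~ (y <= xhigh t).
  by apply/not_andP => -[h1 h2]; apply: out; split => //=; rewrite h1.
case=> /negP; rewrite -ltNge => hy.
(* A third of the distance for the convergence at time [t], a third for the motion between [t] and
   [t'], a third for the size of the neighbourhood in space. *)
- pose d := (xlow t - y) / 3; have d0 : 0 < d by rewrite divr_gt0// subr_gt0.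
  apply: (vanish (U d)) => //; first exact: oU; first exact: Uty.
  have /cvgrPdist_lt/(_ _ d0) near_x := clow tT.
  near=> n => -[t' y'] [/= tt' yy']; apply: (cell_sum_eq0 _ (tr (k0 n))) => /= t'T.
  move=> /andP[x0y _]; have h1 := Lr d t' n 0%N d0 (leq0n _) (itv_oocc t'T) tt'.
  have h2 : `|xlow t - x (k n) 0%N t| < d by near: n.
  move: yy' h1 h2; rewrite /ball/= !(ltr_norml, ler_norml).
  move=> /andP[a1 a2] /andP[b1 b2] /andP[c1 c2]; move: d0 a1 a2 b1 b2 c1 c2; rewrite /d; lra.
- pose d := (y - xhigh t) / 3; have d0 : 0 < d by rewrite divr_gt0// subr_gt0.
  apply: (vanish (U d)) => //; first exact: oU; first exact: Uty.
  have /cvgrPdist_lt/(_ _ d0) near_x := chigh tT.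
  near=> n => -[t' y'] [/= tt' yy']; apply: (cell_sum_eq0 _ (tr (k0 n))) => /= t'T.
  move=> /andP[_ xNy]; have h1 := Lr d t' n (k n) d0 (leqnn _) (itv_oocc t'T) tt'.
  have h2 : `|xhigh t - x (k n) (k n) t| < d by near: n.
  move: yy' h1 h2; rewrite /ball/= !(ltr_norml, ler_norml).
  move=> /andP[a1 a2] /andP[b1 b2] /andP[c1 c2]; move: d0 a1 a2 b1 b2 c1 c2; rewrite /d; lra.
Unshelve. all: by end_near. Qed.

End supports.

Lemma ess_supp_closed (X : topologicalType) (R : realType) (ae : set_system X)
  (f : X -> R) : closed (ess_supp ae f).
Proof.
rewrite -openC openE => z; rewrite /ess_supp/= => /existsNP[U].
move=> /not_implyP[oU /not_implyP[Uz /contrapT fU]].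
apply: filterS (open_nbhs_nbhs (conj oU Uz)) => w Uw; apply/existsNP; exists U.
by do 2 (apply/not_implyP; split => //); apply/contrapT.
Qed.

Lemma ess_supp_sub (X : topologicalType) (R : realType) (ae : set_system X)
    {FF : Filter ae} (f : X -> R) (D : set X) :
  closed D -> (forall z, ~ D z -> f z = 0) -> ess_supp ae f `<=` D.
Proof.
move=> cD fD z supp; apply: contrapT => nD.
by apply: (supp (~` D)) => //; [exact: closed_openC|apply: filterE => w /fD].
Qed.

(** * The flux quotient as a measure on the closed strip *)

Section flux_measures.
Context (R : realType) (T s S L rhobar : R) (N : nat) (x : nat -> R -> R)
  (theta : R -> R).
Context (T0 : 0 < T) (N0 : (0 < N)%N) (tr : trajectories T s S L rhobar N x).

Local Notation mu1 := (leb1 R).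
Local Notation mu2 := (leb2 R).

Let flux z := e1_interp T N x z / theta (rho_interp N x z).
Let q i t := vel T x i t / theta (density N x i t).

(** Unlike the formula with cell sums, this one holds up to the times 0 and [T], which belong to the
    strip carrying the measures. A jammed cell at time 0 contributes 0 on both sides, by the
    convention on division by zero. *)
Lemma flux_stepE t y : t \in `[0, T] -> flux (t, y) =
  \sum_(i < N) density N x i t * vel T x i t / theta (density N x i t) *
    \1_(`[x i t, x i.+1 t[%classic) y.
Proof.
move=> tT; rewrite /flux /e1_interp /rho_interp /= -/(vel T x _ _).
have [[i yi]|ny] := pselect (exists i : 'I_N, x i t <= y < x i.+1 t).
  have sumE (h : nat -> R) : \sum_(j < N) h j * \1_(`[x j t, x j.+1 t[%classic) y = h i.
    rewrite (bigD1 i)//= big1 => [|j ji].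
      by rewrite addr0 indicE mem_set ?mulr1//= in_itv.
    rewrite indicE memNset ?mulr0//= in_itv/= => yj.
    move: ji; rewrite -val_eqE/= neq_ltn => /orP[ji|ij].
      have := traj_le tr ji (ltnW (ltn_ord i)) tT.
      by move: yi yj => /andP[h1 _] /andP[_ h2] h3;
        have := lt_le_trans h2 (le_trans h3 h1); rewrite ltxx.
    have := traj_le tr ij (ltnW (ltn_ord j)) tT.
    by move: yi yj => /andP[_ h1] /andP[h2 _] h3;
      have := lt_le_trans h1 (le_trans h3 h2); rewrite ltxx.
  rewrite (sumE (fun j => density N x j t)).
  rewrite (sumE (fun j => density N x j t * deriv_in `[0, T]%classic (x j) t)).
  by rewrite (sumE (fun j => density N x j t * vel T x j t / theta (density N x j t))).
rewrite big1 ?mul0r => [|j _].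
  rewrite big1// => j _; rewrite indicE memNset ?mulr0//= in_itv/= => yj.
  by apply: ny; exists j.
rewrite indicE memNset ?mulr0//= in_itv/= => yj.
by apply: ny; exists j.
Qed.

Lemma flux_supp z : strip T z -> ~ (z.2 \in `[s, S]) -> flux z = 0.
Proof.
case: z => t y [/= tT _] ny; rewrite flux_stepE// big1// => i _.
rewrite indicE memNset ?mulr0//= in_itv/= => /andP[h1 h2]; apply: ny.
have := traj_itv tr (ltnW (ltn_ord i)) tT; have := traj_itv tr (ltn_ord i) tT.
rewrite !in_itv/= => /andP[_ xS] /andP[sx _].
by rewrite (le_trans sx h1)/= (le_trans (ltW h2) xS).
Qed.

(** The lines of the closed strip on which cell sums vanish while the flux need not; they form a
    null set. *)
Definition sides : set (measurableTypeR R * measurableTypeR R) :=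
  ([set 0] `|` [set T]) `*` setT.

Lemma measurable_sides : measurable sides.
Proof. by apply: measurableX => //; apply: measurableU. Qed.

Lemma measurable_strip :
  measurable (strip T : set (measurableTypeR R * measurableTypeR R)).
Proof. by apply: measurableX => //; exact: measurable_itv. Qed.

Lemma measurable_open_strip :
  measurable (open_strip T : set (measurableTypeR R * measurableTypeR R)).
Proof. by apply: measurableX => //; exact: measurable_itv. Qed.

Lemma sides_eq0 : mu2 sides = 0%E.
Proof.
rewrite /sides product_measure1E//; last exact: measurableU.
rewrite [X in (X * _)%E](_ : _ = 0%E) ?mul0e//; apply/eqP; rewrite eq_le measure_ge0 andbT.
apply: (@le_trans _ _ (mu1 [set (0%R : R)] + mu1 [set T])%E); first exact: measureU2.
by rewrite !lebesgue_measure_set1 adde0.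
Qed.

Lemma stripD : strip T `\` sides = open_strip T.
Proof.
apply/seteqP; split => -[t y] /=.
  move=> [[/= + _] nt]; rewrite /= !in_itv/= => /andP[t0 tT]; split => //=.
  rewrite in_itv/= !lt_neqAle t0 tT !andbT; apply/andP; split; apply/eqP => h.
    by apply: nt; split => //; left.
  by apply: nt; split => //; right.
move=> [/= tT _]; split; first by split => //=; exact: itv_oocc.
move=> [/= [h|h] _]; move: tT; rewrite h in_itv/= ltxx//.
by rewrite andbF.
Qed.

Lemma strip_sides : strip T = open_strip T `|` sides.
Proof.
rewrite -stripD setUC setDUK// => -[t y] [/= [->|->] _]; split => //=.
  by rewrite in_itv/= lexx ltW.
by rewrite in_itv/= lexx ltW.
Qed.

Lemma flux_measurable : (forall i, (i < N)%N ->
    mu1.-integrable `]0, T[%classic (EFin \o q i)) ->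
  measurable_fun (strip T : set (measurableTypeR R * measurableTypeR R)) flux.
Proof.
move=> iq; have iqs := measurable_cell_sum N0 tr iq.
have mo := measurable_open_strip.
have ml t : measurable ([set t] `*` setT : set (measurableTypeR R * measurableTypeR R)).
  exact: measurableX.
(* That the sides are null does not settle measurability; on each of them the flux is an explicit
   step function of the position. *)
have line t : t \in `[0, T] -> measurable_fun
    ([set t] `*` setT : set (measurableTypeR R * measurableTypeR R)) flux.
  move=> tT; apply: (@eq_measurable_fun _ _ _ _ _ (fun z => \sum_(i < N)
    density N x i t * vel T x i t / theta (density N x i t) *
    \1_(`[x i t, x i.+1 t[%classic) z.2)).
    by move=> [t' y] /set_mem[/= -> _]; rewrite flux_stepE.
  apply: measurable_funTS; apply: measurable_sum => i.
  apply: measurable_funM; first exact: measurable_cst.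
  by apply: measurableT_comp; [exact: measurable_indic_co|exact: measurable_snd].
rewrite strip_sides; apply/measurable_funU => //; first exact: measurable_sides.
split.
  apply: (@eq_measurable_fun _ _ _ _ _ (cell_sum T N x q)).
    by move=> z /set_mem[zT _]; rewrite /flux (flux_quotientE tr).
  apply: measurable_funTS; apply/measurable_EFinP.
  exact: measurable_int iqs.
rewrite (_ : sides = [set 0] `*` setT `|` [set T] `*` setT); last first.
  by apply/seteqP; split => [[t y] [[/= ->|/= ->] _]|[t y] [[/= -> _]|[/= -> _]]];
    [left|right|split => //; left|split => //; right].
apply/measurable_funU => //.
by split; apply: line; rewrite in_itv/= lexx ltW.
Qed.

Lemma flux_integrable : (forall i, (i < N)%N ->
    mu1.-integrable `]0, T[%classic (EFin \o q i)) ->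
  mu2.-integrable (strip T) (EFin \o flux).
Proof.
move=> iq; have iqs := measurable_cell_sum N0 tr iq.
apply/(negligible_integrable measurable_sides measurable_strip _ sides_eq0).
  by apply/measurable_EFinP; exact: flux_measurable.
have mo := measurable_open_strip.
rewrite stripD; apply: (eq_integrable mo (EFin \o cell_sum T N x q)).
- by move=> z /set_mem[zT _] /=; rewrite /flux (flux_quotientE tr).
- exact: integrableS iqs.
Qed.

(** Two exchanges: [psi] gives way to its extension because the flux vanishes outside [[s, S]], and
    the flux to the cell sum once the null sides are removed. *)
Lemma flux_integral (psi : R * R -> R) : s <= S ->
  (forall i, (i < N)%N -> mu1.-integrable `]0, T[%classic (EFin \o q i)) ->
  {within strip T, continuous psi} ->
  (\int[mu2]_(z in strip T) (psi z * flux z)%:E =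
   (\int[mu2]_z (cell_sum T N x q z * box_ext T s S psi z))%:E)%E.
Proof.
move=> sS iq cpsi; have iqs := measurable_cell_sum N0 tr iq.
have aG := box_ext_almost_lip (ltW T0) sS cpsi.
have mG := measurable_almost_lip aG.
have [M M0 GM] := box_ext_bounded (ltW T0) sS cpsi.
have ic := integrableZr measurableT mG (fun z _ => GM z) iqs.
have iG := integrableZr measurable_strip (measurable_funTS mG) (fun z _ => GM z)
  (flux_integrable iq).
transitivity (\int[mu2]_(z in strip T) (box_ext T s S psi z * flux z)%:E)%E.
  apply: eq_integral => -[t y] /set_mem tyT; have [/= tT _] := tyT.
  have [yS|ny] := boolP (y \in `[s, S]); first by rewrite box_extE.
  by rewrite (flux_supp tyT) ?mulr0//; exact/negP.
rewrite (negligible_integral measurable_sides measurable_strip iG sides_eq0) stripD.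
rewrite /Rintegral fineK; last first.
  apply: integrable_fin_num => //; apply: eq_integrable ic => // z _ /=.
  by rewrite mulrC.
rewrite integral_mkcond; apply: eq_integral => z _; rewrite patchE; case: ifPn.
  by move=> /set_mem[zT _]; rewrite /flux/= (flux_quotientE tr)// mulrC.
rewrite notin_setE => nz; rewrite (cell_sum_supp tr) ?mul0r// => -[z1 _].
by apply: nz; split.
Qed.

End flux_measures.

(** * From the planar limits to the stated convergences *)

Lemma box_ext_on_box (R : realType) (T s S : R) (f G : R * R -> R) (t y : R) :
  (forall z, ~ spacetime_box T s S z -> f z = 0) ->
  f (t, y) * G (t, y) = f (t, y) * box_ext T s S G (t, y).
Proof.
move=> fD; have [[/= tT yS]|nD] := pselect (spacetime_box T s S (t, y)).
  by rewrite box_extE//; exact: itv_oocc.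
by rewrite fD// !mul0r.
Qed.

(** Fubini's theorem returns from planar to iterated integrals. Test functions are arbitrary far
    away in space, but the limits vanish off the box, and inside it the derivatives of [phi] agree
    with their extensions. *)
Lemma transport_solution_limit (R : realType) (T s S M0 M1 M2 : R)
    (u0 : nat -> R -> R) (u1 u2 : nat -> R * R -> R)
    (rho0 : R -> R) (rho e1 : R * R -> R) : 0 < T -> s <= S ->
  density_limit_of (leb1 R) (space_box s S) M0 u0 rho0 ->
  density_limit_of (leb2 R) (spacetime_box T s S) M1 u1 rho ->
  density_limit_of (leb2 R) (spacetime_box T s S) M2 u2 e1 ->
  (forall phi, C1_strip T phi -> (forall y, phi (T, y) = 0) ->
    \int[leb2 R]_z (rho z * box_ext T s S (partial_t T phi) z) +
    \int[leb2 R]_z (e1 z * box_ext T s S (partial_x phi) z) =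
    - \int[leb1 R]_y (rho0 y * box_ext T s S phi (0, y))) ->
  transport_solution T rho0 rho e1.
Proof.
move=> T0 sS [m0 b0 D0 i0 _] [m1 b1 D1 i1 _] [m2 b2 D2 i2 _] id phi C1 phiT.
have := id phi C1 phiT; have [cphi _ ct cx] := C1.
have ap := box_ext_almost_lip (ltW T0) sS cphi.
have at_ := box_ext_almost_lip (ltW T0) sS ct.
have ax := box_ext_almost_lip (ltW T0) sS cx.
have [Mp Mp0 hMp] := box_ext_bounded (ltW T0) sS cphi.
have [Mt Mt0 hMt] := box_ext_bounded (ltW T0) sS ct.
have [Mx Mx0 hMx] := box_ext_bounded (ltW T0) sS cx.
set bt := box_ext T s S (partial_t T phi); set bx := box_ext T s S (partial_x phi).
set bp := box_ext T s S phi => idphi.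
have it : (leb2 R).-integrable setT (EFin \o (fun z => rho z * bt z)).
  have := integrableZr measurableT (measurable_almost_lip at_) (fun z _ => hMt z) i1.
  by apply: eq_integrable => // z _ /=; rewrite mulrC.
have ix : (leb2 R).-integrable setT (EFin \o (fun z => e1 z * bx z)).
  have := integrableZr measurableT (measurable_almost_lip ax) (fun z _ => hMx z) i2.
  by apply: eq_integrable => // z _ /=; rewrite mulrC.
have mbp : measurable_fun setT (fun y : measurableTypeR R => bp (0, y)).
  apply: measurable_realfun.continuous_measurable_fun.
  exact: continuous_slice (almost_lip_continuous ap).
have ip : (leb1 R).-integrable setT (EFin \o (fun y => rho0 y * bp (0, y))).
  have := integrableZr measurableT mbp (fun y _ => hMp (0, y)) i0.
  by apply: eq_integrable => // z _ /=; rewrite mulrC.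
have ih : (leb2 R).-integrable setT (EFin \o (fun z => rho z * bt z + e1 z * bx z)).
  by have := integrableD measurableT it ix; apply: eq_integrable.
transitivity (\int[leb2 R]_z (EFin \o (fun z => rho z * bt z + e1 z * bx z)%R) z)%E.
  apply: etrans (integral12_prod_meas1 ih).
  rewrite integral_mkcond; apply: eq_integral => t _.
  rewrite patchE; case: ifPn => tT.
    by apply: eq_integral => y _ /=; rewrite (box_ext_on_box _ _ _ D1) (box_ext_on_box _ _ _ D2).
  rewrite /fubini_F integral0_eq// => y _ /=.
  have nD : ~ spacetime_box T s S (t, y).
    by move=> [/= h _]; move: tT; rewrite mem_set.
  by rewrite D1// D2// !mul0r addr0.
rewrite -(fineK (integrable_fin_num measurableT ih)) -/(Rintegral _ _ _).
rewrite RintegralD// idphi EFinN; congr (- _)%E.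
rewrite /Rintegral fineK; last exact: integrable_fin_num.
apply: eq_integral => y _ /=; have [yS|ny] := pselect (space_box s S y).
  by rewrite /bp box_extE// in_itv/= lexx ltW.
by rewrite D0// !mul0r.
Qed.

Lemma weakstar_flux (R : realType) (T s S L rhobar gamma Fm : R) (eps : nat -> R)
    (theta : R -> R) (F : R * R -> R) (x : nat -> nat -> R -> R) (k : nat -> nat)
    (rho : R * R -> R) :
  0 < T -> 0 <= L -> s <= S -> 0 < gamma -> 0 <= Fm ->
  (forall N, (0 < N)%N -> 0 < eps N) -> eps @ \oo --> (0 : R) ->
  {within strip T, continuous F} -> (forall z, `|box_ext T s S F z| <= Fm) ->
  (forall N, (0 < N)%N -> trajectories T s S L rhobar N (x N)) ->
  (forall N i, (0 < N)%N -> (i < N)%N ->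
    let w t := gamma * (vel T (x N) i t / theta (density N (x N) i t))
               - box_ext T s S F (t, x N i t) in
    [/\ (leb1 R).-integrable `]0, T[%classic (EFin \o w),
      \int[leb1 R]_(t in `]0, T[) `|w t| <= eps N * L + 2 * Fm * T &
      forall a b : R, 0 <= a -> a < b -> b <= T ->
        `|\int[leb1 R]_(t in `]a, b[) w t| <= eps N * L]) ->
  (forall n, (0 < k n)%N) -> {homo k : m n / (m < n)%N} ->
  density_limit_of (leb2 R) (spacetime_box T s S) rhobar
    (fun n => rho_cells T x (k n)) rho ->
  weakstar_measures T
    (fun n z => e1_interp T (k n) (x (k n)) z / theta (rho_interp (k n) (x (k n)) z))
    (fun z => gamma^-1 * (rho z * F z)).
Proof.
move=> T0 L0 sS g0 Fm0 eps0 epsC cF FM tr hw k0 hk lim_rho.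
have aF := box_ext_almost_lip (ltW T0) sS cF.
have [mrho rhoM rhoD irho _] := lim_rho.
(* The quotient is recovered as [gamma^-1 (w + F)] from an integrable function and a bounded one. *)
have iq N i : (0 < N)%N -> (i < N)%N -> (leb1 R).-integrable `]0, T[%classic
    (EFin \o (fun t => vel T (x N) i t / theta (density N (x N) i t))).
  move=> N0 iN; have [iw _ _] := hw N i N0 iN.
  have i1 : (leb1 R).-integrable `]0, T[%classic
      (EFin \o (fun t => 1 * box_ext T s S F (t, x N i t))).
    exact: (integrable_along aF FM (tr N N0) (ltnW iN) (integrable_cst_itv _ _ _)).
  have mI : measurable (`]0, T[%classic : set (measurableTypeR R)) by exact: measurable_itv.
  have := integrableZl mI gamma^-1 (integrableD mI iw i1).
  apply: eq_integrable => // t _ /=.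
  by rewrite -EFinD -EFinM mul1r subrK mulKf// gt_eqF.
have mK (K : set (R * R)) : compact K ->
    measurable (K : set (measurableTypeR R * measurableTypeR R)).
  move=> cK; rewrite -(setCK K); apply: measurableC; apply: open_measurable2.
  by apply: closed_openC; apply: compact_closed => //; exact: norm_hausdorff.
have rhoF (z : R * R) : rho z * F z = rho z * box_ext T s S F z.
  by case: z => t y; exact: box_ext_on_box.
have irF : (leb2 R).-integrable setT (EFin \o (fun z => gamma^-1 * (rho z * F z))).
  have i1 := integrableZr measurableT (measurable_almost_lip aF) (fun z _ => FM z) irho.
  have := integrableZl measurableT gamma^-1 i1.
  by apply: eq_integrable => // z _ /=; rewrite rhoF -EFinM [rho z * _]mulrC.
split.
- move=> n K cK KT; apply: (integrableS (measurable_strip T) (mK K cK) KT).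
  exact: (flux_integrable T0 (k0 n) (tr _ (k0 n)) (fun i => iq _ i (k0 n))).
- by move=> K cK _; apply: integrableS irF => //; exact: mK.
move=> psi [cpsi _].
have aG := box_ext_almost_lip (ltW T0) sS cpsi.
have [Gm Gm0 GM] := box_ext_bounded (ltW T0) sS cpsi.
have cFpsi : {within strip T, continuous (fun z => F z * psi z)}.
  by move=> z; apply: cvgM; [exact: cF|exact: cpsi].
(* The extension of a product is the product of the extensions. *)
have aFG : almost_lip (fun z => box_ext T s S F z * box_ext T s S psi z).
  exact: (box_ext_almost_lip (ltW T0) sS cFpsi).
have -> : (fun n => \int[leb2 R]_(z in strip T) (psi z * (e1_interp T (k n) (x (k n)) z
      / theta (rho_interp (k n) (x (k n)) z))%R)%:E)%E =
    (fun n => (\int[leb2 R]_z (cell_sum T (k n) (x (k n))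
      (fun i t => vel T (x (k n)) i t / theta (density (k n) (x (k n)) i t)) z
      * box_ext T s S psi z))%:E).
  by apply/funext => n; exact: (flux_integral T0 (k0 n) (tr _ (k0 n)) sS
    (fun i => iq _ i (k0 n)) cpsi).
have -> : (\int[leb2 R]_(z in strip T) (psi z * (gamma^-1 * (rho z * F z))%R)%:E =
    (gamma^-1 * \int[leb2 R]_z (rho z * (box_ext T s S F z * box_ext T s S psi z)))%:E)%E.
  have FGM z : `|box_ext T s S F z * box_ext T s S psi z| <= Fm * Gm.
    by rewrite normrM ler_pM.
  have i2 : (leb2 R).-integrable setT
      (EFin \o (fun z => rho z * (box_ext T s S F z * box_ext T s S psi z))).
    have := integrableZr measurableT (measurable_almost_lip aFG) (fun z _ => FGM z) irho.
    by apply: eq_integrable => // z _ /=; rewrite mulrC.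
  rewrite EFinM /Rintegral fineK; last exact: integrable_fin_num.
  rewrite -integralZl// [LHS]integral_mkcond; apply: eq_integral => -[t y] _.
  rewrite patchE -EFinM; case: ifPn => [_|ny].
    have -> : psi (t, y) * (gamma^-1 * (rho (t, y) * F (t, y))) =
        gamma^-1 * (rho (t, y) * F (t, y) * psi (t, y)) by ring.
    by rewrite rhoF mulrAC (box_ext_on_box _ _ _ rhoD) mulrAC -mulrA.
  rewrite rhoD ?mul0r ?mulr0// => -[/= tT _]; move: ny; rewrite notin_setE; apply.
  by split => //; exact: itv_oocc.
apply: cvg_EFin; first exact: nearW.
exact: (flux_limit T0 L0 tr k0 hk lim_rho g0 Fm0 (ltW Gm0) aF aG aFG FM GM eps0 epsC hw).
Qed.

Theorem theorem2p14 (R : realType) (T gamma : R) (eps : nat -> R)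
    (rhobar : R) (theta : R -> R) (F : R * R -> R)
    (s S C0 : R) (x0 v0 : nat -> nat -> R) (x : nat -> nat -> R -> R)
    (hT : 0 < T) (hgamma : 0 < gamma)
    (heps : forall N, (0 < N)%N -> 0 < eps N) (heps0 : eps @ \oo --> (0 : R))
    (hnl : nonlinearities T rhobar theta F)
    (hs : 0 < s) (hS : 0 < S) (hC0 : 0 < C0)
    (hdata : forall N, (0 < N)%N ->
      admissible_data T rhobar s S C0 N (x0 N) (v0 N) (x N N))
    (hsol : forall N, (0 < N)%N ->
      micro_solution T gamma (eps N) rhobar theta F N (x0 N) (v0 N) (x N))
    (hspeed : forall N, (0 < N)%N ->
      speed_bounded T gamma rhobar theta F N (x0 N) (v0 N) (x N)) :
  exists (k : nat -> nat) (xlow xhigh rho0 : R -> R) (rho e1 : R * R -> R),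
    [/\ (forall n, (0 < k n)%N) /\ {homo k : m n / (m < n)%N},
        [/\ {uniform `[0, T], (fun n => x (k n) 0%N) @ \oo --> xlow} /\
            {uniform `[0, T], (fun n => x (k n) (k n)) @ \oo --> xhigh},
            weakstar_Linfty (leb1 R) setT
              (fun n y => rho_interp (k n) (x (k n)) (0, y)) rho0,
            weakstar_Linfty (leb2 R) (open_strip T)
              (fun n => rho_interp (k n) (x (k n))) rho /\
            weakstar_Linfty (leb2 R) (open_strip T)
              (fun n => e1_interp T (k n) (x (k n))) e1 &
            weakstar_measures T
              (fun n z => e1_interp T (k n) (x (k n)) z
                            / theta (rho_interp (k n) (x (k n)) z))
              (fun z => gamma^-1 * (rho z * F z))],
        [/\ ('N[leb1 R]_+oo [EFin \o rho0] <= rhobar%:E)%E,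
            {ae leb1 R, forall y, 0 <= rho0 y} &
            compact (ess_supp (almost_everywhere (leb1 R)) rho0)],
        [/\ {ae leb2 R, forall z, open_strip T z -> 0 <= rho z /\ 0 <= e1 z},
            ('N[leb2 R]_+oo [EFin \o (rho \_ (open_strip T))] <= rhobar%:E)%E &
            let region :=
              [set z : R * R | z.1 \in `[0, T] /\ xlow z.1 <= z.2 <= xhigh z.1] in
            ess_supp (almost_everywhere (leb2 R)) (rho \_ (open_strip T))
              `<=` region /\
            ess_supp (almost_everywhere (leb2 R)) (e1 \_ (open_strip T))
              `<=` region] &
        transport_solution T rho0 rho e1].
Proof.
have hT' := ltW hT; have r0 : 0 <= rhobar := ltW (rhobar_gt0 hnl).
(* The data for [N = 1] already force this inequality. *)
have sS : s <= S.
  by have [h1 h2 h3] := positions_bounds (hdata 1%N isT); exact: le_trans h1 (le_trans h2 h3).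
have cF := F_continuous hnl.
have [Fm Fm0 FM] := box_ext_bounded hT' sS cF.
have Fb t y : t \in `[0, T] -> y \in `[s, S] -> F (t, y) <= Fm.
  by move=> tT yS; rewrite -(box_extE _ tT yS); exact: le_trans (ler_norm _) (FM _).
(* The larger of the leader's bound and the uniform form of the followers' bound; it is the common
   Lipschitz constant for all [N]. *)
pose L := Num.max C0 (sup (theta @` `[0, rhobar]) / gamma * Fm).
have L0 : 0 <= L by rewrite le_max ltW.
have tr N (N0 : (0 < N)%N) : trajectories T s S L rhobar N (x N).
  exact: (micro_trajectories hT hgamma (heps N N0) N0 hC0 (ltW Fm0) hnl
    (hdata N N0) (hsol N N0) (hspeed N N0) Fb).
have [k [rho0 [rho [e1 [[k0 hk] ck lim_rho0 lim_rho lim_e1]]]]] :=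
  extraction hT L0 r0 tr.
have [xlow ulow [clow _]] := equilipschitz_uniform_cvg hT L0
  (fun n => traj_lipschitz (tr _ (k0 n)) (leq0n _)) (fun q => (ck q).1).
have [xhigh uhigh [chigh _]] := equilipschitz_uniform_cvg hT L0
  (fun n => traj_lipschitz (tr _ (k0 n)) (leqnn _)) (fun q => (ck q).2).
have box_strip : spacetime_box T s S `<=` open_strip T by move=> z [? _]; split.
(* The limits vanish outside the box, which is smaller than the open strip, so restricting them to
   the strip changes nothing. *)
have strip_vanish (f : R * R -> R) : (forall z, ~ spacetime_box T s S z -> f z = 0) ->
    f \_ (open_strip T) = f.
  by move=> fD; apply: restrict_id => z nz; apply: fD => /box_strip.
have [_ rho0M rho0D _ _] := lim_rho0.
have [_ rhoM rhoD _ _] := lim_rho.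
have [_ e1M e1D _ _] := lim_e1.
exists k, xlow, xhigh, rho0, rho, e1; split.
- by [].
- split.
  + by [].
  + apply: (weakstar_density_limit (D := space_box s S) (M := rhobar)
      (u := fun n => rho_init x (k n))) => //.
    * by move=> n; exact: measurable_rho_interp0.
    * by move=> n y; exact: (rho_interp0_bounds (k0 n) hT r0 (tr _ (k0 n))).
    * by move=> n y; exact: (rho_interp0_supp (k0 n) hT (tr _ (k0 n))).
  + split.
    * apply: (weakstar_density_limit r0 (measurable_open_strip T) box_strip
        (fun n => rho_cells_measurable tr (k0 n)) (fun n z => rho_cells_bounds r0 tr z (k0 n))
        (fun n z nz => cell_sum_supp (tr _ (k0 n)) _ nz) _ lim_rho).
      by move=> n z [zT _]; exact: rho_interpE.
    * apply: (weakstar_density_limit (mulr_ge0 L0 r0) (measurable_open_strip T) box_strip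
        (fun n => e1_cells_measurable tr (k0 n)) (fun n z => e1_cells_bounds L0 r0 tr z (k0 n))
        (fun n z nz => cell_sum_supp (tr _ (k0 n)) _ nz) _ lim_e1).
      by move=> n z [zT _]; exact: e1_interpE.
  + apply: (weakstar_flux hT L0 sS hgamma (ltW Fm0) heps heps0 cF FM tr _ k0 hk lim_rho).
    move=> N i N0; exact: (micro_flux hT hgamma (heps N N0) N0 (ltW Fm0) sS hnl
      (hdata N N0) (hsol N N0) FM (tr N N0)).
- split.
  + apply: Lnorm_infty_le => // y; have /andP[h1 h2] := rho0M y.
    by rewrite ger0_norm.
  + by apply: nearW => y; have /andP[] := rho0M y.
  + apply: (subclosed_compact _ (@segment_compact R s S)).
      exact: ess_supp_closed.
    apply: ess_supp_sub rho0D; last exact: interval_closed.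
    exact: (@ae_filter_ringOfSetsType _ (measurableTypeR R) R (leb1 R)).
- rewrite !strip_vanish//; split.
  + apply: nearW => z _; have /andP[h1 _] := rhoM z; have /andP[h2 _] := e1M z.
    by split.
  + apply: Lnorm_infty_le => // z; have /andP[h1 h2] := rhoM z.
    by rewrite ger0_norm.
  + split.
      exact: (ess_supp_between (h := fun _ _ _ => 1) L0 tr k0 clow chigh lim_rho).
    exact: (ess_supp_between (h := fun N => vel T (x N)) L0 tr k0 clow chigh lim_e1).
- apply: (transport_solution_limit hT sS lim_rho0 lim_rho lim_e1).
  by move=> phi; exact: (transport_limit hT L0 sS tr k0 hk lim_rho0 lim_rho lim_e1).
Qed.
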